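(* Let $N\in\mathbb{N}^*$, let $-\frac1{\sqrt2}<\lambda_1<\dots<\lambda_N<\frac1{\sqrt2}$ and let $\mu_1,\dots,\mu_N$ be strictly negative real numbers. Let $\beta:\mathbb{R}\to\mathbb{C}$ be such that the function $\xi\mapsto\beta(\lambda(\xi))$, with $\lambda(\xi)=\sqrt{\xi^2+\frac12}$, belongs to $L^1(\mathbb{R})\cap L^2(\mathbb{R})$. Let $n\ge 0$ be an integer such that $$\lambda\mapsto\lambda^{n+2}\beta(\lambda)\in L^\infty([\tfrac1{\sqrt2},+\infty[).$$ There exists a constant $\epsilon_0>0$, depending on $N$, $n$, the $\lambda_i$ and the $\mu_i$, such that if $$\|\lambda^n\beta(\cdot)\|_{L^\infty([\frac{1}{\sqrt2},+\infty[)}\le\epsilon_0,$$ then for every $x\in\mathbb{R}$ the Marchenko system with parameter $x$ (for $y\ge x$) $$\left\{\begin{array}{l} 2\sqrt2\,\Psi_1(x,y)=F_2(x+y)-\int_x^{+\infty}\left[\sqrt2\,\Psi_2(x,s)(F_1(s+y)-iF_2'(s+y))+\Psi_1(x,s)F_2(s+y)\right]ds,\\ 2\sqrt2\,\Psi_2(x,y)=\sqrt2(F_1(x+y)+iF_2'(x+y))-\int_x^{+\infty}\left[\sqrt2\,\Psi_1(x,s)(F_1(s+y)+iF_2'(s+y))+\Psi_2(x,s)F_2(s+y)\right]ds \end{array}\right.$$ has a unique solution $\Psi(x,\cdot)=(\Psi_1(x,\cdot),\Psi_2(x,\cdot))\in (H^n((x,+\infty)))^2$. Moreover, the function $$\underline{\Psi}:\mathbb{R}\times\mathbb{R}^+\to\mathbb{C}^2,\qquad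 \underline\Psi(x,p)=\Psi(x,x+p),$$ belongs (as a function of $x$ with values in functions of $p$) to $\mathcal{C}^k(\mathbb{R},(H^{n-k}(\mathbb{R}^+))^2)$ for $k\in\{0,\dots,n-1\}$.
   Context: For $\xi\in\mathbb{R}$ set $\lambda=\lambda(\xi)=\sqrt{\xi^2+\frac12}$, $c_1(\xi)=\beta(\lambda)+\beta(-\lambda)$, $c_2(\xi)=\frac{\beta(\lambda)-\beta(-\lambda)}{\lambda}$. With $\nu_k=\sqrt{\frac12-\lambda_k^2}$, define the functions of a real variable $$F_{11}(z)=\sum_{k=1}^N\mu_k\lambda_ke^{-\nu_kz},\qquad F_{12}(z)=\frac1{2\pi}\int_{-\infty}^{+\infty}c_1(\xi)e^{i\xi z}d\xi,$$ $$F_{21}(z)=\sum_{k=1}^N\mu_ke^{-\nu_kz},\qquad F_{22}(z)=\frac1{2\pi}\int_{-\infty}^{+\infty}c_2(\xi)e^{i\xi z}d\xi,$$ $$F_1=F_{12}-F_{11},\qquad F_2=F_{22}-F_{21}.$$ $H^m$ denotes the usual $L^2$-based Sobolev space of complex-valued functions on the indicated half-line.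
   Formalization: The hypotheses on β (L¹ and L² of β(λ(ξ)), boundedness of λ^{n+2}β, smallness of λ^nβ) are also required on the negative branch, for β(−λ(ξ)) and λ ≤ −1/√2; without this F₁₂, F₂₂ may be undefined and the claim can fail. *)

(* Defs.v *)
From HB Require Import structures.
From mathcomp Require Import all_boot all_order all_algebra.
From mathcomp Require Import complex.
From mathcomp Require Import all_classical all_reals all_analysis.

Set Implicit Arguments.
Unset Strict Implicit.
Unset Printing Implicit Defensive.

Import Order.TTheory GRing.Theory Num.Theory.
Import numFieldNormedType.Exports.
Local Open Scope classical_set_scope.
Local Open Scope ring_scope.
Local Open Scope complex_scope.

Section ComplexValuedFunctions.
Context {R : realType}.
Local Notation C := R[i].
Local Notation leb := (@lebesgue_measure R).
Implicit Types (D : set R) (f g : R -> C).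

Definition cint D f : C :=
  (\int[leb]_(x in D) complex.Re (f x)) +i* (\int[leb]_(x in D) complex.Im (f x)).

Definition cderiv f : R -> C := fun x =>
  derive1 (fun t => complex.Re (f t)) x +i* derive1 (fun t => complex.Im (f t)) x.

Definition cis (t : R) : C := cos t +i* sin t.

Definition cmeasurable D f :=
  measurable_fun D (fun x => complex.Re (f x)) /\
  measurable_fun D (fun x => complex.Im (f x)).

(* The extension by zero outside D has the L^p(D) norm of f, also for p = +oo
   since |f| is nonnegative. *)
Definition cLnorm D (p : \bar R) f : \bar R :=
  Lnorm leb p ((fun x => (Normc.normc (f x))%:E) \_ D).

Definition inLp D (p : \bar R) f := cmeasurable D f /\ (cLnorm D p f < +oo)%E.

End ComplexValuedFunctions.

(* Elements of the Sobolev spaces H^m((a, +oo)) are represented by functions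
   on R, of which only the a.e. class on (a, +oo) matters. *)
Section Sobolev.
Context {R : realType}.
Local Notation C := R[i].
Implicit Types (a : R) (f : R -> C) (g : nat -> R -> C).

(* Real-valued test functions suffice, by linearity. *)
Definition test_function a (phi : R -> R) :=
  (forall (j : nat) (x : R), derivable (derive1n j phi) x 1) /\
  exists b c : R, a < b /\ forall x, phi x != 0 -> b <= x <= c.

Definition weak_derivative a (j : nat) f (fj : R -> C) :=
  forall phi : R -> R, test_function a phi ->
    cint `]a, +oo[ (fun x => f x * (derive1n j phi x)%:C) =
    (- 1) ^+ j * cint `]a, +oo[ (fun x => fj x * (phi x)%:C).

Definition weak_jet (m : nat) a f g :=
  g 0%N = f /\
  forall j : nat, (j <= m)%N ->
    inLp `]a, +oo[ 2%:E (g j) /\ weak_derivative a j f (g j).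

Definition in_sobolev (m : nat) a f := exists g, weak_jet m a f g.

(* Weak derivatives are unique up to null sets, so on H^m the infimum is taken
   over a single value, the usual Hilbertian norm; off H^m it is +oo. *)
Definition sobolev_norm (m : nat) a f : \bar R :=
  ereal_inf [set ((\sum_(j < m.+1) cLnorm `]a, +oo[ 2%:E (g j) `^ 2) `^ 2^-1)%E
            | g in weak_jet m a f].

Definition in_sobolev2 (m : nat) a (w : R -> C * C) :=
  in_sobolev m a (fun p => (w p).1) /\ in_sobolev m a (fun p => (w p).2).

Definition sobolev2_norm (m : nat) a (w : R -> C * C) : \bar R :=
  (sobolev_norm m a (fun p => (w p).1) + sobolev_norm m a (fun p => (w p).2))%E.

(* u is of class C^k from R to (H^m((0, +oo)))^2: the v j are the successive
   derivatives of u, the difference quotients converging in the norm of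
   (H^m((0, +oo)))^2. *)
Definition Ck_sobolev2 (k m : nat) (u : R -> R -> C * C) :=
  exists v : nat -> R -> R -> C * C,
    [/\ v 0%N = u,
        forall (j : nat) (x : R), (j <= k)%N -> in_sobolev2 m 0 (v j x),
        forall (j : nat) (x : R), (j < k)%N ->
          sobolev2_norm m 0
            (fun p => (h^-1)%:C *: (v j (x + h) p - v j x p) - v j.+1 x p)
            @[h --> (0 : R)^'] --> 0%E
      & forall x : R,
          sobolev2_norm m 0 (fun p => v k (x + h) p - v k x p)
            @[h --> (0 : R)^'] --> 0%E].

End Sobolev.

Section Marchenko.
Context {R : realType} (N : nat) (lam mu : 'I_N -> R) (beta : R -> R[i]).
Local Notation C := R[i].

Definition lambda_of (xi : R) : R := Num.sqrt (xi ^+ 2 + 2^-1).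

Definition c1 (xi : R) : C := beta (lambda_of xi) + beta (- lambda_of xi).

Definition c2 (xi : R) : C :=
  (beta (lambda_of xi) - beta (- lambda_of xi)) / (lambda_of xi)%:C.

Definition nu (k : 'I_N) : R := Num.sqrt (2^-1 - lam k ^+ 2).

Definition F11 (z : R) : C := (\sum_(k < N) mu k * lam k * expR (- nu k * z))%:C.

Definition F12 (z : R) : C :=
  (2 * pi)^-1%:C * cint setT (fun xi => c1 xi * cis (xi * z)).

Definition F21 (z : R) : C := (\sum_(k < N) mu k * expR (- nu k * z))%:C.

Definition F22 (z : R) : C :=
  (2 * pi)^-1%:C * cint setT (fun xi => c2 xi * cis (xi * z)).

Definition F1 (z : R) : C := F12 z - F11 z.

Definition F2 (z : R) : C := F22 z - F21 z.

Definition marchenko_eq1 (x : R) (Psi : R -> C * C) (y : R) : Prop :=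
  (2 * Num.sqrt 2)%:C * (Psi y).1 =
  F2 (x + y) -
  cint `]x, +oo[ (fun s =>
    (Num.sqrt 2)%:C * (Psi s).2 * (F1 (s + y) - 'i * cderiv F2 (s + y)) +
    (Psi s).1 * F2 (s + y)).

Definition marchenko_eq2 (x : R) (Psi : R -> C * C) (y : R) : Prop :=
  (2 * Num.sqrt 2)%:C * (Psi y).2 =
  (Num.sqrt 2)%:C * (F1 (x + y) + 'i * cderiv F2 (x + y)) -
  cint `]x, +oo[ (fun s =>
    (Num.sqrt 2)%:C * (Psi s).1 * (F1 (s + y) + 'i * cderiv F2 (s + y)) +
    (Psi s).2 * F2 (s + y)).

(* Psi is the function Psi(x, .) of the second variable; as an identity in
   (H^n((x, +oo)))^2 the system is required for almost every y > x. *)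
Definition marchenko_solution (n : nat) (x : R) (Psi : R -> C * C) : Prop :=
  in_sobolev2 n x Psi /\
  \forall y \ae (@lebesgue_measure R), x < y ->
    marchenko_eq1 x Psi y /\ marchenko_eq2 x Psi y.

End Marchenko.

(* Both sheets lambda >= 1/sqrt 2 and lambda <= -1/sqrt 2 contribute to c1 and
   c2. *)
Definition continuous_spectrum {R : realType} : set R :=
  [set l : R | (Num.sqrt 2)^-1 <= `|l|].

(* Main.v *)
(* In the variable p = y - x the Marchenko system reads 2 sqrt 2 u + T_x u = b_x
   in L^2 of the half-line, where T_x is the Hankel operator with kernel
   G(2 x + s + p), G being a 2 x 2 matrix built from F_1, F_2 and F_2'.  Since
   mu_k < 0 and |sqrt 2 (lambda_k + i nu_k)| = 1, the discrete part of G is a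
   positive combination of kernels e^(- nu_k (s + p)) v v^*, so it contributes a
   nonnegative operator.  The continuous part is the Fourier transform of a
   bounded symbol; by the Plancherel inequality its norm is at most a constant
   times eps_0.  Hence the operator is coercive, which gives existence and
   uniqueness in L^2.

   The decay of beta gives n derivatives of the kernel in the operator norm, with
   increments of order h and Taylor remainders of order h^2.  Differentiating
   u = (b_x - T_x u) / (2 sqrt 2) in p puts the solution in H^n; differentiating
   the equation in x shows that u and the p-derivatives up to order l are C^(n-l)
   in x with values in L^2, and weak derivatives pass to the limit in L^2. *)
Require Import Defs.
From HB Require Import structures.
From mathcomp Require Import all_boot all_order all_algebra.
From mathcomp Require Import complex.
From mathcomp Require Import all_classical all_reals all_analysis.
From mathcomp Require Import ring lra measurable_realfun ess_sup_inf.
Import Order.TTheory GRing.Theory Num.Theory.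
Import numFieldNormedType.Exports.
Set Implicit Arguments.
Unset Strict Implicit.
Unset Printing Implicit Defensive.
Local Open Scope classical_set_scope.
Local Open Scope ring_scope.

(** * Coercive operators and smooth curves in a semi-inner product space *)
Section SemiInner.
Context {R : realType} {X : lmodType R} (ip : X -> X -> R).

(** Functions are never identified modulo null sets. The spaces carry only a semi-inner product, an
    equation is solved when its defect has seminorm 0, and smoothness in x is expressed by explicit
    bounds of order |h| on increments and |h|^2 on Taylor remainders, so no topology on the spaces
    is involved. A pair of complex functions is split into four real components, which makes the
    operator a real 4 x 4 matrix of Hankel operators.

    The exponent n + 2 is what these bounds consume: n powers of xi for the derivatives of the
    kernel, one for |e^(i h xi) - 1| <= |h xi|, and one for the square integrability of the
    resulting kernel. A Taylor remainder costs one power more, but occurs only up to order n - 1.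

    The bound eps_0 can be chosen from n alone, since the discrete part has a favourable sign and
    the continuous part only has to stay below 2 sqrt 2. Essential bounds in lambda become bounds at
    almost every xi because xi -> lambda(xi) expands distances, up to a constant, away from its
    critical point 0. *)

Definition semi_inner :=
  [/\ forall u v, ip u v = ip v u,
      forall u v w, ip (u + v) w = ip u w + ip v w,
      forall a u v, ip (a *: u) v = a * ip u v
    & forall u, 0 <= ip u u].

Definition sn u := Num.sqrt (ip u u).

(** Completeness restricted to sequences with geometric steps, which is what a contraction produces.
    The limit inherits the rate; it is not unique, [sn] being a seminorm. *)
Definition fast_complete := forall (u : nat -> X) (C q : R),
  0 <= q < 1 -> (forall k, sn (u k.+1 - u k) <= C * q ^+ k) ->
  exists l C', forall k, sn (l - u k) <= C' * q ^+ k.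

Hypothesis H : semi_inner.

Lemma ipC u v : ip u v = ip v u. Proof. by case: H. Qed.
Lemma ipDl u v w : ip (u + v) w = ip u w + ip v w. Proof. by case: H. Qed.
Lemma ipZl a u v : ip (a *: u) v = a * ip u v. Proof. by case: H. Qed.
Lemma ip_ge0 u : 0 <= ip u u. Proof. by case: H. Qed.
Lemma ipDr u v w : ip w (u + v) = ip w u + ip w v.
Proof. by rewrite ipC ipDl !(ipC w). Qed.
Lemma ipZr a u v : ip v (a *: u) = a * ip v u.
Proof. by rewrite ipC ipZl ipC. Qed.
Lemma ipNl u v : ip (- u) v = - ip u v.
Proof. by rewrite -scaleN1r ipZl mulN1r. Qed.
Lemma ipNr u v : ip v (- u) = - ip v u.
Proof. by rewrite ipC ipNl ipC. Qed.

Lemma sn_ge0 u : 0 <= sn u. Proof. exact: sqrtr_ge0. Qed.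
Lemma sn_sqr u : sn u ^+ 2 = ip u u.
Proof. by rewrite sqr_sqrtr // ip_ge0. Qed.

Lemma sn_le u c : 0 <= c -> ip u u <= c ^+ 2 -> sn u <= c.
Proof.
by move=> c0 h; rewrite -(ger0_norm c0) -sqrtr_sqr ler_sqrt // sqr_ge0.
Qed.

Lemma snZ a u : sn (a *: u) = `|a| * sn u.
Proof.
rewrite /sn ipZl ipZr mulrA -expr2 sqrtrM ?sqr_ge0 // sqrtr_sqr //.
Qed.

Lemma snN u : sn (- u) = sn u.
Proof. by rewrite -scaleN1r snZ normrN1 mul1r. Qed.

Lemma sn0 : sn 0 = 0.
Proof. by rewrite -(scale0r 0) snZ normr0 mul0r. Qed.

(** A vector [v] with [ip v v = 0] need not be 0. In that case a nonzero [ip u v] would make the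
    square of [u - t *: v] equal to -1 for the [t] chosen below; otherwise one expands the square of
    [ip v v *: u - ip u v *: v]. *)
Lemma cauchy_schwarz_sq u v : ip u v ^+ 2 <= ip u u * ip v v.
Proof.
have [v0|v0] := eqVneq (ip v v) 0.
- have [uv0|uv0] := eqVneq (ip u v) 0; first by rewrite uv0 v0 mulr0 expr0n.
  have := ip_ge0 (u - ((ip u u + 1) / (2 * ip u v)) *: v).
  rewrite ipDl !ipDr !ipNl !ipNr !ipZl !ipZr v0 (ipC v u).
  set t := _ / _.
  have -> : ip u u + - (t * ip u v) + (- (t * ip u v) - - (t * (t * 0))) = -1.
    by rewrite /t; field.
  by lra.
- have := ip_ge0 (ip v v *: u - ip u v *: v).
  rewrite ipDl !ipDr !ipNl !ipNr !ipZl !ipZr (ipC v u).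
  have := ip_ge0 v; rewrite le_eqVlt eq_sym (negbTE v0) /= => vp.
  set e := (X in 0 <= X) => e0.
  have : 0 <= ip v v * (ip u u * ip v v - ip u v ^+ 2).
    by rewrite (_ : _ * _ = e) // /e; ring.
  by rewrite pmulr_rge0 // subr_ge0.
Qed.

Lemma cauchy_schwarz u v : `|ip u v| <= sn u * sn v.
Proof.
rewrite -sqrtr_sqr -sqrtrM ?ip_ge0 // ler_wsqrtr //; exact: cauchy_schwarz_sq.
Qed.

Lemma ler_snD u v : sn (u + v) <= sn u + sn v.
Proof.
apply: sn_le; first by rewrite addr_ge0 // sn_ge0.
rewrite ipDl !ipDr sqrrD !sn_sqr (ipC v u).
have := le_trans (ler_norm _) (cauchy_schwarz u v); lra.
Qed.

Lemma ler_snB u v : sn (u - v) <= sn u + sn v.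
Proof. by apply: le_trans (ler_snD _ _) _; rewrite snN. Qed.

Lemma ler_sn_triangle u v w : sn (u - w) <= sn (u - v) + sn (v - w).
Proof. by apply: le_trans (ler_snD _ _); rewrite addrA subrK. Qed.

Lemma snB u v : sn (u - v) = sn (v - u).
Proof. by rewrite -snN opprB. Qed.

Lemma geometric_le0 (x C q : R) : 0 <= q < 1 -> (forall k, x <= C * q ^+ k) ->
  x <= 0.
Proof.
move=> /andP[q0 q1] h.
have qc : (fun k => C * q ^+ k) @ \oo --> (0 : R).
  by apply: cvg_geometric; rewrite ger0_norm.
rewrite leNgt; apply/negP => x0.
move/cvgrPdist_lt: qc => /(_ x x0) [k _ /(_ k)] /= /(_ (leqnn _)).
by rewrite sub0r normrN => /(le_lt_trans (ler_norm _)); rewrite ltNge h.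
Qed.

Lemma sn_eq0_ip u v : sn u = 0 -> ip u v = 0.
Proof.
move=> u0; apply/eqP; rewrite -normr_le0.
by apply: le_trans (cauchy_schwarz u v) _; rewrite u0 mul0r.
Qed.

Definition islin (L : X -> X) :=
  (forall u v, L (u + v) = L u + L v) /\ (forall a u, L (a *: u) = a *: L u).

Lemma islinN L u : islin L -> L (- u) = - L u.
Proof. by case=> _ LZ; rewrite -scaleN1r LZ scaleN1r. Qed.

Lemma islinB L u v : islin L -> L (u - v) = L u - L v.
Proof. by move=> HL; have [LD _] := HL; rewrite LD islinN. Qed.

Lemma coercive_le L (a : R) u : 0 < a -> a * ip u u <= ip (L u) u ->
  a * sn u <= sn (L u).
Proof.
move=> a0 h; have [u0|u0] := eqVneq (sn u) 0.
  by rewrite u0 mulr0 sn_ge0.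
have up : 0 < sn u by rewrite lt0r u0 sn_ge0.
rewrite -(ler_pM2r up) -mulrA -expr2 sn_sqr (le_trans h) //.
exact: le_trans (ler_norm _) (cauchy_schwarz _ _).
Qed.

(* Richardson's iteration u -> u - t (L u - w) is a contraction for small t. *)
Lemma coercive_surj L (a M : R) : fast_complete -> islin L -> 0 < a ->
  (forall u, sn (L u) <= M * sn u) ->
  (forall u, a * ip u u <= ip (L u) u) ->
  forall w, exists v, sn (L v - w) = 0.
Proof.
move=> cX linL a0 LM La w.
have [LD LZ] := linL.
(* [M1 >= a > 0] ensures that [q2] below lies in [0, 1). *)
pose M1 := `|M| + a.
have M1p : 0 < M1 by rewrite ltr_wpDl.
have LM1 u : sn (L u) <= M1 * sn u.
  apply: le_trans (LM u) _; rewrite ler_wpM2r ?sn_ge0 //.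
  by rewrite (le_trans (ler_norm _)) // lerDl ltW.
(* The squared norm of [u - t *: L u] is at most 1 - 2 a t + M1^2 t^2 times that of [u]; this [t]
   minimises the factor, and the minimum is [q2]. *)
pose t := a / M1 ^+ 2.
have t0 : 0 < t by rewrite divr_gt0 // exprn_gt0.
pose q2 := 1 - (a / M1) ^+ 2.
have aM : 0 < a / M1 <= 1.
  by rewrite divr_gt0 //= ler_pdivrMr // mul1r /M1 lerDr.
have q20 : 0 <= q2 < 1.
  move: aM => /andP[h1 h2]; rewrite /q2; apply/andP; split; last first.
    by rewrite ltrBlDr ltrDl exprn_gt0.
  by rewrite subr_ge0 expr_le1 // ltW.
pose q := Num.sqrt q2.
have q01 : 0 <= q < 1.
  rewrite sqrtr_ge0 /= -sqrtr1 ltr_sqrt //; by case/andP: q20.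
have contr u : sn (u - t *: L u) <= q * sn u.
  apply: sn_le; first by rewrite mulr_ge0 ?sn_ge0 //; case/andP: q01.
  rewrite exprMn sn_sqr sqr_sqrtr; last by case/andP: q20.
  rewrite ipDl !ipDr !ipNl !ipNr !ipZl !ipZr (ipC u (L u)).
  have e1 : ip (L u) (L u) <= M1 ^+ 2 * ip u u.
    rewrite -!sn_sqr -exprMn lerXn2r ?nnegrE ?mulr_ge0 ?sn_ge0 //.
    exact: ltW.
  have e2 := La u.
  have tE : t * M1 ^+ 2 = a by rewrite /t divfK // expf_neq0 // gt_eqF.
  have e3 : t * ip (L u) (L u) <= a * ip u u.
    by rewrite -tE -mulrA ler_pM2l.
  have -> : q2 = 1 - t * a by rewrite /q2 /t; field; rewrite gt_eqF.
  have e4 : t * (t * ip (L u) (L u)) <= t * (a * ip u u) by rewrite ler_pM2l.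
  have e5 : t * (a * ip u u) <= t * ip (L u) u by rewrite ler_pM2l.
  lra.
pose S u := u - t *: (L u - w).
have SB u v : S u - S v = (u - v) - t *: L (u - v).
  rewrite /S (islinB _ _ linL) opprD addrACA; congr (_ + _).
  by rewrite -opprD -scalerBr opprB addrA subrK.
pose u_ k := iter k S 0.
pose C := sn (u_ 1%N - u_ 0%N).
have du k : sn (u_ k.+1 - u_ k) <= C * q ^+ k.
  elim: k => [|k IH]; first by rewrite expr0 mulr1.
  rewrite /u_ iterS [in X in _ - X]iterS SB (le_trans (contr _)) //.
  by rewrite exprS mulrCA ler_wpM2l //; case/andP: q01.
have [l [C1 hl]] := cX _ _ _ q01 du.
exists l; apply/eqP; rewrite eq_le sn_ge0 andbT.
apply: (@geometric_le0 _ (M1 * C1 + t^-1 * C) q q01) => k.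
(* The defect of the limit does not depend on [k], while both terms on the right decay like
   [q ^+ k]. *)
have -> : L l - w = L (l - u_ k) + t^-1 *: (u_ k - u_ k.+1).
  rewrite (islinB _ _ linL) /u_ iterS /S opprB addrCA subrr addr0.
  by rewrite scalerA mulVf ?gt_eqF // scale1r addrA subrK.
rewrite mulrDl; apply: le_trans (ler_snD _ _) _; apply: lerD.
  apply: le_trans (LM1 _) _; rewrite -mulrA ler_wpM2l //; exact: ltW.
rewrite snZ gtr0_norm ?invr_gt0 // snB -mulrA ler_wpM2l // invr_ge0; exact: ltW.
Qed.

Lemma snD_le u v (a b : R) : sn u <= a -> sn v <= b -> sn (u + v) <= a + b.
Proof. by move=> ? ?; apply: le_trans (ler_snD _ _) _; exact: lerD. Qed.

Lemma snZ_le (a : R) u (b c : R) : `|a| <= b -> sn u <= c ->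
  sn (a *: u) <= b * c.
Proof. by move=> ? ?; rewrite snZ ler_pM // sn_ge0. Qed.

Section Smooth.

(** The constant may depend on [x], the range of [h] may not; explicit rates can be added and
    composed with operators without any limit argument. *)
Definition rate0 (w : R -> X) := forall x, exists C, 0 <= C /\
  forall h, `|h| <= 1 -> sn (w (x + h) - w x) <= C * `|h|.

Definition rate1 (w w' : R -> X) := forall x, exists C, 0 <= C /\
  forall h, `|h| <= 1 -> sn (w (x + h) - w x - h *: w' x) <= C * `|h| ^+ 2.

(** Slightly stronger than class C^k, since the last derivative has increments of order [h], and
    stable under the operations below. *)
Fixpoint smooth k w := if k is k'.+1 then
  exists w', rate1 w w' /\ smooth k' w' else rate0 w.

Lemma rate1_rate0 w w' : rate1 w w' -> rate0 w.
Proof.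
move=> r x; have [C [C0 hC]] := r x.
exists (C + sn (w' x)); split; first by rewrite addr_ge0 ?sn_ge0.
move=> h h1; rewrite -[w (x + h) - w x](subrK (h *: w' x)) mulrDl.
apply: snD_le; last by rewrite snZ mulrC.
apply: le_trans (hC _ h1) _; rewrite ler_wpM2l // expr2 ler_piMr //.
Qed.

Lemma smoothW k w : smooth k.+1 w -> smooth k w.
Proof.
elim: k w => [|k IH] w; first by case=> w' [+ _]; exact: rate1_rate0.
by move=> [w' [r s]]; exists w'; split => //; exact: IH.
Qed.

Lemma rate0D w1 w2 : rate0 w1 -> rate0 w2 -> rate0 (fun x => w1 x + w2 x).
Proof.
move=> r1 r2 x; have [C1 [C10 h1]] := r1 x; have [C2 [C20 h2]] := r2 x.
exists (C1 + C2); split; first exact: addr_ge0.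
move=> h hh; rewrite opprD addrACA mulrDl; apply: snD_le; [exact: h1|exact: h2].
Qed.

Lemma rate1D w1 w1' w2 w2' : rate1 w1 w1' -> rate1 w2 w2' ->
  rate1 (fun x => w1 x + w2 x) (fun x => w1' x + w2' x).
Proof.
move=> r1 r2 x; have [C1 [C10 h1]] := r1 x; have [C2 [C20 h2]] := r2 x.
exists (C1 + C2); split; first exact: addr_ge0.
move=> h hh; rewrite opprD (addrACA (w1 (x + h))) scalerDr (opprD (h *: _)).
rewrite (addrACA (_ - _)) mulrDl.
by apply: snD_le; [exact: h1|exact: h2].
Qed.

Lemma rate0Z a w : rate0 w -> rate0 (fun x => a *: w x).
Proof.
move=> r x; have [C [C0 hC]] := r x.
exists (`|a| * C); split; first exact: mulr_ge0.
by move=> h hh; rewrite -scalerBr -mulrA; apply: snZ_le => //; exact: hC.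
Qed.

Lemma rate1Z a w w' : rate1 w w' ->
  rate1 (fun x => a *: w x) (fun x => a *: w' x).
Proof.
move=> r x; have [C [C0 hC]] := r x.
exists (`|a| * C); split; first exact: mulr_ge0.
move=> h hh; rewrite scalerA mulrC -scalerA -!scalerBr -mulrA.
by apply: snZ_le => //; exact: hC.
Qed.

Lemma smoothD k w1 w2 : smooth k w1 -> smooth k w2 ->
  smooth k (fun x => w1 x + w2 x).
Proof.
elim: k w1 w2 => [|k IH] w1 w2; first exact: rate0D.
move=> [w1' [r1 s1]] [w2' [r2 s2]].
exists (fun x => w1' x + w2' x); split; [exact: rate1D|exact: IH].
Qed.

Lemma smoothZ k a w : smooth k w -> smooth k (fun x => a *: w x).
Proof.
elim: k w => [|k IH] w; first exact: rate0Z.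
move=> [w' [r s]].
by exists (fun x => a *: w' x); split; [exact: rate1Z|exact: IH].
Qed.

Lemma smoothB k w1 w2 : smooth k w1 -> smooth k w2 ->
  smooth k (fun x => w1 x - w2 x).
Proof.
move=> s1 s2; have := smoothD s1 (smoothZ (-1) s2).
by under eq_fun do rewrite scaleN1r.
Qed.

(* The factor 2 comes from the dependence on x through 2 * x of the kernels. *)
Record opfam (n : nat) (T : nat -> R -> X -> X) := OpFam {
  opfam_lin : forall l x, (l <= n)%N -> islin (T l x) ;
  opfam_bd : forall l x, (l <= n)%N -> exists C, 0 <= C /\
    forall u, sn (T l x u) <= C * sn u ;
  opfam_r0 : forall l x, (l <= n)%N -> exists C, 0 <= C /\
    forall h u, `|h| <= 1 -> sn (T l (x + h) u - T l x u) <= C * `|h| * sn u ;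
  opfam_r1 : forall l x, (l < n)%N -> exists C, 0 <= C /\
    forall h u, `|h| <= 1 ->
      sn (T l (x + h) u - T l x u - h *: (2 *: T l.+1 x u))
        <= C * `|h| ^+ 2 * sn u }.

Variables (n : nat) (T : nat -> R -> X -> X).
Hypothesis HT : opfam n T.

Lemma opfam_bd_near l x : (l <= n)%N -> exists C, 0 <= C /\
  forall h u, `|h| <= 1 -> sn (T l (x + h) u) <= C * sn u.
Proof.
move=> ln; have [B [B0 hB]] := opfam_bd HT x ln.
have [C [C0 hC]] := opfam_r0 HT x ln.
exists (C + B); split; first exact: addr_ge0.
move=> h u h1; rewrite -[T l (x + h) u](subrK (T l x u)) mulrDl.
apply: snD_le (hB u); apply: le_trans (hC _ _ h1) _.
by rewrite ler_wpM2r ?sn_ge0 // ler_piMr.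
Qed.

Lemma rate0_op l w : (l <= n)%N -> rate0 w -> rate0 (fun x => T l x (w x)).
Proof.
move=> ln r x; have [C [C0 hC]] := r x.
have [B [B0 hB]] := opfam_bd_near x ln.
have [D [D0 hD]] := opfam_r0 HT x ln.
exists (B * C + D * sn (w x)); split.
  by rewrite addr_ge0 // mulr_ge0 // sn_ge0.
move=> h h1; rewrite -[T l (x + h) _](subrK (T l (x + h) (w x))).
rewrite -(islinB _ _ (opfam_lin HT _ ln)) -addrA mulrDl; apply: snD_le.
  by apply: le_trans (hB _ _ h1) _; rewrite -mulrA ler_wpM2l // hC.
by apply: le_trans (hD _ _ h1) _; rewrite mulrAC.
Qed.

Lemma rate1_op l w w' : (l < n)%N -> rate1 w w' ->
  rate1 (fun x => T l x (w x)) (fun x => 2 *: T l.+1 x (w x) + T l x (w' x)).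
Proof.
move=> ln r x; have [C [C0 hC]] := r x.
have [B [B0 hB]] := opfam_bd_near x (ltnW ln).
have [D [D0 hD]] := opfam_r0 HT x (ltnW ln).
have [E [E0 hE]] := opfam_r1 HT x ln.
exists (B * C + D * sn (w' x) + E * sn (w x)); split.
  by rewrite !addr_ge0 // mulr_ge0 // sn_ge0.
move=> h h1.
have [LD LZ] := opfam_lin HT (x + h) (ltnW ln).
have [y [hy ->]] : exists y, sn y <= C * `|h| ^+ 2 /\
    w (x + h) = y + w x + h *: w' x.
  by exists (w (x + h) - w x - h *: w' x); split; [exact: hC|rewrite addrAC !subrK].
rewrite !LD LZ.
(* Product rule with remainders: the operator on the Taylor remainder of [w], the increment of the
   operator on [h *: w' x], and the Taylor remainder of the operator on [w x]. *)
rewrite (_ : _ - _ - _ = T l (x + h) y +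
  h *: (T l (x + h) (w' x) - T l x (w' x)) +
  (T l (x + h) (w x) - T l x (w x) - h *: (2 *: T l.+1 x (w x)))); last first.
  rewrite scalerDr opprD scalerBr !addrA.
  by rewrite [RHS](ACl (1*4*2*5*6*3)).
rewrite !mulrDl; apply: snD_le; first apply: snD_le.
- by apply: le_trans (hB _ _ h1) _; rewrite -mulrA ler_wpM2l.
- rewrite snZ; apply: le_trans (ler_wpM2l (normr_ge0 h) (hD _ _ h1)) _.
  by rewrite le_eqVlt; apply/orP; left; apply/eqP; ring.
- by apply: le_trans (hE _ _ h1) _; rewrite mulrAC.
Qed.

(** A derivative falls either on the operator, raising [l], or on the curve; in both cases [k] drops
    by one and [k + l <= n] persists. *)
Lemma smooth_op k l w : (k + l <= n)%N -> smooth k w ->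
  smooth k (fun x => T l x (w x)).
Proof.
elim: k l w => [|k IH] l w kl; first exact: rate0_op.
move=> sw; have [w' [r s]] := sw.
have ln : (l < n)%N by apply: leq_trans kl; rewrite addSn ltnS leq_addl.
exists (fun x => 2 *: T l.+1 x (w x) + T l x (w' x)).
split; first exact: rate1_op.
apply: smoothD; first apply: smoothZ.
  by apply: IH (smoothW sw); rewrite addnS -addSn.
by apply: IH s; apply: leq_trans kl; rewrite leq_add2r.
Qed.

Variables (b a0 : R).
Hypotheses (a0_gt0 : 0 < a0) (cX : fast_complete).
Let L x u := b *: u + T 0 x u.
Hypothesis coer : forall x u, a0 * ip u u <= ip (L x u) u.

Let linL x : islin (L x).
Proof.
have [LD LZ] := opfam_lin HT x (leq0n n).
split=> [u v|a u]; rewrite /L.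
  by rewrite LD scalerDr addrACA.
by rewrite LZ scalerDr !scalerA mulrC.
Qed.

Lemma solve_exists x w : exists v, sn (L x v - w) = 0.
Proof.
have [B [B0 hB]] := opfam_bd HT x (leq0n n).
apply: (@coercive_surj (L x) a0 (`|b| + B)) => // u.
by rewrite mulrDl; apply: snD_le (hB u); rewrite snZ.
Qed.

Lemma solve_le x u : sn u <= a0^-1 * sn (L x u).
Proof. by rewrite mulrC ler_pdivlMr // mulrC; apply: coercive_le => //; exact: coer. Qed.

(** The inverse operators are never differentiated. Coercivity at [x + h], applied to the increment
    or to the Taylor remainder of [v], reduces the claim to estimates on [L (x + h)] of that vector,
    where the equations at [x] and [x + h] can be inserted. *)
Lemma smooth_solve k v w : (k <= n)%N ->
  (forall x, sn (L x (v x) - w x) = 0) -> smooth k w -> smooth k v.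
Proof.
have ai : 0 <= a0^-1 by rewrite invr_ge0 ltW.
elim: k v w => [|k IH] v w kn eqn sw.
- move=> x; have [C [C0 hC]] := sw x.
  have [D [D0 hD]] := opfam_r0 HT x (leq0n n).
  exists (a0^-1 * (C + D * sn (v x))); split.
    by rewrite mulr_ge0 // ?addr_ge0 ?mulr_ge0 ?sn_ge0.
  move=> h h1; apply: le_trans (solve_le (x + h) _) _.
  rewrite -mulrA ler_wpM2l // (islinB _ _ (linL _)).
  rewrite (_ : _ - _ = (L (x + h) (v (x + h)) - w (x + h)) +
    (w (x + h) - w x) - (L x (v x) - w x) -
      (T 0%N (x + h) (v x) - T 0%N x (v x))); last first.
    have <- : L (x + h) (v x) - L x (v x) =
      T 0%N (x + h) (v x) - T 0%N x (v x) by rewrite /L opprD addrACA subrr add0r.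
    by rewrite subrKA opprB subrKA opprB subrKA.
  rewrite mulrDl -[C * _]addr0 -[X in X + 0]add0r; apply: snD_le; last first.
    by rewrite snN; apply: le_trans (hD _ _ h1) _; rewrite mulrAC.
  apply: snD_le; last by rewrite snN eqn.
  by apply: snD_le; [rewrite eqn|exact: hC].
have sw0 := smoothW sw; have [w' [r s]] := sw.
have sv := IH _ _ (ltnW kn) eqn sw0.
(* Formal differentiation of [L x (v x) = w x] gives an equation for the derivative; a solution of
   that equation is taken as the candidate [v']. *)
have [v' hv'] := choice (fun x => solve_exists x (w' x - 2 *: T 1%N x (v x))).
exists v'; split; last first.
  apply: (IH _ _ (ltnW kn) hv'); apply: smoothB => //; apply: smoothZ.
  by apply: smooth_op => //; rewrite addn1.
move=> x; have [C [C0 hC]] := r x.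
have [D [D0 hD]] := opfam_r0 HT x (leq0n n).
have [E [E0 hE]] := @opfam_r1 _ _ HT 0%N x (leq_ltn_trans (leq0n k) kn).
exists (a0^-1 * (C + E * sn (v x) + D * sn (v' x))); split.
  by rewrite mulr_ge0 // ?addr_ge0 ?mulr_ge0 ?sn_ge0.
move=> h h1; apply: le_trans (solve_le (x + h) _) _.
rewrite -mulrA ler_wpM2l //.
have [LD LZ] := linL (x + h).
rewrite !(islinB _ _ (linL _)) LZ.
(* The six groups are: the equation at [x + h], the Taylor remainder of [w], the equation at [x],
   the Taylor remainder of the operator on [v x], the equation of [v' x], and the increment of the
   operator on [h *: v' x]. Three of them have seminorm 0. *)
have telescope (V : zmodType) (a e c f p l q g t : V) :
    a - e - t = (a - c) + (c - f - p) - (l - f) - (e - l - q)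
      - (g - (p - q)) - (t - g).
  rewrite !opprD !opprK !addrA.
  rewrite [RHS](ACl (1*8*14*(2*3)*(4*7)*(5*12)*(6*9)*(10*13)*(11*15)))/=.
  by rewrite !addNr !subrr !addr0.
rewrite (telescope _ _ _ (w (x + h)) (w x) (h *: w' x) (L x (v x))
  (h *: (2 *: T 1%N x (v x))) (h *: L x (v' x))) -!scalerBr.
have LT u : L (x + h) u - L x u = T 0%N (x + h) u - T 0%N x u.
  by rewrite /L opprD addrACA subrr add0r.
rewrite !LT !mulrDl.
apply: snD_le; last first.
  rewrite snN snZ; apply: le_trans (ler_wpM2l (normr_ge0 h) (hD _ _ h1)) _.
  by rewrite le_eqVlt; apply/orP; left; apply/eqP; ring.
rewrite -[C * _ + _]addr0; apply: snD_le; last by rewrite snN snZ hv' mulr0.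
apply: snD_le; last first.
  by rewrite snN; apply: le_trans (hE _ _ h1) _; rewrite mulrAC.
rewrite -[C * _]addr0; apply: snD_le; last by rewrite snN eqn.
by rewrite -[C * _]add0r; apply: snD_le; [rewrite eqn|exact: hC].
Qed.

End Smooth.
End SemiInner.

(** * Finite powers of a semi-inner product space *)

Section FinitePower.
Context {R : realType} {X : lmodType R} (ip : X -> X -> R) (I : finType).
Hypothesis H : semi_inner ip.

Definition ipv (u v : I -> X) : R := \sum_i ip (u i) (v i).

Lemma semi_inner_ipv : semi_inner ipv.
Proof.
split=> [u v|u v w|a u v|u]; rewrite /ipv.
- by apply: eq_bigr => i _; rewrite (ipC H).
- by rewrite -big_split; apply: eq_bigr => i _; rewrite (ipDl H).
- by rewrite mulr_sumr; apply: eq_bigr => i _; rewrite (ipZl H).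
- by apply: sumr_ge0 => i _; exact: ip_ge0.
Qed.

Lemma sn_comp_le (u : I -> X) i : sn ip (u i) <= sn ipv u.
Proof.
rewrite /sn ler_wsqrtr // /ipv (bigD1 i) //= lerDl.
by apply: sumr_ge0 => j _; exact: ip_ge0.
Qed.

Lemma sn_ipv_le (u : I -> X) (c : R) : 0 <= c ->
  (forall i, sn ip (u i) <= c) -> sn ipv u <= Num.sqrt #|I|%:R * c.
Proof.
move=> c0 h; apply: sn_le; first by rewrite mulr_ge0 ?sqrtr_ge0.
rewrite exprMn sqr_sqrtr ?ler0n // mulr_natl -sumr_const.
by apply: ler_sum => i _; rewrite -(sn_sqr H) lerXn2r ?nnegrE ?sn_ge0 ?h.
Qed.

Lemma fast_complete_ipv : fast_complete ip -> fast_complete ipv.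
Proof.
move=> cX u C q q01 uC.
have /choice[l hl] i : exists l, exists C', forall k, sn ip (l - u k i) <= C' * q ^+ k.
  by apply: (cX _ C q q01) => k; apply: le_trans (uC k); exact: (sn_comp_le (u k.+1 - u k)).
have /choice[C' hC] := hl.
exists l, (Num.sqrt #|I|%:R * \sum_i `|C' i|) => k.
rewrite -mulrA; apply: sn_ipv_le.
  by rewrite mulr_ge0 ?exprn_ge0 ?sumr_ge0 //; case/andP: q01.
move=> i; apply: le_trans (hC i k) _; rewrite ler_wpM2r ?exprn_ge0 //.
  by case/andP: q01.
apply: le_trans (ler_norm _) _; rewrite (bigD1 i) //= lerDl.
exact: sumr_ge0.
Qed.

End FinitePower.

(** * Square integrable functions *)
Section SquareIntegrable.
Context {d} {T : measurableType d} {R : realType}.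
Variable mu : {measure set T -> \bar R}.
Implicit Types f g : T -> R.

Definition nsq f : \bar R := (\int[mu]_x ((f x) ^+ 2)%:E)%E.

Definition sqint : {pred T -> R} :=
  fun f => `[< measurable_fun setT f /\ (nsq f < +oo)%E >].

Lemma sqintP f :
  reflect (measurable_fun setT f /\ (nsq f < +oo)%E) (f \in sqint).
Proof. exact: asboolP. Qed.

Lemma nsq_ge0 f : (0 <= nsq f)%E.
Proof. by apply: integral_ge0 => x _; rewrite lee_fin sqr_ge0. Qed.

Lemma measurable_sqr f : measurable_fun setT f ->
  measurable_fun setT (fun x => ((f x) ^+ 2)%:E).
Proof. by move=> mf; apply/measurable_EFinP; exact: measurable_funX. Qed.

Lemma nsq_le f g : measurable_fun setT f -> measurable_fun setT g ->
  (forall x, f x ^+ 2 <= g x ^+ 2) -> (nsq f <= nsq g)%E.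
Proof.
move=> mf mg h; apply: ge0_le_integral => //.
- by move=> x _; rewrite lee_fin sqr_ge0.
- exact: measurable_sqr.
- exact: measurable_sqr.
- by move=> x _; rewrite lee_fin.
Qed.

Lemma sqint_integrable f : f \in sqint ->
  mu.-integrable setT (EFin \o (fun x => f x ^+ 2)).
Proof.
move=> /sqintP[mf fy]; apply/integrableP; split; first exact: measurable_sqr.
apply: le_lt_trans fy; apply: ge0_le_integral => //.
- by apply: measurableT_comp => //; exact: measurable_sqr.
- exact: measurable_sqr.
- by move=> x _; rewrite /= ger0_norm ?sqr_ge0.
Qed.

Lemma sqintM f g : f \in sqint -> g \in sqint ->
  mu.-integrable setT (EFin \o (fun x => f x * g x)).
Proof.
move=> fs gs.
have h := integrableD measurableT (sqint_integrable fs) (sqint_integrable gs).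
apply: (le_integrable measurableT _ _ h).
  move/sqintP: fs => [mf _]; move/sqintP: gs => [mg _].
  by apply/measurable_EFinP; exact: measurable_funM.
move=> x _; rewrite /= lee_fin [X in _ <= X]ger0_norm ?addr_ge0 ?sqr_ge0 //.
rewrite normrM -(real_normK (num_real (f x))) -(real_normK (num_real (g x))).
have := sqr_ge0 (`|f x| - `|g x|); have := mulr_ge0 (normr_ge0 (f x)) (normr_ge0 (g x)).
nra.
Qed.

Lemma sqint_le f g : measurable_fun setT f -> g \in sqint ->
  (forall x, f x ^+ 2 <= g x ^+ 2) -> f \in sqint.
Proof.
move=> mf /sqintP[mg gy] h; apply/sqintP; split => //.
by apply: le_lt_trans gy; exact: nsq_le.
Qed.

Lemma sqint_submod_closed : submod_closed sqint.
Proof.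
split.
  apply/sqintP; split; first exact: measurable_cst.
  by rewrite /nsq; under eq_integral do rewrite expr0n; rewrite integral0.
move=> a f g fs gs; move/sqintP: (fs) => [mf _]; move/sqintP: (gs) => [mg _].
have mafg : measurable_fun setT (a *: f + g).
  by apply: measurable_funD => //; exact: measurable_funM.
apply/sqintP; split => //.
have h := integrableD measurableT
  (integrableZl measurableT (2 * a ^+ 2) (sqint_integrable fs))
  (integrableZl measurableT 2 (sqint_integrable gs)).
apply: le_lt_trans (integrable_lty measurableT h).
apply: ge0_le_integral => //.
- by move=> x _; rewrite lee_fin sqr_ge0.
- exact: measurable_sqr.
- by case/integrableP: h.
- move=> x _; rewrite /= -!EFinM -EFinD lee_fin fctE.
  have := sqr_ge0 (a * f x - g x).
  have -> : (a *: f) x = a * f x by [].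
  by nra.
Qed.

HB.instance Definition _ := GRing.isSubmodClosed.Build R (T -> R) sqint
  sqint_submod_closed.

(** Genuine functions rather than classes: values at points stay available, at the price that
    nonzero elements may have seminorm 0. *)
Record L2 := MkL2 { L2fun :> T -> R ; L2P : L2fun \in sqint }.
HB.instance Definition _ := [isSub for L2fun].
HB.instance Definition _ := [Choice of L2 by <:].
HB.instance Definition _ := [SubChoice_isSubLmodule of L2 by <:].

Lemma L2D (f g : L2) x : (f + g) x = f x + g x. Proof. by []. Qed.
Lemma L2N (f : L2) x : (- f) x = - f x. Proof. by []. Qed.
Lemma L2Z a (f : L2) x : (a *: f) x = a * f x. Proof. by []. Qed.

Lemma measurable_L2 (f : L2) : measurable_fun setT f.
Proof. by case/sqintP: (L2P f). Qed.

Lemma L2M (f g : L2) : mu.-integrable setT (EFin \o (fun x => f x * g x)).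
Proof. by apply: sqintM; exact: L2P. Qed.

Definition ip2 (f g : L2) : R := \int[mu]_x (f x * g x).

Lemma semi_inner_ip2 : semi_inner ip2.
Proof.
split=> [f g|f g h|a f g|f]; rewrite /ip2.
- by apply: eq_Rintegral => x _; rewrite mulrC.
- rewrite -RintegralD //; try exact: L2M.
  by apply: eq_Rintegral => x _; rewrite L2D mulrDl.
- rewrite -RintegralZl //; try exact: L2M.
  by apply: eq_Rintegral => x _; rewrite L2Z mulrA.
- by apply: Rintegral_ge0 => x _; rewrite -expr2 sqr_ge0.
Qed.

Lemma nsqE (f : L2) : nsq f = (ip2 f f)%:E.
Proof.
rewrite /ip2 /Rintegral fineK; last first.
  by apply: integrable_fin_num => //; exact: L2M.
by apply: eq_integral => x _; rewrite expr2.
Qed.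

Lemma nsq_sn (f : L2) : nsq f = (sn ip2 f ^+ 2)%:E.
Proof. by rewrite nsqE (sn_sqr semi_inner_ip2). Qed.

Lemma sn_nsq_le (f : L2) (c : R) : 0 <= c -> (nsq f <= (c ^+ 2)%:E)%E ->
  sn ip2 f <= c.
Proof.
by move=> c0; rewrite nsqE lee_fin => h; apply: sn_le => //; exact: semi_inner_ip2.
Qed.

(** Serves three times to carry a bound over to an almost everywhere limit: for the completeness of
    L^2, for the removal of the weight in the Plancherel inequality, and for the removal of a
    cut-off in Hankel operators. *)
Lemma fatou_nsq (g : nat -> T -> R) (f : T -> R) (K : \bar R) :
  (forall m, measurable_fun setT (g m)) -> measurable_fun setT f ->
  (forall m, (nsq (g m) <= K)%E) ->
  {ae mu, forall x, g m x @[m --> \oo] --> f x} -> (nsq f <= K)%E.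
Proof.
move=> mg mf gK gf.
have msq m := measurable_sqr (mg m).
have mE : measurable_fun setT
    (fun x => limn_einf (fun m => ((g m x) ^+ 2)%:E)).
  apply: (emeasurable_fun_cvg _ _ (measurable_fun_einfs msq)) => x _.
  by rewrite limn_einf_lim; exact: is_cvg_einfs.
have E0 x : (0 <= limn_einf (fun m => ((g m x) ^+ 2)%:E))%E.
  rewrite limn_einf_lim; apply: lime_ge; first exact: is_cvg_einfs.
  by apply: nearW => m; apply: le_ereal_inf_tmp => _ [k _ <-]; rewrite lee_fin sqr_ge0.
rewrite /nsq (_ : (\int[mu]_x _ =
    \int[mu]_x (limn_einf (fun m => ((g m x) ^+ 2)%:E)))%E); last first.
  apply: ge0_ae_eq_integral => //.
  - exact: measurable_sqr.
  - by move=> x _; rewrite lee_fin sqr_ge0.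
  - apply: filterS gf => x gfx _.
    have : (g m x ^+ 2)%:E @[m --> \oo] --> (f x ^+ 2)%:E.
      apply: cvg_EFin; first exact: nearW.
      by rewrite /comp /=; under eq_fun do rewrite expr2; rewrite expr2; exact: cvgM.
    by move/cvg_limn_einf_sup => [-> _].
apply: le_trans (fatou mu measurableT _ _) _ => //.
- by move=> m x _; rewrite lee_fin sqr_ge0.
rewrite limn_einf_lim; apply: lime_le; first exact: is_cvg_einfs.
apply: nearW => m; apply: le_trans (gK m).
by apply: ereal_inf_lbound; exists m => /=.
Qed.

Lemma sqint_norm f : f \in sqint -> (fun x => `|f x|) \in sqint.
Proof.
move=> fs; apply: (sqint_le _ fs); last by move=> x; rewrite real_normK ?num_real.
by apply: measurableT_comp => //; case/sqintP: fs.
Qed.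

Definition absL2 (f : L2) : L2 := MkL2 (sqint_norm (L2P f)).

Lemma sn_absL2 (f : L2) : sn ip2 (absL2 f) = sn ip2 f.
Proof.
rewrite /sn; congr Num.sqrt; apply: eq_Rintegral => x _ /=.
by rewrite -!expr2 real_normK ?num_real.
Qed.

Lemma L2sum I (r : seq I) (P : pred I) (F : I -> L2) x :
  (\sum_(i <- r | P i) F i) x = \sum_(i <- r | P i) F i x.
Proof. by elim/big_ind2 : _ => [//|a b c e <- <-|]. Qed.

(** Riesz-Fischer. The partial sums [G] of the absolute steps are bounded in L^2, so by monotone
    convergence their limit is finite almost everywhere; there the sequence converges, and Fatou's
    lemma gives the rate of convergence in L^2. *)
Lemma fast_complete_ip2 : fast_complete ip2.
Proof.
move=> u C q q01 uC.
have H := semi_inner_ip2.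
have /andP[q0 q1] := q01.
have q1' : 0 < 1 - q by rewrite subr_gt0.
have C0 : 0 <= C.
  by have := le_trans (sn_ge0 _ _) (uC 0%N); rewrite expr0 mulr1.
(* [K * q ^+ k] is the tail of the geometric series from [k] on. *)
pose K := C / (1 - q).
have K0 : 0 <= K by rewrite divr_ge0 // ltW.
have Kq k : K * q ^+ k = C * q ^+ k + K * q ^+ k.+1.
  by rewrite exprS /K; field; rewrite gt_eqF.
have snuK m k : sn ip2 (u (m + k)%N - u k) <= K * q ^+ k - K * q ^+ (m + k).
  elim: m => [|m IH]; first by rewrite add0n !subrr sn0.
  rewrite addSn; apply: le_trans (ler_sn_triangle H _ (u (m + k)%N) _) _.
  by move: (uC (m + k)%N) IH; rewrite (Kq (m + k)%N); lra.
pose G m : L2 := \sum_(k < m) absL2 (u k.+1 - u k).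
have snG m : sn ip2 (G m) <= K - K * q ^+ m.
  elim: m => [|m IH]; first by rewrite /G big_ord0 sn0 // expr0 mulr1 subrr.
  rewrite /G big_ord_recr /=; apply: le_trans (ler_snD H _ _) _.
  by rewrite sn_absL2; move: (uC m) IH; rewrite (Kq m) /G; lra.
have GE m x : G m x = \sum_(k < m) `|u k.+1 x - u k x| by rewrite L2sum.
have Gnd x : {homo (fun m => G m x) : m n / (m <= n)%N >-> m <= n}.
  apply/nondecreasing_seqP => m; rewrite !GE big_ord_recr /= lerDl //.
have G0 m x : 0 <= G m x by rewrite GE sumr_ge0.
pose F x := limn (fun m => ((G m x) ^+ 2)%:E).
have Fnd x : {homo (fun m => ((G m x) ^+ 2)%:E) : m n / (m <= n)%N >-> (m <= n)%E}.
  by move=> m n mn; rewrite lee_fin lerXn2r ?nnegrE // Gnd.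
have Fc x : cvgn (fun m => ((G m x) ^+ 2)%:E).
  by apply: ereal_nondecreasing_is_cvgn; exact: Fnd.
have mG m : measurable_fun setT (fun x => ((G m x) ^+ 2)%:E).
  by apply: measurable_sqr; exact: measurable_L2.
have mF : measurable_fun setT F.
  by apply: (emeasurable_fun_cvg _ _ mG) => x _; exact: Fc.
have intF : (\int[mu]_x F x <= (K ^+ 2)%:E)%E.
  rewrite monotone_convergence //; last first.
    by move=> m x _; rewrite lee_fin sqr_ge0.
  apply: lime_le.
    apply: ereal_nondecreasing_is_cvgn => m n mn.
    apply: ge0_le_integral => // x _; last exact: Fnd.
    by rewrite lee_fin sqr_ge0.
  apply: nearW => m; rewrite -/(nsq (G m)) nsq_sn lee_fin lerXn2r ?nnegrE ?sn_ge0 //.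
  by apply: le_trans (snG m) _; rewrite lerBlDr lerDl mulr_ge0 // exprn_ge0.
have F0 x : (0 <= F x)%E.
  by apply: lime_ge => //; apply: nearW => m; rewrite lee_fin sqr_ge0.
pose E := F @^-1` [set` Interval -oo%O (BLeft +oo%E)].
have mE : measurable E by rewrite -[E]setTI; apply: mF => //; exact: emeasurable_itv.
have aeE : {ae mu, forall x, E x}.
  have : mu.-integrable setT F.
    apply/integrableP; split => //.
    under eq_integral do rewrite gee0_abs //.
    exact: le_lt_trans intF (ltry _).
  move/integrable_ae => /(_ measurableT); apply: filterS => x /(_ I).
  by rewrite ge0_fin_numE // /E /= in_itv /=.
have uc x : E x -> cvgn (fun k => u k x).
  rewrite /E /= in_itv /= => Fx.
  have Fle m : (((G m x) ^+ 2)%:E <= F x)%E.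
    rewrite /F (cvg_lim _ (ereal_nondecreasing_cvgn (Fnd x))) //.
    by apply: ereal_sup_ubound; exists m.
  have cG : cvgn (fun m => G m x).
    apply: nondecreasing_is_cvgn; first exact: Gnd.
    (* From [t <= t ^+ 2 + 1], the bound on the squares bounds the sums. *)
    exists (fine (F x) + 1) => _ [m _ <-].
    have : (G m x) ^+ 2 <= fine (F x).
      rewrite -lee_fin fineK; first exact: Fle.
      by rewrite ge0_fin_numE.
    have := sqr_ge0 (G m x - 1 / 2); nra.
  have -> : (fun k => u k x) = (fun k => u 0%N x + series (telescope (fun k => u k x)) k).
    by apply/funext => k; rewrite -eq_sum_telescope.
  apply: is_cvgD; first exact: is_cvg_cst.
  apply: normed_cvg; rewrite (_ : [normed series _] = (fun m => G m x)) //.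
  by apply/funext => m; rewrite GE; exact: big_mkord.
pose l x := \1_E x * limn (fun k => u k x).
have lc x : (\1_E x * u k x) @[k --> \oo] --> l x.
  rewrite /l /indic; have [Ex|Ex] := pselect (E x).
    by rewrite mem_set //; apply: cvgM; [exact: cvg_cst|exact: uc].
  rewrite memNset //= mul0r; under eq_fun do rewrite mul0r; exact: cvg_cst.
have ml : measurable_fun setT l.
  apply: (@measurable_fun_cvg _ _ _ _ (fun k x => \1_E x * u k x)) => [k|x _].
    by apply: measurable_funM; [exact: measurable_indic|exact: measurable_L2].
  exact: lc.
have nl k : (nsq (fun x => (l x - u k x)%R) <= ((K * q ^+ k) ^+ 2)%:E)%E.
  apply: (@fatou_nsq (fun m x => u (m + k)%N x - u k x)).
  - by move=> m; apply: measurable_funB; exact: measurable_L2.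
  - by apply: measurable_funB => //; exact: measurable_L2.
  - move=> m; rewrite -[X in nsq X]/(L2fun (u (m + k)%N - u k)) nsq_sn lee_fin.
    have Kq0 j : 0 <= K * q ^+ j by apply: mulr_ge0 => //; exact: exprn_ge0.
    rewrite lerXn2r ?nnegrE ?sn_ge0 //.
    by apply: le_trans (snuK m k) _; rewrite lerBlDr lerDl.
  - apply: filterS aeE => x Ex; apply: cvgB; last exact: cvg_cst.
    rewrite (cvg_shiftn k (fun m => u m x)).
    have := lc x; rewrite /indic mem_set //=.
    by under eq_fun do rewrite mul1r.
have ls : l \in sqint.
  have h : (fun x => l x - u 0%N x) \in sqint.
    apply/sqintP; split; last by apply: le_lt_trans (nl 0%N) (ltry _).
    by apply: measurable_funB => //; exact: measurable_L2.
  rewrite (_ : l = (fun x => l x - u 0%N x) + u 0%N).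
    by apply: rpredD => //; exact: L2P.
  by apply/funext => x; rewrite fctE subrK.
exists (MkL2 ls), K => k; apply: sn_nsq_le; last exact: nl.
by rewrite mulr_ge0 // exprn_ge0.
Qed.

End SquareIntegrable.

(** * Fourier integrals and the Plancherel inequality *)
Section ParametricIntegral.
Context {d1 d2} {T1 : measurableType d1} {T2 : measurableType d2} {R : realType}.
Variables (m1 : {sigma_finite_measure set T1 -> \bar R}).
Variables (m2 : {sigma_finite_measure set T2 -> \bar R}).
Implicit Types F : T1 * T2 -> R.

(** Sections may fail to be integrable: the positive and negative parts are treated by Tonelli, and
    [fine] of their difference is still measurable. *)
Lemma measurable_Rintegral F : measurable_fun setT F ->
  measurable_fun setT (fun x => \int[m2]_y F (x, y)).
Proof.
move=> mF; have mE : measurable_fun setT (EFin \o F) by exact/measurable_EFinP.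
rewrite /Rintegral; apply: (measurableT_comp (fine_measurable measurableT)).
under eq_fun do rewrite integralE.
apply: emeasurable_funB.
  have := @measurable_fun_fubini_tonelli_F _ _ T1 T2 R m2 ((EFin \o F)^\+)%E.
  move=> /(_ (measurable_funepos mE) (fun z => funepos_ge0 _ z)).
  congr (measurable_fun _ _); apply/funext => x; apply: eq_integral => y _.
  by rewrite !unlock.
have := @measurable_fun_fubini_tonelli_F _ _ T1 T2 R m2 ((EFin \o F)^\-)%E.
move=> /(_ (measurable_funeneg mE) (fun z => funeneg_ge0 _ z)).
congr (measurable_fun _ _); apply/funext => x; apply: eq_integral => y _.
by rewrite !unlock.
Qed.

Variables (F : T1 * T2 -> R) (a : T1 -> R) (b : T2 -> R).
Hypotheses (mF : measurable_fun setT F)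
  (ia : m1.-integrable setT (EFin \o a)) (ib : m2.-integrable setT (EFin \o b))
  (Fab : forall x y, `|F (x, y)| <= a x * b y).

Lemma dominated_sectionr x : m2.-integrable setT (fun y => (F (x, y))%:E).
Proof.
apply: (le_integrable measurableT _ _ (integrableZl measurableT (a x) ib)).
  by apply/measurable_EFinP; exact: (measurableT_comp mF (pair1_measurable x)).
by move=> y _; rewrite /= lee_fin; apply: le_trans (Fab x y) (ler_norm _).
Qed.

Lemma dominated_sectionl y : m1.-integrable setT (fun x => (F (x, y))%:E).
Proof.
apply: (le_integrable measurableT _ _ (integrableZl measurableT (b y) ia)).
  by apply/measurable_EFinP; exact: (measurableT_comp mF (pair2_measurable y)).
move=> x _; rewrite /= lee_fin mulrC; apply: le_trans (Fab x y) (ler_norm _).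
Qed.

Lemma EFin_Rint_sectionr x :
  (\int[m2]_y F (x, y))%:E = (\int[m2]_y (F (x, y))%:E)%E.
Proof. by rewrite /Rintegral fineK //; exact: integrable_fin_num (dominated_sectionr x). Qed.

Lemma EFin_Rint_sectionl y :
  (\int[m1]_x F (x, y))%:E = (\int[m1]_x (F (x, y))%:E)%E.
Proof. by rewrite /Rintegral fineK //; exact: integrable_fin_num (dominated_sectionl y). Qed.

Lemma norm_Rint_section x : `|\int[m2]_y F (x, y)| <= a x * \int[m2]_y b y.
Proof.
apply: le_trans (le_normr_Rintegral measurableT (dominated_sectionr x)) _.
rewrite -RintegralZl //; apply: le_Rintegral => //.
- exact: (integrable_norm (dominated_sectionr x)).
- exact: (integrableZl measurableT (a x) ib).
Qed.

Lemma integrable_Rint_section :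
  m1.-integrable setT (fun x => (\int[m2]_y F (x, y))%:E).
Proof.
apply: (le_integrable measurableT _ _
  (integrableZl measurableT (\int[m2]_y b y) ia)).
  by apply/measurable_EFinP; exact: measurable_Rintegral.
move=> x _; rewrite /= lee_fin mulrC.
exact: le_trans (norm_Rint_section x) (ler_norm _).
Qed.

(** A bound by a product [a x * b y] is the form in which Fubini is applied throughout: one factor
    comes from the symbol or the weight, the other from the function. *)
Lemma dominated_Fubini :
  \int[m1]_x (\int[m2]_y F (x, y)) = \int[m2]_y (\int[m1]_x F (x, y)).
Proof.
have mE : measurable_fun setT (EFin \o F) by exact/measurable_EFinP.
rewrite /Rintegral; congr fine.
under eq_integral do rewrite -/(Rintegral _ _ _) EFin_Rint_sectionr.
under [RHS]eq_integral do rewrite -/(Rintegral _ _ _) EFin_Rint_sectionl.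
apply: (Fubini (f := EFin \o F)); apply/integrable12ltyP => //.
have bE x : (\int[m2]_y `|(EFin \o F) (x, y)| <= (a x * \int[m2]_y b y)%:E)%E.
  rewrite -RintegralZl // /Rintegral fineK; last first.
    by apply: integrable_fin_num => //; exact: (integrableZl measurableT (a x) ib).
  apply: ge0_le_integral => //.
  - apply: measurableT_comp => //; apply/measurable_EFinP.
    exact: (measurableT_comp mF (pair1_measurable x)).
  - by case/integrableP: (integrableZl measurableT (a x) ib).
  - by move=> y _; rewrite lee_fin; exact: Fab.
apply: le_lt_trans (integrable_lty measurableT
  (integrableZl measurableT (\int[m2]_y b y) ia)).
apply: ge0_le_integral => //.
- by move=> x _; exact: integral_ge0.
- apply: (measurable_fun_fubini_tonelli_F (abse \o (EFin \o F))).
    exact: measurableT_comp.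
  by move=> z; exact: abse_ge0.
- by case/integrableP: (integrableZl measurableT (\int[m2]_y b y) ia).
- by move=> x _; rewrite /= -EFinM mulrC; exact: bE.
Qed.

End ParametricIntegral.

(** * Translation invariance of the Lebesgue integral *)

Section Translation.
Context {R : realType}.
Local Notation mu := (@lebesgue_measure R).

Lemma measurable_shift (a : R) : measurable_fun setT (fun x : R => x + a).
Proof. by apply: measurable_funD. Qed.

(** The image of the Lebesgue measure under a translation agrees with it on half-open intervals,
    hence everywhere by uniqueness. *)
Lemma ge0_integral_shift (f : R -> \bar R) (a : R) :
  measurable_fun setT f -> (forall x, 0 <= f x)%E ->
  (\int[mu]_x f (x + a)%R = \int[mu]_x f x)%E.
Proof.
move=> mf f0.
have := @ge0_integral_pushforward _ _ (measurableTypeR R) (measurableTypeR R) R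
  (fun x => x + a) (measurable_shift a) mu setT f
  measurableT mf (fun x _ => f0 x).
rewrite preimage_setT => <-.
apply: (@eq_measure_integral _ (measurableTypeR R)) => [|mshift A mA _].
  exact: measurable_shift.
refine (esym (@lebesgue_measure_unique R (measure_function_pushforward__canonical__measure_function_Measure mu mshift) _ A mA)).
move=> X [[u v] /= _ <-].
rewrite /pushforward.
rewrite (_ : _ @^-1` _ = `]u - a, v - a]%classic); last first.
  by apply/seteqP; split=> x /=; rewrite !in_itv /= ltrBlDr lerBrDr.
rewrite !lebesgue_measure_itv /= !lte_fin ltrD2r.
by case: ifP => // _; rewrite -!EFinB opprB addrA subrK.
Qed.

Lemma integral_shift (f : R -> \bar R) (a : R) : measurable_fun setT f ->
  (\int[mu]_x f (x + a)%R = \int[mu]_x f x)%E.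
Proof.
move=> mf; rewrite [LHS]integralE [RHS]integralE; congr (_ - _)%E.
  rewrite -(@ge0_integral_shift (f^\+)%E a) //; last exact: measurable_funepos.
  by apply: eq_integral => x _; rewrite !unlock.
rewrite -(@ge0_integral_shift (f^\-)%E a) //; last exact: measurable_funeneg.
by apply: eq_integral => x _; rewrite !unlock.
Qed.

End Translation.

(** * The Poisson kernel as a Fourier integral *)

Section PoissonKernel.
Context {R : realType}.
Local Notation mu := (@lebesgue_measure R).
Implicit Types (e t x xi : R).

(** The Poisson kernel of the half-plane times 2 pi, that is, the Fourier transform of the Abel
    weight [expw e]. *)
Definition pois e t : R := 2 * e / (e ^+ 2 + t ^+ 2).
Definition expw e xi : R := expR (- e * `|xi|).

Lemma measurable_cos : measurable_fun setT (@cos R).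
Proof. by apply: continuous_measurable_fun; exact: continuous_cos. Qed.
Lemma measurable_sin : measurable_fun setT (@sin R).
Proof. by apply: continuous_measurable_fun; exact: continuous_sin. Qed.

Lemma is_derive_continuous (f f' : R -> R) :
  (forall x, is_derive x 1 f (f' x)) -> continuous f.
Proof.
by move=> df x; apply/differentiable_continuous/derivable1_diffP; case: (df x).
Qed.

Lemma continuous_cosM t : continuous (fun x => cos (x * t)).
Proof. by apply: is_derive_continuous => x; exact: is_derive_eq. Qed.

Lemma continuous_sinM t : continuous (fun x => sin (x * t)).
Proof. by apply: is_derive_continuous => x; exact: is_derive_eq. Qed.

Lemma continuous_expRM t : continuous (fun x => expR (t * x)).
Proof. by apply: is_derive_continuous => x; exact: is_derive_eq. Qed.

Lemma continuous_expw e : continuous (expw e).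
Proof.
move=> x; apply: (@continuous_comp _ _ _ (fun y => - e * `|y|) expR); last exact: continuous_expR.
by apply: continuousM; [exact: cvg_cst|exact: norm_continuous].
Qed.

Lemma expR_Ny e : 0 < e -> expR (- e * x) @[x --> +oo] --> (0 : R).
Proof.
move=> e0.
have h : e * x @[x --> +oo] --> +oo.
  by apply: gt0_cvgMry => //; exact: cvg_id.
have := cvg_comp _ _ h (@cvgr_expR R).
by rewrite /comp; under eq_fun do rewrite -mulNr.
Qed.

Lemma integral_expw e : 0 < e -> (\int[mu]_xi (expw e xi)%:E = (2 / e)%:E)%E.
Proof.
move=> e0; rewrite ge0_symfun_integralT; last 3 first.
- by move=> x; exact: expR_ge0.
- exact: continuous_expw.
- by move=> x; rewrite /expw /= normrN.
rewrite -set_itvcy.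
rewrite (_ : (\int[mu]_(x in _) _)%E = \int[mu]_(x in `[0%R, +oo[) (expR (- e * x))%:E)%E; last first.
  apply: eq_integral => x; rewrite inE /= in_itv /= andbT => x0.
  by rewrite /expw ger0_norm.
have dF (x : R) : is_derive x 1 (fun x => - e^-1 * expR (- e * x)) (expR (- e * x)).
  apply: is_derive_eq; rewrite /GRing.scale /=; field; exact: lt0r_neq0.
have cF : continuous (fun x => - e^-1 * expR (- e * x)).
  exact: is_derive_continuous dF.
rewrite (@ge0_continuous_FTC2y _ _ (fun x => - e^-1 * expR (- e * x)) 0 0).
- by rewrite mulr0 expR0 mulr1 -EFinB sub0r opprK -EFinM.
- by move=> x _; exact: expR_ge0.
- by apply: continuous_subspaceT; exact: continuous_expRM.
- by rewrite -[X in _ --> X](mulr0 (- e^-1)); apply: cvgM; [exact: cvg_cst|exact: expR_Ny].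
- by move=> x _; case: (dF x).
- by apply: cvg_at_right_filter; exact: cF.
- by move=> x _; rewrite derive1E; case: (dF x).
Qed.

Lemma integrable_expw e : 0 < e -> mu.-integrable setT (EFin \o expw e).
Proof.
move=> e0; apply/integrableP; split.
  apply/measurable_EFinP.
  by apply: (@continuous_measurable_fun R); exact: continuous_expw.
under eq_integral do rewrite gee0_abs ?lee_fin ?expR_ge0 //.
by rewrite integral_expw ?ltry.
Qed.

(** With 1 - cos instead of cos the integrand is nonnegative, so the fundamental theorem of calculus
    on a half-line for nonnegative functions applies. *)
Lemma integral_expw_cos e t : 0 < e ->
  (\int[mu]_xi (expw e xi * (1 - cos (xi * t)))%:E = (2 / e - pois e t)%:E)%E.
Proof.
move=> e0; rewrite ge0_symfun_integralT; last 3 first.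
- by move=> x; rewrite mulr_ge0 ?expR_ge0 // subr_ge0 cos_le1.
- move=> x; apply: cvgM; first exact: continuous_expw.
  by apply: cvgB; [exact: cvg_cst|exact: continuous_cosM].
- by move=> x; rewrite /expw [in RHS]/= normrN (mulNr x) cosN.
rewrite -set_itvcy.
rewrite (_ : (\int[mu]_(x in _) _)%E =
    \int[mu]_(x in `[0%R, +oo[) (expR (- e * x) * (1 - cos (x * t)))%:E)%E; last first.
  apply: eq_integral => x; rewrite inE /= in_itv /= andbT => x0.
  by rewrite /expw ger0_norm.
have D0 : e ^+ 2 + t ^+ 2 != 0.
  by rewrite gt_eqF // ltr_pwDl ?exprn_gt0 // sqr_ge0.
pose F x := expR (- e * x) * (- e^-1 - (t * sin (x * t) - e * cos (x * t)) / (e ^+ 2 + t ^+ 2)).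
have dF (x : R) : is_derive x 1 F (expR (- e * x) * (1 - cos (x * t))).
  apply: is_derive_eq; rewrite /GRing.scale /=; field.
  by rewrite D0 lt0r_neq0.
have cF : continuous F.
  exact: is_derive_continuous dF.
rewrite (@ge0_continuous_FTC2y _ _ F 0 0).
- rewrite /F mulr0 expR0 mul0r sin0 cos0 -EFinB -EFinM /pois; congr EFin.
  by field; rewrite D0 lt0r_neq0.
- by move=> x _; rewrite mulr_ge0 ?expR_ge0 // subr_ge0 cos_le1.
- apply: continuous_subspaceT => x; apply: cvgM.
    exact: continuous_expRM.
  by apply: cvgB; [exact: cvg_cst|exact: continuous_cosM].
- pose K := e^-1 + (`|t| + e) / (e ^+ 2 + t ^+ 2).
  apply: norm_cvg0.
  have Kc : K * expR (- e * x) @[x --> +oo] --> 0.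
    by rewrite -[X in _ --> X](mulr0 K); apply: cvgM; [exact: cvg_cst|exact: expR_Ny].
  apply: (squeeze_cvgr _ _ Kc); last exact: cvg_cst.
    near=> x; rewrite normr_ge0 /=.
    rewrite /F normrM mulrC (ger0_norm (expR_ge0 _)) ler_wpM2r ?expR_ge0 //.
    apply: le_trans (ler_normB _ _) _; rewrite normrN (gtr0_norm (_ : 0 < e^-1)) ?invr_gt0 //.
    rewrite /K lerD2l normrM (ger0_norm (_ : 0 <= (e ^+ 2 + t ^+ 2)^-1)); last first.
      by rewrite invr_ge0 addr_ge0 ?sqr_ge0.
    rewrite ler_wpM2r ?invr_ge0 ?addr_ge0 ?sqr_ge0 //.
    apply: le_trans (ler_normB _ _) _; rewrite !normrM.
    apply: lerD; first by rewrite ler_piMr // sin_max.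
    by rewrite (gtr0_norm e0); apply: ler_piMr; [exact: ltW|exact: cos_max].
- by move=> x _; case: (dF x).
- by apply: cvg_at_right_filter; exact: cF.
- by move=> x _; rewrite derive1E; case: (dF x).
Unshelve. all: by end_near.
Qed.

Lemma Rintegral_expw_cos e t : 0 < e ->
  \int[mu]_xi (expw e xi * cos (xi * t)) = pois e t.
Proof.
move=> e0.
have i1 := integrable_expw e0.
have i2 : mu.-integrable setT (EFin \o (fun x => expw e x * (1 - cos (x * t)))).
  apply/integrableP; split.
    apply/measurable_EFinP; apply: (@continuous_measurable_fun R) => x.
    apply: cvgM; first exact: continuous_expw.
    by apply: cvgB; [exact: cvg_cst|exact: continuous_cosM].
  under eq_integral do rewrite gee0_abs ?lee_fin ?mulr_ge0 ?expR_ge0 ?subr_ge0 ?cos_le1 //.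
  by rewrite integral_expw_cos ?ltry.
rewrite (_ : pois e t = 2 / e - (2 / e - pois e t)); last by rewrite subKr.
rewrite -[X in _ = X - _](_ : \int[mu]_xi expw e xi = _); last first.
  by rewrite /Rintegral integral_expw.
rewrite -[X in _ = _ - X](_ : \int[mu]_xi (expw e xi * (1 - cos (xi * t))) = _); last first.
  by rewrite /Rintegral integral_expw_cos.
rewrite -RintegralB //; apply: eq_Rintegral => x _.
by rewrite mulrBr mulr1 subKr.
Qed.

Lemma pois_ge0 e t : 0 < e -> 0 <= pois e t.
Proof. by move=> e0; rewrite /pois divr_ge0 ?mulr_ge0 ?addr_ge0 ?sqr_ge0 // ltW. Qed.

Lemma continuous_pois e : 0 < e -> continuous (pois e).
Proof.
move=> e0 x; apply: cvgM; first exact: cvg_cst.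
apply: cvgV; first by rewrite gt_eqF // ltr_pwDl ?exprn_gt0 // sqr_ge0.
by apply: cvgD; [exact: cvg_cst|exact: exprn_continuous].
Qed.

Lemma measurable_pois e : 0 < e -> measurable_fun setT (pois e).
Proof. by move=> e0; apply: (@continuous_measurable_fun R); exact: continuous_pois. Qed.

Lemma integral_pois e : 0 < e -> (\int[mu]_t (pois e t)%:E = (2 * pi)%:E)%E.
Proof.
move=> e0; have D0 t : 0 < e ^+ 2 + t ^+ 2.
  by rewrite ltr_pwDl ?exprn_gt0 // sqr_ge0.
have p0 t := pois_ge0 t e0.
have dP (x : R) : is_derive x 1 (fun t => 2 * atan (t / e)) (pois e x).
  apply: is_derive_eq; rewrite /GRing.scale /= /pois; field.
  by rewrite (gt_eqF (D0 x)) (gt_eqF e0) /=.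
have cp := continuous_pois e0.
rewrite ge0_symfun_integralT //; last by move=> x; rewrite /pois /= sqrrN.
rewrite -set_itvcy (@ge0_continuous_FTC2y _ _ (fun t => 2 * atan (t / e)) 0 pi).
- by rewrite mul0r atan0 mulr0 sube0 -EFinM.
- by [].
- exact: continuous_subspaceT.
- rewrite (_ : pi = 2 * (pi / 2)); last by field.
  apply: cvgM; first exact: cvg_cst.
  have h : e^-1 * x @[x --> +oo] --> +oo.
    by apply: gt0_cvgMry; [rewrite invr_gt0|exact: cvg_id].
  have := cvg_comp _ _ h (@cvgy_atan R).
  by rewrite /comp; under eq_fun do rewrite mulrC.
- by move=> x _; case: (dP x).
- apply: cvg_at_right_filter.
  exact: (is_derive_continuous dP).
- by move=> x _; rewrite derive1E; case: (dP x).
Qed.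

End PoissonKernel.

(** * The Plancherel inequality for integrable functions *)

Section FourierL2.
Context {R : realType}.
Local Notation mu := (@lebesgue_measure R).
Implicit Types (f : R -> R) (x xi e : R).

Definition cosT f xi : R := \int[mu]_x (f x * cos (xi * x)).
Definition sinT f xi : R := \int[mu]_x (f x * sin (xi * x)).

Section Transform.
Variable f : R -> R.
Hypothesis fi : mu.-integrable setT (EFin \o f).

Lemma measurable_int : measurable_fun setT f.
Proof. by apply/measurable_EFinP; case/integrableP: fi. Qed.

Lemma measurable_fcos :
  measurable_fun setT (fun z : R * R => f z.2 * cos (z.1 * z.2)).
Proof.
apply: measurable_funM; first exact: (measurableT_comp measurable_int measurable_snd).
apply: (measurableT_comp measurable_cos).
by apply: measurable_funM; [exact: measurable_fst|exact: measurable_snd].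
Qed.

Lemma measurable_fsin :
  measurable_fun setT (fun z : R * R => f z.2 * sin (z.1 * z.2)).
Proof.
apply: measurable_funM; first exact: (measurableT_comp measurable_int measurable_snd).
apply: (measurableT_comp measurable_sin).
by apply: measurable_funM; [exact: measurable_fst|exact: measurable_snd].
Qed.

Lemma measurable_cosT : measurable_fun setT (cosT f).
Proof. exact: (measurable_Rintegral mu measurable_fcos). Qed.

Lemma measurable_sinT : measurable_fun setT (sinT f).
Proof. exact: (measurable_Rintegral mu measurable_fsin). Qed.

Lemma integrable_bounded_mul (g : R -> R) : measurable_fun setT g ->
  (forall x, `|g x| <= 1) -> mu.-integrable setT (EFin \o (fun x => f x * g x)).
Proof.
move=> mg g1; apply: (le_integrable measurableT _ _ fi).
  by apply/measurable_EFinP; apply: measurable_funM => //; exact: measurable_int.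
by move=> x _; rewrite lee_fin normrM ler_piMr.
Qed.

Lemma integrable_fcos xi : mu.-integrable setT (EFin \o (fun x => f x * cos (xi * x))).
Proof.
apply: integrable_bounded_mul => [|x]; last exact: cos_max.
by apply: (measurableT_comp measurable_cos); exact: measurable_funM.
Qed.

Lemma integrable_fsin xi : mu.-integrable setT (EFin \o (fun x => f x * sin (xi * x))).
Proof.
apply: integrable_bounded_mul => [|x]; last exact: sin_max.
by apply: (measurableT_comp measurable_sin); exact: measurable_funM.
Qed.

Let n1 : R := \int[mu]_x `|f x|.

Let n1_ge0 : 0 <= n1. Proof. exact: Rintegral_ge0. Qed.

Lemma norm_Rint_bounded_mul (g : R -> R) : measurable_fun setT g ->
  (forall x, `|g x| <= 1) -> `|\int[mu]_x (f x * g x)| <= n1.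
Proof.
move=> mg g1; have i := integrable_bounded_mul mg g1.
apply: le_trans (le_normr_Rintegral measurableT i) _.
apply: le_Rintegral => //; [exact: (integrable_norm i)|exact: (integrable_norm fi)|].
by move=> x _; rewrite normrM ler_piMr.
Qed.

Lemma norm_cosT xi : `|cosT f xi| <= n1.
Proof.
apply: norm_Rint_bounded_mul => [|x]; last exact: cos_max.
by apply: (measurableT_comp measurable_cos); exact: measurable_funM.
Qed.

Lemma norm_sinT xi : `|sinT f xi| <= n1.
Proof.
apply: norm_Rint_bounded_mul => [|x]; last exact: sin_max.
by apply: (measurableT_comp measurable_sin); exact: measurable_funM.
Qed.

Lemma Rint_cos_sin xi (a b : R) :
  \int[mu]_x (f x * (cos (xi * x) * a + sin (xi * x) * b)) =
  cosT f xi * a + sinT f xi * b.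
Proof.
have i1 := integrableZl measurableT a (integrable_fcos xi).
have i2 := integrableZl measurableT b (integrable_fsin xi).
rewrite /cosT /sinT (mulrC _ a) (mulrC _ b).
rewrite -RintegralZl //; last exact: integrable_fcos.
rewrite -RintegralZl //; last exact: integrable_fsin.
rewrite -RintegralD //.
by apply: eq_Rintegral => x _; ring.
Qed.

Variable e : R.
Hypothesis e0 : 0 < e.
Let w := expw e.

(** Integrated over x it yields the weighted square of the transform of [f]; integrated over xi it
    yields f(x) times the Poisson integral of [f] at x. Fubini equates the two. *)
Let h (z : R * R) :=
  w z.1 * (f z.2 * (cos (z.1 * z.2) * cosT f z.1 + sin (z.1 * z.2) * sinT f z.1)).

Let measurable_w1 : measurable_fun setT (fun z : R * R => w z.1).
Proof.
apply: (measurableT_comp _ measurable_fst).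
by apply: (@continuous_measurable_fun R); exact: continuous_expw.
Qed.

Let measurable_h : measurable_fun setT h.
Proof.
apply: measurable_funM; first exact: measurable_w1.
have -> : (fun z : R * R => f z.2 *
   (cos (z.1 * z.2) * cosT f z.1 + sin (z.1 * z.2) * sinT f z.1)) =
   (fun z => (f z.2 * cos (z.1 * z.2)) * cosT f z.1 +
     (f z.2 * sin (z.1 * z.2)) * sinT f z.1).
  by apply/funext => z; ring.
apply: measurable_funD; apply: measurable_funM.
- exact: measurable_fcos.
- exact: (measurableT_comp measurable_cosT measurable_fst).
- exact: measurable_fsin.
- exact: (measurableT_comp measurable_sinT measurable_fst).
Qed.

Let h_le xi x : `|h (xi, x)| <= w xi * (2 * n1 * `|f x|).
Proof.
rewrite /h /= normrM (ger0_norm (expR_ge0 _)) ler_wpM2l ?expR_ge0 //.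
rewrite normrM mulrC ler_wpM2r //.
apply: le_trans (ler_normD _ _) _; rewrite !normrM mulr_natl mulr2n.
by apply: lerD; rewrite -[X in _ <= X]mul1r; apply: ler_pM => //;
  rewrite ?cos_max ?sin_max ?norm_cosT ?norm_sinT.
Qed.

Let iw : mu.-integrable setT (EFin \o w). Proof. exact: integrable_expw. Qed.
Let ib (k : R) : mu.-integrable setT (EFin \o (fun x => k * `|f x|)).
Proof. exact: (integrableZl measurableT k (integrable_norm fi)). Qed.

Let int_h_r xi : \int[mu]_x h (xi, x) = w xi * (cosT f xi ^+ 2 + sinT f xi ^+ 2).
Proof.
rewrite /h /= RintegralZl //.
  by rewrite Rint_cos_sin !expr2.
have := integrableD measurableT
 (integrableZl measurableT (cosT f xi) (integrable_fcos xi))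
 (integrableZl measurableT (sinT f xi) (integrable_fsin xi)).
apply: eq_integrable => // x _ /=.
by rewrite -!EFinM -EFinD; congr EFin; ring.
Qed.

Let k (z : R * R) (x : R) := w z.1 * (f z.2 * cos (z.1 * (z.2 - x))).

Let int_h_l x : \int[mu]_xi h (xi, x) = f x * \int[mu]_y (f y * pois e (y - x)).
Proof.
have -> : (fun y => f y * pois e (y - x)) = (fun y => \int[mu]_xi k (xi, y) x).
  apply/funext => y; rewrite -Rintegral_expw_cos // -RintegralZl //.
    by apply: eq_Rintegral => xi _; rewrite /k /w /=; ring.
  apply: (le_integrable measurableT _ _ iw).
    apply/measurable_EFinP; apply: (@continuous_measurable_fun R) => z.
    by apply: cvgM; [exact: continuous_expw|exact: continuous_cosM].
  by move=> z _; rewrite lee_fin normrM ler_piMr // cos_max.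
have mk : measurable_fun setT (k ^~ x).
  apply: measurable_funM; first exact: measurable_w1.
  apply: measurable_funM; first exact: (measurableT_comp measurable_int measurable_snd).
  apply: (measurableT_comp measurable_cos).
  apply: measurable_funM; first exact: measurable_fst.
  by apply: measurable_funB; [exact: measurable_snd|exact: measurable_cst].
have kle xi y : `|k (xi, y) x| <= w xi * (1 * `|f y|).
  rewrite /k /= normrM (ger0_norm (expR_ge0 _)) ler_wpM2l ?expR_ge0 //.
  by rewrite mul1r normrM ler_piMr // cos_max.
have E := @dominated_Fubini _ _ _ _ R mu mu (k ^~ x) w (fun y => 1 * `|f y|) mk iw (ib 1) kle.
rewrite -E -RintegralZl //; last first.
  exact: (@integrable_Rint_section _ _ _ _ R mu mu (k ^~ x) w (fun y => 1 * `|f y|) mk iw (ib 1) kle).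
apply: eq_Rintegral => xi _; rewrite /h /k /=.
rewrite RintegralZl //; last first.
  apply: integrable_bounded_mul => [|y]; last exact: cos_max.
  apply: (measurableT_comp measurable_cos); apply: measurable_funM => //.
  exact: measurable_funB.
rewrite mulrCA; congr (_ * (_ * _)).
under eq_Rintegral do rewrite mulrBr cosB.
by rewrite Rint_cos_sin mulrC [X in _ + X]mulrC.
Qed.

(** If the integral is infinite, its [fine] is 0 and the bound is trivial. *)
Lemma EFin_norm_Rintegral_le (g : R -> R) : measurable_fun setT g ->
  ((`|\int[mu]_x g x|)%:E <= \int[mu]_x (`|g x|)%:E)%E.
Proof.
move=> mg; have mE : measurable_fun setT (EFin \o g) by exact/measurable_EFinP.
have := le_abse_integral mu measurableT mE; rewrite /Rintegral.
case: (\int[mu]_x (g x)%:E)%E => [r| |] //= _; rewrite normr0.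
  by apply: integral_ge0 => x _; rewrite lee_fin.
by apply: integral_ge0 => x _; rewrite lee_fin.
Qed.

Let P t := pois e t.
Let P0 t : 0 <= P t. Proof. exact: pois_ge0. Qed.

Let mP : measurable_fun setT P. Proof. exact: measurable_pois. Qed.

Let mPB : measurable_fun setT (fun z : R * R => P (z.2 - z.1)).
Proof.
apply: (measurableT_comp mP).
by apply: measurable_funB; [exact: measurable_snd|exact: measurable_fst].
Qed.

Let intP c : 0 <= c -> forall x,
  (\int[mu]_y (c * P (y - x))%:E = (c * (2 * pi))%:E)%E.
Proof.
move=> c0 x; under eq_integral do rewrite EFinM.
rewrite ge0_integralZl_EFin //; last 2 first.
- by move=> y _; rewrite lee_fin.
- apply/measurable_EFinP; apply: (measurableT_comp mP); exact: measurable_funB.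
rewrite (ge0_integral_shift (f := EFin \o P) (- x)) //; last exact/measurable_EFinP.
by rewrite integral_pois.
Qed.

(** The Poisson kernel is nonnegative with total mass 2 pi in either variable, so |f(x) f(y)| <=
    (f(x)^2 + f(y)^2) / 2 bounds the double integral uniformly in [e]. An inequality is enough for
    operator norms; no inversion formula enters. *)
Lemma poisson_bound :
  (\int[mu]_xi (w xi * (cosT f xi ^+ 2 + sinT f xi ^+ 2))%:E <= (2 * pi)%:E * nsq mu f)%E.
Proof.
have mf := measurable_int.
pose g x := \int[mu]_y (f y * P (y - x)).
have mfP : measurable_fun setT (fun z : R * R => f z.2 * P (z.2 - z.1)).
  by apply: measurable_funM => //; exact: (measurableT_comp mf measurable_snd).
have mg : measurable_fun setT g by exact: (measurable_Rintegral mu mfP).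
have E : \int[mu]_xi (\int[mu]_x h (xi, x)) = \int[mu]_x (f x * g x).
  rewrite (dominated_Fubini (m1 := mu) (m2 := mu) measurable_h iw (ib (2 * n1)) h_le).
  by apply: eq_Rintegral => x _; rewrite int_h_l.
under eq_integral do rewrite -int_h_r.
rewrite -(fineK (integrable_fin_num measurableT (integrable_Rint_section (m1 := mu) (m2 := mu) measurable_h iw (ib (2 * n1)) h_le))).
rewrite -/(Rintegral _ _ _) E.
apply: le_trans (_ : (`|\int[mu]_x (f x * g x)|)%:E <= _)%E.
  by rewrite lee_fin ler_norm.
apply: le_trans (EFin_norm_Rintegral_le _) _; first exact: measurable_funM.
pose F1 (z : R * R) := (2^-1 * f z.1 ^+ 2 * P (z.2 - z.1))%:E.
pose F2 (z : R * R) := (2^-1 * f z.2 ^+ 2 * P (z.2 - z.1))%:E.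
have h2 : 0 <= 2^-1 :> R by rewrite invr_ge0.
have c0 x : 0 <= 2^-1 * f x ^+ 2 by apply: mulr_ge0 => //; exact: sqr_ge0.
have F10 z : (0 <= F1 z)%E by rewrite lee_fin; apply: mulr_ge0; [exact: c0|exact: P0].
have F20 z : (0 <= F2 z)%E by rewrite lee_fin; apply: mulr_ge0; [exact: c0|exact: P0].
have mF1 : measurable_fun setT F1.
  apply/measurable_EFinP; apply: measurable_funM => //; apply: measurable_funM => //.
  by apply: measurable_funX; exact: (measurableT_comp mf measurable_fst).
have mF2 : measurable_fun setT F2.
  apply/measurable_EFinP; apply: measurable_funM => //; apply: measurable_funM => //.
  by apply: measurable_funX; exact: (measurableT_comp mf measurable_snd).
have mF1x x : measurable_fun setT (fun y => F1 (x, y)).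
  exact: (measurableT_comp mF1 (pair1_measurable x)).
have mF2x x : measurable_fun setT (fun y => F2 (x, y)).
  exact: (measurableT_comp mF2 (pair1_measurable x)).
have mI1 : measurable_fun setT (fun x => \int[mu]_y F1 (x, y))%E.
  exact: (measurable_fun_fubini_tonelli_F (m2 := mu) F1 mF1 F10).
have mI2 : measurable_fun setT (fun x => \int[mu]_y F2 (x, y))%E.
  exact: (measurable_fun_fubini_tonelli_F (m2 := mu) F2 mF2 F20).
apply: le_trans (_ : \int[mu]_x (\int[mu]_y F1 (x, y) + \int[mu]_y F2 (x, y)) <= _)%E.
  apply: ge0_le_integral => //.
  - by apply/measurable_EFinP/measurableT_comp => //; exact: measurable_funM.
  - exact: emeasurable_funD.
  move=> x _; rewrite normrM EFinM.
  have mfPx : measurable_fun setT (fun y => f y * P (y - x)).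
    exact: (measurableT_comp mfP (pair1_measurable x)).
  apply: le_trans (lee_wpmul2l _ (EFin_norm_Rintegral_le mfPx)) _.
    by rewrite lee_fin.
  rewrite -ge0_integralZl_EFin //; last by apply/measurable_EFinP/measurableT_comp.
  rewrite -ge0_integralD //; [|exact: (mF1x x)|exact: (mF2x x)].
  apply: ge0_le_integral => //.
  - under eq_fun do rewrite -EFinM.
    apply/measurable_EFinP; apply: measurable_funM => //.
    exact: (measurableT_comp _ mfPx).
  - exact: (emeasurable_funD (mF1x x) (mF2x x)).
  move=> y _; rewrite /F1 /F2 /= -EFinM -EFinD lee_fin normrM (ger0_norm (P0 _)).
  rewrite -mulrDl mulrA ler_wpM2r //.
  rewrite -(real_normK (num_real (f x))) -(real_normK (num_real (f y))).
  have := sqr_ge0 (`|f x| - `|f y|); lra.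
rewrite ge0_integralD //; last 2 first.
- by move=> x _; exact: integral_ge0.
- by move=> x _; exact: integral_ge0.
rewrite [X in (_ + X)%E](fubini_tonelli (m1 := mu) (m2 := mu) F2 mF2 F20).
under eq_integral do rewrite /F1 /= intP //.
rewrite [X in (_ + X)%E](_ : _ =
    \int[mu]_y (2^-1 * f y ^+ 2 * (2 * pi))%:E)%E; last first.
  apply: eq_integral => y _; rewrite -(intP (c0 y) y); apply: eq_integral => x _.
  by rewrite /F2 /P /pois /= -(sqrrN (x - y)) opprB.
have E2 : (\int[mu]_x (2^-1 * f x ^+ 2 * (2 * pi))%:E = pi%:E * nsq mu f)%E.
  rewrite /nsq -ge0_integralZl_EFin ?pi_ge0 //.
  - by apply: eq_integral => x _; rewrite -EFinM; congr EFin; field.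
  - by move=> x _; rewrite lee_fin sqr_ge0.
  - exact: measurable_sqr.
apply: (@le_trans _ _ (pi%:E * nsq mu f + pi%:E * nsq mu f)%E).
  by apply: leeD; rewrite -E2; exact: lexx.
by rewrite -ge0_muleDl ?lee_fin ?pi_ge0 // -EFinD -mulr2n mulr_natl lexx.
Qed.

End Transform.

Lemma fatou_expw (g : R -> R) (K : \bar R) : measurable_fun setT g ->
  (forall e, 0 < e -> (\int[mu]_xi (expw e xi * g xi ^+ 2)%:E <= K)%E) ->
  (nsq mu g <= K)%E.
Proof.
move=> mg gK; pose e m : R := m.+1%:R^-1.
(* The weight is squared inside [nsq], hence half the exponent. *)
apply: (@fatou_nsq _ _ _ mu (fun m xi => expw (2^-1 * e m) xi * g xi)) => //.
- move=> m; apply: measurable_funM => //.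
  by apply: (@continuous_measurable_fun R); exact: continuous_expw.
- move=> m; apply: le_trans (gK (e m) _); last by rewrite invr_gt0.
  rewrite /nsq le_eqVlt; apply/orP; left; apply/eqP; apply: eq_integral => x _.
  rewrite exprMn; congr (_ * _)%:E.
  by rewrite /expw expr2 -expRD; congr expR; move: (e m) => y; field.
- apply: aeW => x; rewrite -[X in _ --> X]mul1r; apply: cvgM; last exact: cvg_cst.
  rewrite -[X in _ --> X](@expR0 R).
  apply: (@cvg_comp _ _ _ (fun m => - (2^-1 * e m) * `|x|) expR); last exact: continuous_expR.
  have -> : 0 = - (2^-1 * 0) * `|x| by rewrite mulr0 oppr0 mul0r.
  apply: cvgM; last exact: cvg_cst.
  by apply: cvgN; apply: cvgM; [exact: cvg_cst|exact: cvg_harmonic].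
Qed.

Section Bounds.
Variable f : R -> R.
Hypothesis fi : mu.-integrable setT (EFin \o f).

Lemma nsq_cosT : (nsq mu (cosT f) <= (2 * pi)%:E * nsq mu f)%E.
Proof.
apply: fatou_expw; first exact: measurable_cosT.
move=> e e0; apply: le_trans (poisson_bound fi e0).
apply: ge0_le_integral => //.
- by move=> x _; rewrite lee_fin mulr_ge0 ?expR_ge0 ?sqr_ge0.
- apply/measurable_EFinP; apply: measurable_funM.
    by apply: (@continuous_measurable_fun R); exact: continuous_expw.
  by apply: measurable_funX; exact: measurable_cosT.
- apply/measurable_EFinP; apply: measurable_funM.
    by apply: (@continuous_measurable_fun R); exact: continuous_expw.
  by apply: measurable_funD; apply: measurable_funX;
    [exact: measurable_cosT|exact: measurable_sinT].
- by move=> x _; rewrite lee_fin ler_wpM2l ?expR_ge0 // lerDl sqr_ge0.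
Qed.

Lemma nsq_sinT : (nsq mu (sinT f) <= (2 * pi)%:E * nsq mu f)%E.
Proof.
apply: fatou_expw; first exact: measurable_sinT.
move=> e e0; apply: le_trans (poisson_bound fi e0).
apply: ge0_le_integral => //.
- by move=> x _; rewrite lee_fin mulr_ge0 ?expR_ge0 ?sqr_ge0.
- apply/measurable_EFinP; apply: measurable_funM.
    by apply: (@continuous_measurable_fun R); exact: continuous_expw.
  by apply: measurable_funX; exact: measurable_sinT.
- apply/measurable_EFinP; apply: measurable_funM.
    by apply: (@continuous_measurable_fun R); exact: continuous_expw.
  by apply: measurable_funD; apply: measurable_funX;
    [exact: measurable_cosT|exact: measurable_sinT].
- by move=> x _; rewrite lee_fin ler_wpM2l ?expR_ge0 // lerDr sqr_ge0.
Qed.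

End Bounds.
End FourierL2.

(** * Hankel operators on the half-line *)
Section HalfLine.
Context {R : realType}.
Local Notation mu := (@lebesgue_measure R).
Local Notation nq := (nsq mu).
Local Notation sq := (sqint mu).
Implicit Types f g : R -> R.

Lemma sqint_meas f : f \in sq -> measurable_fun setT f.
Proof. by case/sqintP. Qed.

Definition hl : R -> R := \1_(`]0, +oo[%classic : set R).

Lemma hlE x : hl x = (0 < x)%R%:R.
Proof. by rewrite /hl indicE mem_setE in_itv /= andbT. Qed.

Lemma measurable_hl : measurable_fun setT hl.
Proof. exact: measurable_indic. Qed.

(** Functions on the half-line are kept as functions on the line vanishing for [x <= 0], so that a
    single space of square integrable functions serves. *)
Definition trunc f : R -> R := fun x => hl x * f x.

Lemma trunc_pos f x : 0 < x -> trunc f x = f x.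
Proof. by move=> x0; rewrite /trunc hlE x0 mul1r. Qed.

Lemma trunc_npos f x : x <= 0 -> trunc f x = 0.
Proof. by move=> x0; rewrite /trunc hlE ltNge x0 mul0r. Qed.

Lemma eq_trunc f g : (forall x, 0 < x -> f x = g x) -> trunc f = trunc g.
Proof.
move=> fg; apply/funext => x; have [x0|x0] := leP x 0.
  by rewrite !trunc_npos.
by rewrite !trunc_pos ?fg.
Qed.

Lemma measurable_trunc f : measurable_fun setT f -> measurable_fun setT (trunc f).
Proof. by move=> mf; apply: measurable_funM => //; exact: measurable_hl. Qed.

Lemma trunc_sqr_le f x : trunc f x ^+ 2 <= f x ^+ 2.
Proof.
have [x0|x0] := leP x 0; last by rewrite trunc_pos.
by rewrite trunc_npos // expr0n sqr_ge0.
Qed.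

Lemma sqint_trunc f : f \in sq -> trunc f \in sq.
Proof.
move=> fs; apply: (sqint_le _ fs); last exact: trunc_sqr_le.
by apply: measurable_trunc; case/sqintP: fs.
Qed.

Lemma nsq_trunc_le f : measurable_fun setT f -> (nq (trunc f) <= nq f)%E.
Proof.
by move=> mf; apply: nsq_le => //; [exact: measurable_trunc|exact: trunc_sqr_le].
Qed.

Lemma nsqZ (a : R) f : measurable_fun setT f ->
  nq (fun x => a * f x) = ((a ^+ 2)%:E * nq f)%E.
Proof.
move=> mf; rewrite /nsq -ge0_integralZl_EFin ?sqr_ge0 //.
- by apply: eq_integral => x _; rewrite exprMn.
- by move=> x _; rewrite lee_fin sqr_ge0.
- exact: measurable_sqr.
Qed.

Lemma nsqD_le f g : measurable_fun setT f -> measurable_fun setT g ->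
  (nq (fun x => (f x + g x)%R) <= 2%:E * (nq f + nq g))%E.
Proof.
move=> mf mg; rewrite /nsq -ge0_integralD //; last 4 first.
- by move=> x _; rewrite lee_fin sqr_ge0.
- exact: measurable_sqr.
- by move=> x _; rewrite lee_fin sqr_ge0.
- exact: measurable_sqr.
rewrite -ge0_integralZl_EFin //; last 2 first.
- by move=> x _; rewrite -EFinD lee_fin addr_ge0 ?sqr_ge0.
- by apply: emeasurable_funD; exact: measurable_sqr.
apply: ge0_le_integral => //.
- by move=> x _; rewrite lee_fin sqr_ge0.
- by apply: measurable_sqr; exact: measurable_funD.
- by under eq_fun do rewrite -EFinD -EFinM; apply/measurable_EFinP;
    apply: measurable_funM => //; apply: measurable_funD; exact: measurable_funX.
- move=> x _; rewrite -EFinD -EFinM lee_fin.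
  by have := sqr_ge0 (f x - g x); lra.
Qed.

Lemma nsqB_le f g : measurable_fun setT f -> measurable_fun setT g ->
  (nq (fun x => (f x - g x)%R) <= 2%:E * (nq f + nq g))%E.
Proof.
move=> mf mg; have := @nsqD_le f (fun x => -1 * g x) mf (measurable_funM (@measurable_cst _ _ _ _ _ _) mg).
rewrite nsqZ // sqrrN expr1n mul1e.
by under [X in (nq X <= _)%E -> _]eq_fun do rewrite mulN1r.
Qed.

Lemma nsq_shift f a : measurable_fun setT f -> nq (fun x => f (x + a)) = nq f.
Proof.
move=> mf; rewrite /nsq.
apply: (ge0_integral_shift (f := fun x => ((f x) ^+ 2)%:E)).
  exact: measurable_sqr.
by move=> x; rewrite lee_fin sqr_ge0.
Qed.

End HalfLine.

(** * Hankel operators with a bounded symbol *)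

Section FourierKernel.
Context {R : realType}.
Local Notation mu := (@lebesgue_measure R).
Local Notation nq := (nsq mu).
Local Notation sq := (sqint mu).
Implicit Types a b f g : R -> R.

(* The kernel z |-> Re (int c(xi) e^(i xi z) d xi) of the symbol c = a + i b. *)
Definition fker a b (z : R) : R := cosT a z - sinT b z.

Lemma fkerE a b z : mu.-integrable setT (EFin \o a) ->
  mu.-integrable setT (EFin \o b) ->
  fker a b z = \int[mu]_xi (a xi * cos (z * xi) - b xi * sin (z * xi)).
Proof.
move=> ia ib; rewrite RintegralB //; first exact: (integrable_fcos ia z).
exact: (integrable_fsin ib z).
Qed.

Lemma measurable_fker a b : mu.-integrable setT (EFin \o a) ->
  mu.-integrable setT (EFin \o b) -> measurable_fun setT (fker a b).
Proof.
by move=> ia ib; apply: measurable_funB; [exact: measurable_cosT|exact: measurable_sinT].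
Qed.

Lemma nsq_fker a b : mu.-integrable setT (EFin \o a) ->
  mu.-integrable setT (EFin \o b) ->
  (nq (fker a b) <= (4 * pi)%:E * (nq a + nq b))%E.
Proof.
move=> ia ib; apply: le_trans (nsqB_le (measurable_cosT ia) (measurable_sinT ib)) _.
rewrite (_ : 4 * pi = 2 * (2 * pi)) ?(EFinM 2); last by ring.
rewrite -muleA lee_wpmul2l // ge0_muleDr ?nsq_ge0 //.
by apply: leeD; [exact: nsq_cosT|exact: nsq_sinT].
Qed.

Record symbol_le (M : R) a b : Prop := SymbolLe {
  symbol_int1 : mu.-integrable setT (EFin \o a) ;
  symbol_int2 : mu.-integrable setT (EFin \o b) ;
  symbol_bound : forall xi, a xi ^+ 2 + b xi ^+ 2 <= M ^+ 2 }.

Section Bounded.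
Variables (M : R) (a b : R -> R).
Hypotheses (M0 : 0 <= M) (sab : symbol_le M a b).

Let ia := symbol_int1 sab.
Let ib := symbol_int2 sab.
Let ma := measurable_int ia.
Let mb := measurable_int ib.

Let a_le xi : `|a xi| <= M.
Proof.
rewrite -ler_sqr ?nnegrE // real_normK ?num_real //.
by apply: le_trans (symbol_bound sab xi); rewrite lerDl sqr_ge0.
Qed.

Let b_le xi : `|b xi| <= M.
Proof.
rewrite -ler_sqr ?nnegrE // real_normK ?num_real //.
by apply: le_trans (symbol_bound sab xi); rewrite lerDr sqr_ge0.
Qed.

Lemma integrable_bounded_sqint f : mu.-integrable setT (EFin \o f) ->
  (forall xi, `|f xi| <= M) -> f \in sq.
Proof.
move=> fi fM; have mf := measurable_int fi.
apply/sqintP; split => //.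
apply: le_lt_trans (integrable_lty measurableT (integrableZl measurableT M (integrable_norm fi))).
apply: ge0_le_integral => //.
- by move=> x _; rewrite lee_fin sqr_ge0.
- exact: measurable_sqr.
- by case/integrableP: (integrableZl measurableT M (integrable_norm fi)).
- move=> x _; rewrite lee_fin -(real_normK (num_real (f x))) expr2.
  by rewrite ler_wpM2r.
Qed.

Lemma symbol_sqint1 : a \in sq. Proof. exact: integrable_bounded_sqint. Qed.
Lemma symbol_sqint2 : b \in sq. Proof. exact: integrable_bounded_sqint. Qed.

Lemma sqint_fker : fker a b \in sq.
Proof.
apply/sqintP; split; first exact: measurable_fker.
apply: le_lt_trans (nsq_fker ia ib) _.
have /sqintP[_ ay] := symbol_sqint1; have /sqintP[_ by_] := symbol_sqint2.
by rewrite lte_mul_pinfty ?lee_fin ?mulr_ge0 ?pi_ge0 // lte_add_pinfty.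
Qed.

(** The integral runs over the whole line; the operator of the half-line is obtained by truncating
    before and after, which does not increase the norm. *)
Definition hankel (g f : R -> R) (p : R) : R := \int[mu]_s (g (s + p) * f s).

Section Integrable.
Variable f : R -> R.
Hypothesis fi : mu.-integrable setT (EFin \o f).

Let n1 := \int[mu]_x `|f x|.
Let a' xi := a xi * cosT f xi - b xi * sinT f xi.
Let b' xi := a xi * sinT f xi + b xi * cosT f xi.

Let mf := measurable_int fi.

Let n1_ge0 : 0 <= n1. Proof. exact: Rintegral_ge0. Qed.

Let ab_le xi : a' xi ^+ 2 + b' xi ^+ 2 <= M ^+ 2 * (cosT f xi ^+ 2 + sinT f xi ^+ 2).
Proof.
rewrite (_ : _ + _ = (a xi ^+ 2 + b xi ^+ 2) * (cosT f xi ^+ 2 + sinT f xi ^+ 2)).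
  by rewrite ler_wpM2r ?addr_ge0 ?sqr_ge0 // (symbol_bound sab).
by rewrite /a' /b'; ring.
Qed.

Let int_mul (u v : R -> R) : mu.-integrable setT (EFin \o u) ->
  measurable_fun setT v -> (forall x, `|v x| <= n1) ->
  mu.-integrable setT (EFin \o (fun x => u x * v x)).
Proof.
move=> iu mv vn; apply: (le_integrable measurableT _ _ (integrableZl measurableT n1 (integrable_norm iu))).
  by apply/measurable_EFinP; apply: measurable_funM => //; exact: measurable_int iu.
move=> x _; rewrite /= lee_fin normrM mulrC.
by rewrite [X in _ <= X]ger0_norm ?mulr_ge0 // ler_wpM2r.
Qed.

Let symbol_hankel : symbol_le (M * (2 * n1)) a' b'.
Proof.
have i1 := int_mul ia (measurable_cosT fi) (norm_cosT fi).
have i2 := int_mul ib (measurable_sinT fi) (norm_sinT fi).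
have i3 := int_mul ia (measurable_sinT fi) (norm_sinT fi).
have i4 := int_mul ib (measurable_cosT fi) (norm_cosT fi).
split.
- exact: (integrableB measurableT i1 i2).
- exact: (integrableD measurableT i3 i4).
- move=> xi; apply: le_trans (ab_le xi) _; rewrite exprMn ler_wpM2l ?sqr_ge0 //.
  have h (u : R) : `|u| <= n1 -> u ^+ 2 <= n1 ^+ 2.
    by move=> un; rewrite -(real_normK (num_real u)) lerXn2r ?nnegrE.
  have := h _ (norm_cosT fi xi); have := h _ (norm_sinT fi xi); have := sqr_ge0 n1.
  rewrite exprMn; lra.
Qed.

(** By Fubini the Hankel operator becomes a multiplier: [a'] + i [b'] is the product of the symbol a
    + i b with the transform [cosT f] + i [sinT f]. *)
Lemma hankel_fker p : hankel (fker a b) f p = fker a' b' p.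
Proof.
pose F (z : R * R) := (a z.1 * cos ((z.2 + p) * z.1) - b z.1 * sin ((z.2 + p) * z.1)) * f z.2.
have mz : measurable_fun setT (fun z : R * R => (z.2 + p) * z.1).
  apply: measurable_funM; last exact: measurable_fst.
  by apply: measurable_funD; [exact: measurable_snd|exact: measurable_cst].
have mF : measurable_fun setT F.
  apply: measurable_funM; last exact: (measurableT_comp mf measurable_snd).
  apply: measurable_funB; apply: measurable_funM.
  - exact: (measurableT_comp ma measurable_fst).
  - exact: (measurableT_comp measurable_cos mz).
  - exact: (measurableT_comp mb measurable_fst).
  - exact: (measurableT_comp measurable_sin mz).
have iab : mu.-integrable setT (EFin \o (fun xi => `|a xi| + `|b xi|)).
  exact: (integrableD measurableT (integrable_norm ia) (integrable_norm ib)).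
have Fle x y : `|F (x, y)| <= (`|a x| + `|b x|) * `|f y|.
  rewrite /F /= normrM ler_wpM2r //; apply: le_trans (ler_normB _ _) _.
  by rewrite !normrM; apply: lerD; rewrite ler_piMr ?cos_max ?sin_max.
have E := dominated_Fubini (m1 := mu) (m2 := mu) mF iab (integrable_norm fi) Fle.
rewrite /hankel.
transitivity (\int[mu]_s (\int[mu]_xi F (xi, s))).
  apply: eq_Rintegral => s _; rewrite fkerE // /F /= -RintegralZr //.
  exact: (integrableB measurableT (integrable_fcos ia (s + p)) (integrable_fsin ib (s + p))).
rewrite -E fkerE; [|exact: (symbol_int1 symbol_hankel)|exact: (symbol_int2 symbol_hankel)].
apply: eq_Rintegral => xi _; rewrite /F /=.
pose A := a xi * cos (p * xi) - b xi * sin (p * xi).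
pose B := - (a xi * sin (p * xi)) - b xi * cos (p * xi).
transitivity (\int[mu]_s (f s * (cos (xi * s) * A + sin (xi * s) * B))).
  apply: eq_Rintegral => s _; rewrite !(mulrDl s) cosD sinD !(mulrC s) /A /B; ring.
by rewrite Rint_cos_sin // /A /B /a' /b'; ring.
Qed.

(** The multiplier is bounded by [M], and the Plancherel bound costs a factor [4 * pi] twice: once
    from the product symbol to its kernel, once from [f] to its transform. *)
Lemma nsq_hankel_int :
  (nq (hankel (fker a b) f) <= ((4 * pi * M) ^+ 2)%:E * nq f)%E.
Proof.
have -> : hankel (fker a b) f = fker a' b'.
  by apply/funext => p; exact: hankel_fker.
apply: le_trans (nsq_fker (symbol_int1 symbol_hankel) (symbol_int2 symbol_hankel)) _.
have ma' := measurable_int (symbol_int1 symbol_hankel).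
have mb' := measurable_int (symbol_int2 symbol_hankel).
have mC := measurable_cosT fi; have mS := measurable_sinT fi.
have h : (nq a' + nq b' <= (M ^+ 2)%:E * (nq (cosT f) + nq (sinT f)))%E.
  rewrite /nsq -!ge0_integralD //; do ?[exact: measurable_sqr];
    do ?[by move=> x _; rewrite lee_fin sqr_ge0].
  rewrite -ge0_integralZl_EFin ?sqr_ge0 //; last 2 first.
  - by move=> x _; rewrite -EFinD lee_fin addr_ge0 ?sqr_ge0.
  - by apply: emeasurable_funD; exact: measurable_sqr.
  apply: ge0_le_integral => //.
  - by move=> x _; rewrite -EFinD lee_fin addr_ge0 ?sqr_ge0.
  - by apply: emeasurable_funD; exact: measurable_sqr.
  - by apply: emeasurable_funM => //; apply: emeasurable_funD; exact: measurable_sqr.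
  - by move=> x _; rewrite -!EFinD -EFinM lee_fin ab_le.
have h2 : (nq (cosT f) + nq (sinT f) <= (4 * pi)%:E * nq f)%E.
  rewrite (_ : 4 * pi = 2 * pi + 2 * pi); last by ring.
  rewrite EFinD ge0_muleDl ?lee_fin ?mulr_ge0 ?pi_ge0 //.
  by apply: leeD; [exact: nsq_cosT|exact: nsq_sinT].
apply: le_trans (lee_wpmul2l _ h) _; first by rewrite lee_fin mulr_ge0 ?pi_ge0.
rewrite muleA; apply: le_trans (lee_wpmul2l _ h2) _.
  by rewrite -EFinM lee_fin mulr_ge0 ?sqr_ge0 // mulr_ge0 ?pi_ge0.
rewrite muleA -!EFinM (_ : 4 * pi * M ^+ 2 * (4 * pi) = (4 * pi * M) ^+ 2) //.
by ring.
Qed.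

End Integrable.

Lemma integrable_sq_mul_shift g f p : g \in sq -> f \in sq ->
  mu.-integrable setT (EFin \o (fun s => g (s + p) * f s)).
Proof.
move=> gs fs; apply: (@sqintM _ _ _ mu (fun s => g (s + p)) f) => //.
move/sqintP: gs => [mg gy]; apply/sqintP; split; last by rewrite nsq_shift.
by apply: (measurableT_comp mg); exact: measurable_shift.
Qed.

Lemma measurable_hankel g f : measurable_fun setT g -> measurable_fun setT f ->
  measurable_fun setT (hankel g f).
Proof.
move=> mg mf; apply: (measurable_Rintegral mu (F := fun z => g (z.2 + z.1) * f z.2)).
apply: measurable_funM; last exact: (measurableT_comp mf measurable_snd).
apply: (measurableT_comp mg).
by apply: measurable_funD; [exact: measurable_snd|exact: measurable_fst].
Qed.

(** [f] is cut off to [-m, m] to make it integrable. Kernel and [f] being square integrable, the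
    images converge at every point by dominated convergence, and Fatou's lemma concludes. *)
Lemma nsq_hankel f : f \in sq ->
  (nq (hankel (fker a b) f) <= ((4 * pi * M) ^+ 2)%:E * nq f)%E.
Proof.
move=> fs; have mf := sqint_meas fs.
pose c (m : nat) : set R := `[- m%:R, m%:R]%classic.
have mc m : measurable (c m) by exact: measurable_itv.
pose fm m x := \1_(c m) x * f x.
have mfm m : measurable_fun setT (fm m).
  by apply: measurable_funM => //; exact: measurable_indic.
have fm_le m x : fm m x ^+ 2 <= f x ^+ 2.
  by rewrite /fm exprMn indicE ler_piMl ?sqr_ge0 //; case: (_ \in _);
    rewrite ?expr1n ?expr0n.
have fmi m : mu.-integrable setT (EFin \o fm m).
  apply: (@sqintM _ _ _ mu (\1_(c m)) f) => //.
  have m1 : measurable_fun setT (\1_(c m) : R -> R) by exact: measurable_indic.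
  apply/sqintP; split; first exact: m1.
  rewrite /nsq (_ : (\int[mu]_x _)%E = (\int[mu]_x (\1_(c m) x)%:E)%E); last first.
    by apply: eq_integral => x _; rewrite indicE; case: (_ \in _); rewrite ?expr1n ?expr0n.
  exact: (integrable_lty measurableT (integrable_indic_itv _ _ true false)).
have mk := measurable_fker ia ib.
apply: (@fatou_nsq _ _ _ mu (fun m => hankel (fker a b) (fm m))).
- by move=> m; exact: measurable_hankel.
- exact: measurable_hankel.
- move=> m; apply: le_trans (nsq_hankel_int (fmi m)) _.
  apply: lee_wpmul2l; first by rewrite lee_fin sqr_ge0.
  by apply: nsq_le; [exact: mfm|exact: mf|exact: fm_le].
- apply: aeW => p; rewrite /hankel.
  have ig := integrable_sq_mul_shift p sqint_fker fs.
  have mks : measurable_fun setT (fun s : R => fker a b (s + p)).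
    by apply: (measurableT_comp mk); exact: measurable_shift.
  have [|||||_ _] := @dominated_convergence _ _ _ mu setT measurableT
    (fun m (s : R) => (fker a b (s + p) * fm m s)%:E)
    (fun s : R => (fker a b (s + p) * f s)%:E)
    (fun s : R => (`|fker a b (s + p) * f s|)%:E).
  + by move=> m; apply/measurable_EFinP; exact: (measurable_funM mks (mfm m)).
  + by apply/measurable_EFinP; exact: (measurable_funM mks mf).
  + apply: aeW => s _; apply: cvg_EFin; first exact: nearW.
    apply: cvgM; first exact: cvg_cst.
    apply: cvg_near_cst; near=> m.
    have cs : c m s.
      rewrite /c /= in_itv /= -ler_norml.
      by near: m; exact: nbhs_infty_ger.
    by rewrite /fm indicE mem_set // mul1r.
  + exact: (integrable_norm ig).
  + apply: aeW => s m _; rewrite lee_fin !normrM ler_wpM2l // ler_piMl //.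
    by rewrite indicE; case: (_ \in _); rewrite ?normr1 ?normr0.
  by move=> h; apply: fine_cvg; rewrite /Rintegral fineK //; exact: integrable_fin_num ig.
Unshelve. all: by end_near.
Qed.

End Bounded.
End FourierKernel.

(** * Elementary bounds for e^(it) *)

Section TrigBounds.
Context {R : realType}.
Implicit Types t : R.

Lemma norm_sin_le t : `|sin t| <= `|t|.
Proof.
wlog t0 : t / 0 <= t.
  move=> h; have [t0|t0] := leP 0 t; first exact: h.
  by rewrite -normrN -sinN -(normrN t); apply: h; rewrite oppr_ge0 ltW.
have [c _ e] := @MVT_segment R sin cos 0 t t0 (fun x _ => is_derive_sin x)
  (continuous_subspaceT (@continuous_sin R)).
by move: e; rewrite sin0 !subr0 => ->; rewrite normrM ler_piMl // cos_max.
Qed.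

Lemma one_sub_cos t : 1 - cos t = 2 * sin (t / 2) ^+ 2.
Proof.
have {1}-> : t = t / 2 + t / 2 by field.
rewrite cosD; have := cos2Dsin2 (t / 2); nra.
Qed.

Lemma one_sub_cos_le t : 0 <= 1 - cos t <= t ^+ 2 / 2.
Proof.
rewrite one_sub_cos mulr_ge0 ?sqr_ge0 //=.
have : sin (t / 2) ^+ 2 <= (t / 2) ^+ 2.
  by rewrite -(real_normK (num_real (sin _))) -(real_normK (num_real (t / 2)))
    lerXn2r ?nnegrE ?norm_sin_le.
by rewrite exprMn; lra.
Qed.

(** The left side is |e^(it) - 1|^2 = 2 (1 - cos t). *)
Lemma norm_expi_sub1 t : (cos t - 1) ^+ 2 + sin t ^+ 2 <= t ^+ 2.
Proof.
have := cos2Dsin2 t; have /andP[_] := one_sub_cos_le t; lra.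
Qed.

(** The left side is |e^(it) - 1 - it|^2. Each square is at most t^4; for the sine, the mean value
    theorem gives sin t - t = (cos c - 1) t with |cos c - 1| <= |c|. *)
Lemma norm_expi_sub1_sub t :
  (cos t - 1) ^+ 2 + (sin t - t) ^+ 2 <= 2 * (t ^+ 2) ^+ 2.
Proof.
have /andP[h1 h2] := one_sub_cos_le t.
have hs : `|sin t - t| <= t ^+ 2.
  wlog t0 : t {h1 h2} / 0 <= t.
    move=> h; have [t0|t0] := leP 0 t; first exact: h.
    by rewrite -normrN opprB -[X in X - _]opprK addrC -sinN -sqrrN;
      apply: h; rewrite oppr_ge0 ltW.
  have d x : x \in `]0, t[ -> is_derive x 1 (fun x => sin x - x) (cos x - 1).
    by move=> _; apply: is_derive_eq.
  have cF : continuous (fun x : R => sin x - x).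
    by apply: (is_derive_continuous (f' := fun x => cos x - 1)) => x; apply: is_derive_eq.
  have [c] := @MVT_segment R _ _ 0 t t0 d (continuous_subspaceT cF).
  rewrite in_itv /= => /andP[c0 ct]; rewrite sin0 !subr0 => ->.
  rewrite normrM (ger0_norm t0) expr2 ler_wpM2r //.
  apply: le_trans ct.
  rewrite -ler_sqr ?nnegrE // real_normK ?num_real //.
  by apply: le_trans (norm_expi_sub1 c); rewrite lerDl sqr_ge0.
have : (sin t - t) ^+ 2 <= (t ^+ 2) ^+ 2.
  by rewrite -(real_normK (num_real (sin t - t))) lerXn2r ?nnegrE ?sqr_ge0.
have : (cos t - 1) ^+ 2 <= (t ^+ 2) ^+ 2.
  rewrite -sqrrN opprB lerXn2r ?nnegrE ?sqr_ge0 //.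
  by apply: le_trans h2 _; have := sqr_ge0 t; lra.
by lra.
Qed.

End TrigBounds.

(** * Kernels of bounded Hankel operators on the half-line *)

Section HankelClass.
Context {R : realType}.
Local Notation mu := (@lebesgue_measure R).
Local Notation nq := (nsq mu).
Local Notation sq := (sqint mu).
Implicit Types f g : R -> R.

Lemma nsq_sqr_le f (A : R) : measurable_fun setT f -> 0 <= A ->
  (nq f <= (A ^+ 2)%:E)%E -> exists F : L2 mu, (F : R -> R) = f /\ sn (ip2 (mu:=mu)) F <= A.
Proof.
move=> mf A0 h; have fs : f \in sq.
  by apply/sqintP; split => //; apply: le_lt_trans h (ltry _).
by exists (MkL2 fs); split => //; apply: sn_nsq_le.
Qed.

Lemma nsqD_sqr_le f g (A B : R) : measurable_fun setT f -> measurable_fun setT g ->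
  0 <= A -> 0 <= B -> (nq f <= (A ^+ 2)%:E)%E -> (nq g <= (B ^+ 2)%:E)%E ->
  (nq (fun x => (f x + g x)%R) <= ((A + B) ^+ 2)%:E)%E.
Proof.
move=> mf mg A0 B0 fA gB.
have [F [<- FA]] := nsq_sqr_le mf A0 fA.
have [G [<- GB]] := nsq_sqr_le mg B0 gB.
rewrite -[X in nq X]/(L2fun (F + G)) nsq_sn lee_fin lerXn2r ?nnegrE ?sn_ge0 ?addr_ge0 //.
apply: le_trans (ler_snD _ _ _) _; [exact: semi_inner_ip2|exact: lerD].
Qed.

(** The L^2 bound on the half-line makes the Hankel integrals converge at each p >= 0 and controls
    right-hand sides of the system; the operator bound is independent of it. One constant covers
    both, so that increments are estimated only once. *)
Record hank (M : R) g : Prop := Hank {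
  hank_meas : measurable_fun setT g ;
  hank_l2 : (nq (trunc g) <= (M ^+ 2)%:E)%E ;
  hank_op : forall f, f \in sq ->
    (nq (trunc (hankel g (trunc f))) <= (M ^+ 2)%:E * nq f)%E }.

Lemma hank_le M1 M2 g : 0 <= M1 -> M1 <= M2 -> hank M1 g -> hank M2 g.
Proof.
move=> M0 M12 [mg l2 op].
have h : M1 ^+ 2 <= M2 ^+ 2 by rewrite lerXn2r ?nnegrE // (le_trans M0).
split => //; first by apply: le_trans l2 _; rewrite lee_fin.
by move=> f fs; apply: le_trans (op f fs) _; rewrite lee_wpmul2r ?nsq_ge0.
Qed.

Lemma hank_sqint M g : hank M g -> trunc g \in sq.
Proof.
case=> mg l2 _; apply/sqintP; split; first exact: measurable_trunc.
exact: le_lt_trans l2 (ltry _).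
Qed.

(* For p >= 0 the shift moves the half-line into itself. *)
Lemma hank_integrable M g f p : 0 <= p -> hank M g -> f \in sq ->
  mu.-integrable setT (EFin \o (fun s => g (s + p) * trunc f s)).
Proof.
move=> p0 hg fs.
have := integrable_sq_mul_shift p (hank_sqint hg) (sqint_trunc fs).
apply: eq_integrable => // s _ /=; have [s0|s0] := leP s 0.
  by rewrite !(trunc_npos _ s0) !mulr0.
by rewrite (trunc_pos _ (_ : 0 < s + p)) // ltr_wpDr.
Qed.

Lemma hankelDl M1 M2 g1 g2 f p : 0 <= p -> hank M1 g1 -> hank M2 g2 -> f \in sq ->
  hankel (fun z => g1 z + g2 z) (trunc f) p =
  hankel g1 (trunc f) p + hankel g2 (trunc f) p.
Proof.
move=> p0 h1 h2 fs; rewrite /hankel -RintegralD //;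
  [|exact: hank_integrable h1 fs|exact: hank_integrable h2 fs].
by apply: eq_Rintegral => s _; rewrite mulrDl.
Qed.

Lemma hankelZl M g f p (a : R) : 0 <= p -> hank M g -> f \in sq ->
  hankel (fun z => a * g z) (trunc f) p = a * hankel g (trunc f) p.
Proof.
move=> p0 h fs; rewrite /hankel -RintegralZl //; last exact: hank_integrable h fs.
by apply: eq_Rintegral => s _; rewrite mulrA.
Qed.

Lemma hankelDr M g f1 f2 p : 0 <= p -> hank M g -> f1 \in sq -> f2 \in sq ->
  hankel g (trunc (fun x => f1 x + f2 x)) p =
  hankel g (trunc f1) p + hankel g (trunc f2) p.
Proof.
move=> p0 h fs1 fs2; rewrite /hankel -RintegralD //;
  [|exact: hank_integrable h fs1|exact: hank_integrable h fs2].
by apply: eq_Rintegral => s _; rewrite -mulrDr; congr (_ * _); rewrite /trunc mulrDr.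
Qed.

Lemma hankelZr M g f p (a : R) : 0 <= p -> hank M g -> f \in sq ->
  hankel g (trunc (fun x => a * f x)) p = a * hankel g (trunc f) p.
Proof.
move=> p0 h fs; rewrite /hankel -RintegralZl //; last exact: hank_integrable h fs.
by apply: eq_Rintegral => s _; rewrite /trunc; ring.
Qed.

Lemma truncD f g : trunc (fun x => f x + g x) = (fun x => trunc f x + trunc g x).
Proof. by apply/funext => x; rewrite /trunc mulrDr. Qed.

Lemma truncZ (a : R) f : trunc (fun x => a * f x) = (fun x => a * trunc f x).
Proof. by apply/funext => x; rewrite /trunc mulrCA. Qed.

Lemma measurable_trunc_hankel g f : measurable_fun setT g -> measurable_fun setT f ->
  measurable_fun setT (trunc (hankel g (trunc f))).
Proof.
by move=> mg mf; apply: measurable_trunc; apply: measurable_hankel => //;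
  exact: measurable_trunc.
Qed.

Lemma hankD M1 M2 g1 g2 : 0 <= M1 -> 0 <= M2 -> hank M1 g1 -> hank M2 g2 ->
  hank (M1 + M2) (fun z => g1 z + g2 z).
Proof.
move=> M10 M20 h1 h2; have [m1 l1 o1] := h1; have [m2 l2 o2] := h2.
split; first exact: measurable_funD.
  by rewrite truncD; apply: nsqD_sqr_le => //; exact: measurable_trunc.
move=> f fs; have mf := sqint_meas fs.
rewrite (@eq_trunc _ _ (fun p => hankel g1 (trunc f) p + hankel g2 (trunc f) p)); last first.
  by move=> p p0; exact: (hankelDl (ltW p0) h1 h2).
rewrite truncD.
have := o1 f fs; have := o2 f fs.
rewrite -[f]/(L2fun (MkL2 fs)) nsq_sn /= -!EFinM -!exprMn => e2 e1.
rewrite mulrDl; apply: nsqD_sqr_le => //.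
- exact: measurable_trunc_hankel.
- exact: measurable_trunc_hankel.
- by rewrite mulr_ge0 // sn_ge0.
- by rewrite mulr_ge0 // sn_ge0.
Qed.

Lemma hankZ M g (a : R) : hank M g -> hank (`|a| * M) (fun z => a * g z).
Proof.
move=> h; have [mg l2 op] := h.
split; first exact: measurable_funM.
  rewrite truncZ nsqZ; last exact: measurable_trunc.
  by rewrite exprMn real_normK ?num_real // (EFinM (a ^+ 2)) lee_wpmul2l // lee_fin sqr_ge0.
move=> f fs; have mf := sqint_meas fs.
rewrite (@eq_trunc _ _ (fun p => a * hankel g (trunc f) p)); last first.
  by move=> p p0; exact: (hankelZl _ (ltW p0) h).
rewrite truncZ nsqZ; last exact: measurable_trunc_hankel.
rewrite exprMn real_normK ?num_real // (EFinM (a ^+ 2)) -muleA lee_wpmul2l ?op //.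
by rewrite lee_fin sqr_ge0.
Qed.

Lemma hankel_fker_op (W : R) a b x f : 0 <= W -> symbol_le W a b -> f \in sq ->
  (nq (trunc (hankel (fun z => fker a b (x + z)) (trunc f))) <=
    ((4 * pi * W) ^+ 2)%:E * nq f)%E.
Proof.
move=> W0 sab fs; have fst := sqint_trunc fs; have mf := sqint_meas fs.
have mtf := measurable_trunc mf.
have mk := measurable_fker (symbol_int1 sab) (symbol_int2 sab).
have -> : hankel (fun z => fker a b (x + z)) (trunc f) =
    (fun p => hankel (fker a b) (trunc f) (p + x)).
  apply/funext => p; apply: eq_Rintegral => s _.
  by congr (fker _ _ _ * _); ring.
have mh := measurable_hankel mk mtf.
apply: le_trans (nsq_trunc_le _) _.
  by apply: (measurableT_comp mh); exact: measurable_shift.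
rewrite nsq_shift //; apply: le_trans (nsq_hankel W0 sab fst) _.
by apply: lee_wpmul2l; [rewrite lee_fin sqr_ge0|exact: nsq_trunc_le].
Qed.

(** The weight 1 + xi^2 provides the L^2 bound: the squared norm of the symbol is at most W^2 times
    the integral of 1 / (1 + xi^2), which is pi. The operator bound needs only that the symbol is
    bounded by [W]. *)
Lemma hank_fker (W : R) a b x : 0 <= W ->
  mu.-integrable setT (EFin \o a) -> mu.-integrable setT (EFin \o b) ->
  (forall xi, (1 + xi ^+ 2) * (a xi ^+ 2 + b xi ^+ 2) <= W ^+ 2) ->
  hank (4 * pi * W) (fun z => fker a b (x + z)).
Proof.
move=> W0 ia ib h.
have sab : symbol_le W a b.
  split => // xi; apply: le_trans (h xi); rewrite ler_peMl ?addr_ge0 ?sqr_ge0 //.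
  by rewrite lerDl sqr_ge0.
have mk := measurable_fker ia ib.
have mkx : measurable_fun setT (fun z => fker a b (x + z)).
  by apply: (measurableT_comp mk); exact: measurable_funD.
split => //.
- apply: le_trans (nsq_trunc_le mkx) _.
  under [X in nq X]eq_fun do rewrite addrC.
  rewrite nsq_shift //; apply: le_trans (nsq_fker ia ib) _.
  have ma := measurable_int ia; have mb := measurable_int ib.
  have : (nq a + nq b <= (W ^+ 2 * pi)%:E)%E.
    (* [2^-1 * pois 1 t] is 1 / (1 + t^2). *)
    have -> : (W ^+ 2 * pi)%:E = (\int[mu]_t (W ^+ 2 * 2^-1 * pois 1 t)%:E)%E.
      under eq_integral do rewrite EFinM.
      rewrite ge0_integralZl_EFin ?mulr_ge0 ?sqr_ge0 //; last 2 first.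
      - by move=> t _; rewrite lee_fin pois_ge0.
      - by apply/measurable_EFinP; exact: measurable_pois.
      by rewrite integral_pois // -EFinM; congr EFin; field.
    rewrite /nsq -ge0_integralD //; last 4 first.
    - by move=> t _; rewrite lee_fin sqr_ge0.
    - exact: measurable_sqr.
    - by move=> t _; rewrite lee_fin sqr_ge0.
    - exact: measurable_sqr.
    apply: ge0_le_integral => //.
    - by move=> t _; rewrite -EFinD lee_fin addr_ge0 ?sqr_ge0.
    - by apply: emeasurable_funD; exact: measurable_sqr.
    - by apply/measurable_EFinP; apply: measurable_funM => //; exact: measurable_pois.
    - move=> t _; rewrite -EFinD lee_fin /pois expr1n mulr1 mulrA -(mulrA _ 2^-1) mulVf //.
      rewrite mulr1 ler_pdivlMr ?ltr_pwDl ?sqr_ge0 // mulrC; exact: h.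
  move=> /(lee_wpmul2l (_ : (0 <= (4 * pi)%:E)%E)) => /(_ _)/le_trans; apply.
    by rewrite lee_fin mulr_ge0 ?pi_ge0.
  rewrite -EFinM lee_fin !exprMn.
  rewrite (_ : 4 * pi * (W ^+ 2 * pi) = 4 * (pi ^+ 2 * W ^+ 2)); last by ring.
  have : 0 <= pi ^+ 2 * W ^+ 2 by rewrite mulr_ge0 ?sqr_ge0.
  by rewrite -mulrA; set u := _ * _; lra.
- by move=> f; exact: hankel_fker_op.
Qed.

End HankelClass.

(** * Differentiable families of kernels *)

Section KernelFamily.
Context {R : realType}.
Local Notation mu := (@lebesgue_measure R).
Implicit Types (k : nat -> R -> R) (a b : R -> R).

(* [k l] is the l-th derivative of [k 0]; the increments of the associated
   Hankel operators have the rates of a C^(n+1) function. *)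
Record kfam (n : nat) k : Prop := KFam {
  kfam_cont : forall l, (l <= n)%N -> continuous (k l) ;
  kfam_der : forall l (z : R), (l < n)%N -> is_derive z 1 (k l) (k l.+1 z) ;
  kfam_hank : forall l x, (l <= n)%N -> exists C, 0 <= C /\
    hank C (fun z => k l (x + z)) ;
  kfam_r0 : forall l x, (l <= n)%N -> exists C, 0 <= C /\
    forall h, `|h| <= 2 -> hank (C * `|h|) (fun z => k l (x + h + z) - k l (x + z)) ;
  kfam_r1 : forall l x, (l < n)%N -> exists C, 0 <= C /\
    forall h, `|h| <= 2 -> hank (C * `|h| ^+ 2)
      (fun z => k l (x + h + z) - k l (x + z) - h * k l.+1 (x + z)) }.

Lemma eq_hank (M : R) (f g : R -> R) : f =1 g -> hank M f -> hank M g.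
Proof. by move=> /funext ->. Qed.

Lemma kfamD n k1 k2 : kfam n k1 -> kfam n k2 -> kfam n (fun l z => k1 l z + k2 l z).
Proof.
move=> [c1 d1 h1 r1 s1] [c2 d2 h2 r2 s2]; split.
- by move=> l ln z; apply: cvgD; [exact: c1|exact: c2].
- move=> l z ln; have := d1 l z ln; have := d2 l z ln => e2 e1.
  exact: is_deriveD.
- move=> l x ln; have [C1 [C10 H1]] := h1 l x ln; have [C2 [C20 H2]] := h2 l x ln.
  by exists (C1 + C2); split; [exact: addr_ge0|exact: hankD].
- move=> l x ln; have [C1 [C10 H1]] := r1 l x ln; have [C2 [C20 H2]] := r2 l x ln.
  exists (C1 + C2); split; first exact: addr_ge0.
  move=> h hh; rewrite mulrDl.
  apply: (eq_hank _ (hankD _ _ (H1 h hh) (H2 h hh))); rewrite ?mulr_ge0 //.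
  by move=> z; ring.
- move=> l x ln; have [C1 [C10 H1]] := s1 l x ln; have [C2 [C20 H2]] := s2 l x ln.
  exists (C1 + C2); split; first exact: addr_ge0.
  move=> h hh; rewrite mulrDl.
  apply: (eq_hank _ (hankD _ _ (H1 h hh) (H2 h hh))); rewrite ?mulr_ge0 ?sqr_ge0 //.
  by move=> z; ring.
Qed.

Lemma kfamZ n k (c : R) : kfam n k -> kfam n (fun l z => c * k l z).
Proof.
move=> [c1 d1 h1 r1 s1]; split.
- by move=> l ln z; apply: cvgM; [exact: cvg_cst|exact: c1].
- by move=> l z ln; have := d1 l z ln => e1; exact: is_deriveZ.
- move=> l x ln; have [C1 [C10 H1]] := h1 l x ln.
  by exists (`|c| * C1); split; [exact: mulr_ge0|exact: hankZ].
- move=> l x ln; have [C1 [C10 H1]] := r1 l x ln.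
  exists (`|c| * C1); split; first exact: mulr_ge0.
  move=> h hh; rewrite -mulrA.
  by apply: (eq_hank _ (hankZ c (H1 h hh))) => z; ring.
- move=> l x ln; have [C1 [C10 H1]] := s1 l x ln.
  exists (`|c| * C1); split; first exact: mulr_ge0.
  move=> h hh; rewrite -mulrA.
  by apply: (eq_hank _ (hankZ c (H1 h hh))) => z; ring.
Qed.

Section Exponential.
Variables (nu : R) (nu0 : 0 < nu).

Let E (z : R) := expR (- nu * z).

Let measurable_E : measurable_fun setT E.
Proof. by apply: (@continuous_measurable_fun R); exact: continuous_expRM. Qed.

Let nsq_E : (nsq mu (trunc E) < +oo)%E.
Proof.
apply: le_lt_trans (ltry (2 / (2 * nu))); rewrite -integral_expw ?mulr_gt0 //.
apply: ge0_le_integral => //.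
- by move=> x _; rewrite lee_fin sqr_ge0.
- by apply: measurable_sqr; exact: measurable_trunc.
- by apply/measurable_EFinP; apply: (@continuous_measurable_fun R); exact: continuous_expw.
- move=> x _; rewrite lee_fin; have [x0|x0] := leP x 0.
    by rewrite trunc_npos // expr0n expR_ge0.
  rewrite trunc_pos // /E /expw gtr0_norm // expr2 -expRD.
  by rewrite le_eqVlt; apply/orP; left; apply/eqP; congr expR; ring.
Qed.

Let trunc_E_sq : trunc E \in sqint mu.
Proof. by apply/sqintP; split => //; exact: measurable_trunc. Qed.

Let EL : L2 mu := MkL2 trunc_E_sq.
Let C0 := sn (ip2 (mu:=mu)) EL.

(** As E(s + p) = E(s) E(p), the operator has rank one and norm at most the squared norm [C0 ^+ 2]
    of the truncated exponential; [C0] itself is the L^2 bound. *)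
Let hank_E : hank (C0 + C0 ^+ 2) E.
Proof.
have C00 : 0 <= C0 by exact: sn_ge0.
have h1 : C0 <= C0 + C0 ^+ 2 by rewrite lerDl sqr_ge0.
have h2 : C0 ^+ 2 <= C0 + C0 ^+ 2 by rewrite lerDr.
split => //.
  rewrite -[trunc E]/(L2fun EL) nsq_sn lee_fin lerXn2r ?nnegrE //.
  by rewrite addr_ge0 ?sqr_ge0.
move=> f fs; have mf := sqint_meas fs.
pose F : L2 mu := MkL2 (sqint_trunc fs).
have -> : trunc (hankel E (trunc f)) = (fun p => ip2 EL F * trunc E p).
  apply/funext => p; rewrite /trunc mulrCA; congr (_ * _).
  rewrite /hankel /ip2 /= -RintegralZr //; last exact: (L2M EL F).
  apply: eq_Rintegral => s _; rewrite /E mulrDr expRD.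
  rewrite -/(trunc f s).
  have [s0|s0] := leP s 0; first by rewrite !(trunc_npos _ s0) !(mulr0,mul0r).
  by rewrite !(trunc_pos _ s0); ring.
rewrite nsqZ; last exact: measurable_trunc.
rewrite -[trunc E]/(L2fun EL) nsq_sn.
have e : (ip2 EL F ^+ 2 <= C0 ^+ 2 * sn (ip2 (mu:=mu)) F ^+ 2).
  rewrite -exprMn -(real_normK (num_real (ip2 _ _))) lerXn2r ?nnegrE ?mulr_ge0 ?sn_ge0 //.
  exact: (cauchy_schwarz (semi_inner_ip2 mu)).
apply: le_trans (_ : (((C0 ^+ 2) ^+ 2)%:E * nsq mu (trunc f) <= _)%E).
  rewrite -[trunc f]/(L2fun F) nsq_sn -!EFinM lee_fin.
  apply: le_trans (ler_wpM2r (sqr_ge0 C0) e) _.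
  by rewrite -/C0 le_eqVlt; apply/orP; left; apply/eqP; ring.
apply: (@le_trans _ _ (((C0 ^+ 2) ^+ 2)%:E * nsq mu f)%E).
  apply: lee_wpmul2l; first by rewrite lee_fin sqr_ge0.
  exact: nsq_trunc_le.
rewrite lee_wpmul2r ?nsq_ge0 // lee_fin lerXn2r ?nnegrE ?sqr_ge0 //.
by rewrite addr_ge0 ?sqr_ge0.
Qed.

(** expR (- t) >= 1 - t gives expR t - 1 <= t expR t, and then 0 <= expR t - 1 - t <= t (expR t -
    1). The constant is the largest value of the exponential on the range of [t]. *)
Let expR_sub1 (t : R) : `|t| <= 2 * nu ->
  `|expR t - 1| <= expR (2 * nu) * `|t| /\ `|expR t - 1 - t| <= expR (2 * nu) * `|t| ^+ 2.
Proof.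
move=> tn; have e1 := expR_ge1Dx t; have e2 := expR_ge1Dx (- t).
have e3 : expR t * expR (- t) = 1 by rewrite expRxMexpNx_1.
have e4 : expR t <= expR (2 * nu) by rewrite ler_expR; exact: le_trans (ler_norm _) tn.
have e5 : 1 <= expR (2 * nu) by apply: le_trans (expR_ge1Dx (2 * nu)); rewrite lerDl mulr_ge0 // ltW.
have p := expR_gt0 t.
have up : expR t - 1 <= t * expR t by nra.
have h1 : `|expR t - 1| <= expR (2 * nu) * `|t|.
  have [t0|t0] := leP 0 t.
    rewrite (ger0_norm t0) ger0_norm; [nra|lra].
  rewrite (ltr0_norm t0) ler0_norm; last by nra.
  by nra.
split => //.
rewrite ger0_norm; last by lra.
apply: (@le_trans _ _ (`|t| * `|expR t - 1|)).
  rewrite -normrM; apply: le_trans (ler_norm _); lra.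
rewrite expr2 mulrCA mulrA mulrC [X in _ <= X]mulrC [X in _ <= _ * X]mulrC.
by rewrite mulrC ler_wpM2l.
Qed.

(** Translating an exponential multiplies it by a scalar, so all rates reduce to those of [E h - 1]
    and [E h - 1 + nu * h]. *)
Lemma kfam_exp n : kfam n (fun l z => (- nu) ^+ l * expR (- nu * z)).
Proof.
pose c l x := (- nu) ^+ l * E x.
have EE x z : E (x + z) = E x * E z by rewrite /E mulrDr expRD.
have C10 : 0 <= C0 + C0 ^+ 2 by rewrite addr_ge0 ?sqr_ge0 ?sn_ge0.
have en0 := expR_ge0 (2 * nu).
have hh h : `|h| <= 2 -> `|- nu * h| <= 2 * nu.
  by move=> h1; rewrite normrM normrN (gtr0_norm nu0) mulrC ler_wpM2r // ltW.
split.
- move=> l _ z; apply: cvgM; [exact: cvg_cst|exact: continuous_expRM].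
- by move=> l z _; apply: is_derive_eq; rewrite /GRing.scale /= exprS; ring.
- move=> l x _; exists (`|c l x| * (C0 + C0 ^+ 2)); split; first exact: mulr_ge0.
  by apply: (eq_hank _ (hankZ (c l x) hank_E)) => z; rewrite /c -/(E _) EE mulrA.
- move=> l x _; exists (`|c l x| * (expR (2 * nu) * nu) * (C0 + C0 ^+ 2)).
  split; first by rewrite !mulr_ge0 // ltW.
  move=> h h1; have [b1 _] := expR_sub1 (hh h h1).
  have := hankZ (c l x * (E h - 1)) hank_E.
  move=> /(@hank_le _ _ (`|c l x| * (expR (2 * nu) * nu) * (C0 + C0 ^+ 2) * `|h|) _).
  move=> /(_ _ _)H; apply: (eq_hank _ (H _ _)).
  + by move=> z; rewrite /c -!/(E _) !EE; ring.
  + by rewrite mulr_ge0.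
  + rewrite [X in _ <= X]mulrAC ler_wpM2r // normrM -mulrA ler_wpM2l //.
    by move: b1; rewrite normrM normrN (gtr0_norm nu0) mulrA.
- move=> l x _; exists (`|c l x| * (expR (2 * nu) * nu ^+ 2) * (C0 + C0 ^+ 2)).
  split; first by do 3!apply: mulr_ge0 => //; exact: sqr_ge0.
  move=> h h1; have [_ b1] := expR_sub1 (hh h h1).
  have := hankZ (c l x * (E h - 1 - (- nu * h))) hank_E.
  move=> /(@hank_le _ _ (`|c l x| * (expR (2 * nu) * nu ^+ 2) * (C0 + C0 ^+ 2) * `|h| ^+ 2) _).
  move=> /(_ _ _)H; apply: (eq_hank _ (H _ _)).
  + by move=> z; rewrite /c exprS -!/(E _) !EE; ring.
  + by rewrite mulr_ge0.
  + rewrite [X in _ <= X]mulrAC ler_wpM2r // normrM -mulrA ler_wpM2l //.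
    by move: b1; rewrite normrM normrN (gtr0_norm nu0) exprMn mulrA.
Qed.

End Exponential.

Lemma kfam0 n : kfam n (fun _ _ => 0).
Proof.
have := kfamZ 0 (kfam_exp (@ltr01 R) n).
by under eq_fun do under eq_fun do rewrite mul0r.
Qed.

Lemma kfam_sum n (I : finType) (kk : I -> nat -> R -> R) :
  (forall i, kfam n (kk i)) -> kfam n (fun l z => \sum_i kk i l z).
Proof.
move=> h.
have -> : (fun l z => \sum_i kk i l z) = (\sum_i kk i).
  apply/funext => l; apply/funext => z.
  by elim/big_ind2 : _ => // a b c d -> ->.
by elim/big_ind : _ => [|k1 k2 h1 h2|//]; [exact: kfam0|exact: kfamD h1 h2].
Qed.

Section FourierFamily.

Lemma fkerB a1 b1 a2 b2 z :
  mu.-integrable setT (EFin \o a1) -> mu.-integrable setT (EFin \o b1) ->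
  mu.-integrable setT (EFin \o a2) -> mu.-integrable setT (EFin \o b2) ->
  fker (fun x => a1 x - a2 x) (fun x => b1 x - b2 x) z = fker a1 b1 z - fker a2 b2 z.
Proof.
move=> i1 j1 i2 j2; rewrite /fker /cosT /sinT.
have -> : \int[mu]_x ((a1 x - a2 x) * cos (z * x)) =
    \int[mu]_x (a1 x * cos (z * x)) - \int[mu]_x (a2 x * cos (z * x)).
  rewrite -RintegralB //; [|exact: integrable_fcos|exact: integrable_fcos].
  by apply: eq_Rintegral => x _; rewrite mulrBl.
have -> : \int[mu]_x ((b1 x - b2 x) * sin (z * x)) =
    \int[mu]_x (b1 x * sin (z * x)) - \int[mu]_x (b2 x * sin (z * x)).
  rewrite -RintegralB //; [|exact: integrable_fsin|exact: integrable_fsin].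
  by apply: eq_Rintegral => x _; rewrite mulrBl.
by ring.
Qed.

Lemma fkerZ (c : R) a b z :
  mu.-integrable setT (EFin \o a) -> mu.-integrable setT (EFin \o b) ->
  fker (fun x => c * a x) (fun x => c * b x) z = c * fker a b z.
Proof.
move=> i j; rewrite /fker /cosT /sinT mulrBr -!RintegralZl //;
  [|exact: integrable_fsin|exact: integrable_fcos].
by congr (_ - _); apply: eq_Rintegral => x _; rewrite mulrA.
Qed.

(* Multiplication of the symbol a + i b by e^(i h xi). *)
Definition rotr (h : R) a b : R -> R := fun xi => a xi * cos (h * xi) - b xi * sin (h * xi).
Definition roti (h : R) a b : R -> R := fun xi => a xi * sin (h * xi) + b xi * cos (h * xi).

Section Rotation.
Variables (a b : R -> R) (h : R).
Hypotheses (ia : mu.-integrable setT (EFin \o a)) (ib : mu.-integrable setT (EFin \o b)).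

Lemma integrable_rotr : mu.-integrable setT (EFin \o rotr h a b).
Proof. exact: (integrableB measurableT (integrable_fcos ia h) (integrable_fsin ib h)). Qed.

Lemma integrable_roti : mu.-integrable setT (EFin \o roti h a b).
Proof. exact: (integrableD measurableT (integrable_fsin ia h) (integrable_fcos ib h)). Qed.

Lemma fker_rot z : fker a b (h + z) = fker (rotr h a b) (roti h a b) z.
Proof.
rewrite !fkerE //; [|exact: integrable_rotr|exact: integrable_roti].
by apply: eq_Rintegral => xi _; rewrite mulrDl cosD sinD /rotr /roti; ring.
Qed.

End Rotation.

Lemma continuous_fker a b : mu.-integrable setT (EFin \o a) ->
  mu.-integrable setT (EFin \o b) -> continuous (fker a b).
Proof.
move=> ia ib z.
have zI : z \in (`]z - 1, z + 1[%classic : set R).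
  by rewrite inE /= in_itv /= ltrBlDr ltrDl ltr01.
have := @continuity_under_integral R _ _ mu
  (fun z xi => a xi * cos (z * xi) - b xi * sin (z * xi)) setT measurableT (z - 1) (z + 1) _ _
  (fun xi => `|a xi| + `|b xi|) _ _ z zI.
under [X in _ -> _ -> _ -> _ -> {for _, continuous X}]eq_fun do rewrite -fkerE //.
apply.
- by move=> x _; exact: (integrableB measurableT (integrable_fcos ia x) (integrable_fsin ib x)).
- apply: aeW => xi _ x _; apply: cvgB; apply: cvgM; try exact: cvg_cst.
    exact: continuous_cosM.
  exact: continuous_sinM.
- exact: (integrableD measurableT (integrable_norm ia) (integrable_norm ib)).
- move=> x _; apply: aeW => xi _; apply: le_trans (ler_normB _ _) _.
  by rewrite !normrM; apply: lerD; rewrite ler_piMr ?cos_max ?sin_max.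
Qed.

(** Differentiation under the integral sign; the new symbol is i xi (a + i b). *)
Lemma is_derive_fker a b (z : R) :
  mu.-integrable setT (EFin \o a) -> mu.-integrable setT (EFin \o b) ->
  mu.-integrable setT (EFin \o (fun xi => xi * a xi)) ->
  mu.-integrable setT (EFin \o (fun xi => xi * b xi)) ->
  is_derive z 1 (fker a b) (fker (fun xi => - (xi * b xi)) (fun xi => xi * a xi) z : R).
Proof.
move=> ia ib ixa ixb.
have iNxb : mu.-integrable setT (EFin \o (fun xi => - (xi * b xi))).
  exact: (integrableN ixb).
pose f (z xi : R) := a xi * cos (z * xi) - b xi * sin (z * xi).
have fE : fker a b = (fun z => \int[mu]_xi f z xi).
  by apply/funext => x; rewrite fkerE.
have zI : (`]z - 1, z + 1[%classic : set R) z.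
  by rewrite /= in_itv /= ltrBlDr ltrDl ltr01.
have df (x xi : R) : is_derive x 1 (f ^~ xi : R -> R) (- (xi * b xi) * cos (x * xi) - xi * a xi * sin (x * xi) : R).
  by apply: is_derive_eq; rewrite /GRing.scale /=; ring.
have d1 x xi : partial1of2 f x xi = - (xi * b xi) * cos (x * xi) - xi * a xi * sin (x * xi).
  by rewrite partial1of2E; case: (df x xi).
have intf x : (`]z - 1, z + 1[%classic : set R) x -> mu.-integrable setT (EFin \o f x).
  by move=> _; exact: (integrableB measurableT (integrable_fcos ia x) (integrable_fsin ib x)).
have derf x y : (`]z - 1, z + 1[%classic : set R) x -> [set: R] y -> derivable (f ^~ y) x 1.
  by move=> _ _; case: (df x y).
have G0 y : 0 <= `|y * a y| + `|y * b y| by rewrite addr_ge0.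
have iG := integrableD measurableT (integrable_norm ixa) (integrable_norm ixb).
have G_ub x y : (`]z - 1, z + 1[%classic : set R) x -> [set: R] y ->
    `|partial1of2 f x y| <= `|y * a y| + `|y * b y|.
  move=> _ _; rewrite d1; apply: le_trans (ler_normB _ _) _; rewrite addrC.
  rewrite !(normrM _ (cos _)) !(normrM _ (sin _)) normrN.
  by apply: lerD; rewrite ler_piMr ?cos_max ?sin_max.
rewrite fE; apply: DeriveDef.
  exact: (derivable_under_integral (mu := mu) measurableT zI intf derf G0 iG G_ub).
rewrite -derive1E.
rewrite (differentiation_under_integral (mu := mu) measurableT zI intf derf G0 iG G_ub).
by rewrite fkerE //; apply: eq_Rintegral => xi _; rewrite d1.
Qed.

(* Multiplication of the symbol a + i b by (i xi)^l. *)
Fixpoint dsym l (c : (R -> R) * (R -> R)) : (R -> R) * (R -> R) :=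
  if l is l'.+1 then
    (fun xi => - (xi * (dsym l' c).2 xi), fun xi => xi * (dsym l' c).1 xi)
  else c.

Section Decay.
Variables (n : nat) (B : R) (a b : R -> R).
Hypotheses (B0 : 0 <= B) (ma : measurable_fun setT a) (mb : measurable_fun setT b).
Hypothesis dec : forall xi, (1 + xi ^+ 2) ^+ n.+2 * (a xi ^+ 2 + b xi ^+ 2) <= B ^+ 2.

Let A l := (dsym l (a, b)).1.
Let A' l := (dsym l (a, b)).2.

Lemma measurable_dsym l : measurable_fun setT (A l) /\ measurable_fun setT (A' l).
Proof.
elim: l => [//|l [m1 m2]]; split; last exact: measurable_funM.
by apply: measurable_funN; exact: measurable_funM.
Qed.

Lemma dsym_norm l xi :
  A l xi ^+ 2 + A' l xi ^+ 2 = (xi ^+ 2) ^+ l * (a xi ^+ 2 + b xi ^+ 2).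
Proof.
elim: l => [|l IH]; first by rewrite expr0 mul1r.
by rewrite (exprS (xi ^+ 2)) -mulrA -IH /A /A' /=; ring.
Qed.

Let q xi : R := 1 + xi ^+ 2.
Let q1 xi : 1 <= q xi. Proof. by rewrite lerDl sqr_ge0. Qed.
Let q0 xi : 0 <= q xi. Proof. exact: le_trans (q1 xi). Qed.
Let xq xi : xi ^+ 2 <= q xi. Proof. by rewrite lerDr. Qed.

Lemma dsym_decay l j xi : (l + j <= n.+2)%N ->
  q xi ^+ j * (A l xi ^+ 2 + A' l xi ^+ 2) <= B ^+ 2.
Proof.
move=> lj; rewrite dsym_norm; apply: le_trans (dec xi).
rewrite mulrA ler_wpM2r ?addr_ge0 ?sqr_ge0 //.
apply: (@le_trans _ _ (q xi ^+ (l + j))); last exact: ler_weXn2l.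
rewrite addnC exprD ler_wpM2l ?exprn_ge0 //.
by rewrite lerXn2r ?nnegrE ?sqr_ge0.
Qed.

Lemma integrable_decay (f : R -> R) : measurable_fun setT f ->
  (forall xi, q xi ^+ 2 * f xi ^+ 2 <= B ^+ 2) -> mu.-integrable setT (EFin \o f).
Proof.
move=> mf h.
have ip : mu.-integrable setT (EFin \o (pois 1 : R -> R)).
  apply/integrableP; split; first by apply/measurable_EFinP; exact: measurable_pois.
  under eq_integral do rewrite gee0_abs ?lee_fin ?pois_ge0 //.
  by rewrite integral_pois // ltry.
apply: (le_integrable measurableT _ _ (integrableZl measurableT (B / 2) ip)).
  exact/measurable_EFinP.
move=> x _; rewrite /= lee_fin; apply: le_trans (ler_norm _).
have -> : B / 2 * pois 1 x = B / q x.
  by rewrite /pois expr1n mulr1 mulrA -(mulrA B) mulVf // mulr1.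
rewrite ler_pdivlMr ?(lt_le_trans ltr01) // -ler_sqr ?nnegrE ?mulr_ge0 //.
by rewrite exprMn real_normK ?num_real // mulrC.
Qed.

Lemma integrable_dsym l : (l <= n)%N ->
  mu.-integrable setT (EFin \o A l) /\ mu.-integrable setT (EFin \o A' l).
Proof.
move=> ln; have [m1 m2] := measurable_dsym l.
have h xi := @dsym_decay l 2 xi (leq_trans (leq_add ln (leqnn 2)) (eq_leq (addn2 n))).
split; apply: integrable_decay => // xi; apply: le_trans (h xi);
  by rewrite ler_wpM2l ?exprn_ge0 // ?lerDl ?lerDr sqr_ge0.
Qed.

(** Of the n + 2 powers available, order [l] uses l. Increments use one more and Taylor remainders
    two more, through the bounds for e^(i h xi); one is left for the weight in [hank_fker]. The
    totals l + 2 with l <= n and l + 3 with l < n are exactly within the budget. *)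
Lemma kfam_fker : kfam n (fun l => fker (A l) (A' l)).
Proof.
have p0 : 0 <= 4 * pi :> R by rewrite mulr_ge0 ?pi_ge0.
have lS l : (l < n)%N -> (l <= n)%N by exact: ltnW.
split.
- by move=> l ln; have [i1 i2] := integrable_dsym ln; exact: continuous_fker.
- move=> l z ln; have [i1 i2] := integrable_dsym (ltnW ln).
  have [j1 j2] := integrable_dsym ln.
  apply: is_derive_fker => //.
  have := integrableN j1.
  by apply: eq_integrable => // x _ /=; rewrite opprK.
- move=> l x ln; have [i1 i2] := integrable_dsym ln.
  exists (4 * pi * B); split; first exact: mulr_ge0.
  apply: hank_fker => // xi; have := @dsym_decay l 1 xi.
  by rewrite expr1; apply; rewrite addn1 ltnS (leq_trans ln).
- move=> l x ln; have [i1 i2] := integrable_dsym ln.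
  exists (4 * pi * B); split; first exact: mulr_ge0.
  move=> h h1; rewrite -(mulrA (4 * pi)).
  have j1 := integrable_rotr h i1 i2; have j2 := integrable_roti h i1 i2.
  have := @hank_fker R (B * `|h|) _ _ x _ (integrableB measurableT j1 i1)
    (integrableB measurableT j2 i2).
  move=> H; apply: (eq_hank _ (H _ _)); rewrite ?mulr_ge0 //.
    by move=> z; rewrite fkerB // -fker_rot // addrA (addrC h).
  move=> xi; rewrite /rotr /roti.
  set N := A l xi ^+ 2 + A' l xi ^+ 2.
  have N0 : 0 <= N by rewrite addr_ge0 ?sqr_ge0.
  rewrite (_ : (_ - _) ^+ 2 + _ = N * ((cos (h * xi) - 1) ^+ 2 + sin (h * xi) ^+ 2)); last first.
    by rewrite /N; ring.
  have T := norm_expi_sub1 (h * xi).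
  have D : q xi ^+ 2 * N <= B ^+ 2 by apply: dsym_decay; rewrite addn2 !ltnS.
  apply: (@le_trans _ _ (q xi * (N * (h * xi) ^+ 2))).
    by rewrite -/(q xi); apply: ler_wpM2l => //; apply: ler_wpM2l.
  apply: (@le_trans _ _ (h ^+ 2 * (q xi ^+ 2 * N))).
    rewrite (_ : q xi * _ = h ^+ 2 * (q xi * xi ^+ 2 * N)); last by ring.
    rewrite ler_wpM2l ?sqr_ge0 // ler_wpM2r // (expr2 (q xi)); exact: ler_wpM2l.
  by rewrite exprMn real_normK ?num_real // mulrC ler_wpM2r ?sqr_ge0.
- move=> l x ln; have [i1 i2] := integrable_dsym (ltnW ln).
  have [k1 k2] := integrable_dsym ln.
  exists (4 * pi * (2 * B)); split; first by rewrite !mulr_ge0 ?pi_ge0.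
  move=> h h1; rewrite -(mulrA (4 * pi)).
  have j1 := integrable_rotr h i1 i2; have j2 := integrable_roti h i1 i2.
  have l1 := integrableB measurableT j1 i1; have l2 := integrableB measurableT j2 i2.
  have m1 := integrableZl measurableT h k1; have m2 := integrableZl measurableT h k2.
  have := @hank_fker R (2 * B * `|h| ^+ 2) _ _ x _ (integrableB measurableT l1 m1)
    (integrableB measurableT l2 m2).
  move=> H; apply: (eq_hank _ (H _ _)); rewrite ?mulr_ge0 ?sqr_ge0 //.
    move=> z; rewrite fkerB // fkerB // fkerZ // -fker_rot // addrA (addrC h) //.
  move=> xi; rewrite /rotr /roti.
  set N := A l xi ^+ 2 + A' l xi ^+ 2.
  have N0 : 0 <= N by rewrite addr_ge0 ?sqr_ge0.
  rewrite (_ : (_ - _) ^+ 2 + _ = N * ((cos (h * xi) - 1) ^+ 2 + (sin (h * xi) - h * xi) ^+ 2)); last first.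
    by rewrite /N /A /A' /=; ring.
  have T := norm_expi_sub1_sub (h * xi).
  have D : q xi ^+ 3 * N <= B ^+ 2 by apply: dsym_decay; rewrite addn3 !ltnS.
  apply: (@le_trans _ _ (q xi * (N * (2 * ((h * xi) ^+ 2) ^+ 2)))).
    by rewrite -/(q xi); apply: ler_wpM2l => //; apply: ler_wpM2l.
  apply: (@le_trans _ _ (2 * (h ^+ 2) ^+ 2 * (q xi ^+ 3 * N))).
    rewrite (_ : q xi * _ = 2 * (h ^+ 2) ^+ 2 * (q xi * (xi ^+ 2) ^+ 2 * N)); last by ring.
    apply: ler_wpM2l; first by rewrite mulr_ge0 ?sqr_ge0.
    apply: ler_wpM2r => //; rewrite (exprS (q xi)); apply: ler_wpM2l => //.
    by rewrite lerXn2r ?nnegrE ?sqr_ge0.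
  apply: (@le_trans _ _ (2 * (h ^+ 2) ^+ 2 * B ^+ 2)).
    by apply: ler_wpM2l => //; rewrite mulr_ge0 ?sqr_ge0.
  rewrite real_normK ?num_real // !exprMn.
  rewrite (_ : _ ^+ 2 * _ * _ = 2 * (2 * (h ^+ 2 * h ^+ 2) * B ^+ 2)); last by ring.
  apply: ler_peMl; last by rewrite ler1n.
  apply: mulr_ge0; last exact: sqr_ge0.
  by apply: mulr_ge0 => //; apply: mulr_ge0; exact: sqr_ge0.
Qed.

End Decay.
End FourierFamily.
End KernelFamily.

Lemma choice2 (X Y Z : Type) (P : X -> Y -> Z -> Prop) :
  (forall x y, exists z, P x y z) -> exists f, forall x y, P x y (f x y).
Proof.
move=> h; have g x : exists f, forall y, P x y (f y).
  by have [f hf] := choice (h x); exists f.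
by have [f hf] := choice g; exists f.
Qed.

(** * Hankel operators as maps of square integrable functions, and their matrices *)

Section HankelOperators.
Context {R : realType}.
Local Notation mu := (@lebesgue_measure R).
Local Notation L2R := (L2 mu).
Local Notation ipR := (ip2 (mu := mu)).
Local Notation snR := (sn ipR).
Local Notation sq := (sqint mu).
Implicit Types (g : R -> R) (u v : L2R).

Let Hip := semi_inner_ip2 mu.

Lemma L2_eq u v : (forall x, u x = v x) -> u = v.
Proof. by move=> h; apply/val_inj/funext. Qed.

(** A total construction: when the truncation is not square integrable, the value is the junk
    element 0. *)
Fact cutL2_spec g : {w : L2R | trunc g \in sq -> w =1 trunc g}.
Proof.
by have [fs|] := boolP (trunc g \in sq); [exists (MkL2 fs)|exists 0].
Qed.

(* Opaque, to keep unification from comparing the integrals. *)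
Fact HL2_spec g u : {w : L2R | trunc (hankel g (trunc u)) \in sq ->
  w =1 trunc (hankel g (trunc u))}.
Proof. exact: cutL2_spec. Qed.

Definition cutL2 g : L2R := sval (cutL2_spec g).
Definition HL2 g u : L2R := sval (HL2_spec g u).

Lemma cutL2E M g x : hank M g -> cutL2 g x = trunc g x.
Proof. by move=> h; apply: (svalP (cutL2_spec g)); exact: hank_sqint h. Qed.

Lemma sn_cutL2 M g : 0 <= M -> hank M g -> snR (cutL2 g) <= M.
Proof.
move=> M0 h; apply: sn_nsq_le => //.
rewrite (_ : (cutL2 g : R -> R) = trunc g); first exact: hank_l2 h.
by apply/funext => x; exact: cutL2E h.
Qed.

Lemma cutL2D M1 M2 g1 g2 : 0 <= M1 -> 0 <= M2 -> hank M1 g1 -> hank M2 g2 ->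
  cutL2 (fun z => g1 z + g2 z) = cutL2 g1 + cutL2 g2.
Proof.
move=> M10 M20 h1 h2; apply: L2_eq => x.
rewrite L2D (cutL2E _ h1) (cutL2E _ h2) (cutL2E _ (hankD M10 M20 h1 h2)).
by rewrite truncD.
Qed.

Lemma cutL2Z (a M : R) g : hank M g -> cutL2 (fun z => a * g z) = a *: cutL2 g.
Proof.
move=> h; apply: L2_eq => x.
by rewrite L2Z (cutL2E _ h) (cutL2E _ (hankZ a h)) truncZ.
Qed.

Lemma HL2_sqint M g u : hank M g -> trunc (hankel g (trunc u)) \in sq.
Proof.
move=> h; apply/sqintP; split.
  by apply: measurable_trunc_hankel; [exact: hank_meas h|exact: sqint_meas (L2P u)].
apply: le_lt_trans (hank_op h (L2P u)) _.
by rewrite nsq_sn -EFinM ltry.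
Qed.

Lemma HL2E M g u : hank M g -> HL2 g u = trunc (hankel g (trunc u)) :> (R -> R).
Proof. by move=> h; apply/funext; apply: (svalP (HL2_spec g u)); exact: HL2_sqint h. Qed.

Lemma sn_HL2_op M M' g u : 0 <= M -> hank M' g ->
  (nsq mu (trunc (hankel g (trunc u))) <= (M ^+ 2)%:E * nsq mu u)%E ->
  snR (HL2 g u) <= M * snR u.
Proof.
move=> M0 h op; apply: sn_nsq_le; first by rewrite mulr_ge0 // sn_ge0.
rewrite (_ : (HL2 g u : R -> R) = trunc (hankel g (trunc u))); last first.
  exact: HL2E h.
by apply: le_trans op _; rewrite nsq_sn -EFinM exprMn.
Qed.

Lemma sn_HL2 M g u : 0 <= M -> hank M g -> snR (HL2 g u) <= M * snR u.
Proof. by move=> M0 h; apply: (sn_HL2_op M0 h); exact: hank_op h _ (L2P u). Qed.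

Lemma HL2_pos M g u p : hank M g -> 0 < p -> HL2 g u p = hankel g (trunc u) p.
Proof.
move=> h p0; apply: etrans (congr1 (fun f => f p) (HL2E u h)) _.
exact: trunc_pos.
Qed.

Lemma HL2_npos M g u p : hank M g -> p <= 0 -> HL2 g u p = 0.
Proof.
move=> h p0; apply: etrans (congr1 (fun f => f p) (HL2E u h)) _.
exact: trunc_npos.
Qed.

(** Images are specified at every point, as the integral for p > 0 and as 0 elsewhere. Linearity
    therefore holds as an equality of functions, as [islin] demands, and not merely up to null
    sets. *)
Lemma HL2_eq M g u (w : L2R) : hank M g -> (forall p, 0 < p -> w p = hankel g (trunc u) p) ->
  (forall p, p <= 0 -> w p = 0) -> HL2 g u = w.
Proof.
move=> h w1 w2; apply: L2_eq => p; have [p0|p0] := leP p 0.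
  by apply: etrans (HL2_npos _ h p0) (esym (w2 _ p0)).
by apply: etrans (HL2_pos _ h p0) (esym (w1 _ p0)).
Qed.

Lemma HL2Dl M1 M2 g1 g2 u : 0 <= M1 -> 0 <= M2 -> hank M1 g1 -> hank M2 g2 ->
  HL2 (fun z => g1 z + g2 z) u = HL2 g1 u + HL2 g2 u.
Proof.
move=> M10 M20 h1 h2; apply: (HL2_eq (hankD M10 M20 h1 h2)) => p p0.
  apply: etrans (congr2 +%R (HL2_pos u h1 p0) (HL2_pos u h2 p0)) _.
  exact: esym (hankelDl (ltW p0) h1 h2 (L2P u)).
apply: etrans (congr2 +%R (HL2_npos _ h1 p0) (HL2_npos _ h2 p0)) _.
exact: addr0.
Qed.

Lemma HL2Zl M (a : R) g u : hank M g -> HL2 (fun z => a * g z) u = a *: HL2 g u.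
Proof.
move=> h; apply: (HL2_eq (hankZ a h)) => p p0.
  apply: etrans (congr1 ( *%R a) (HL2_pos u h p0)) _.
  exact: esym (hankelZl a (ltW p0) h (L2P u)).
apply: etrans (congr1 ( *%R a) (HL2_npos _ h p0)) _.
exact: mulr0.
Qed.

Lemma HL2Dr M g u v : hank M g -> HL2 g (u + v) = HL2 g u + HL2 g v.
Proof.
move=> h; apply: (HL2_eq h) => p p0.
  apply: etrans (congr2 +%R (HL2_pos u h p0) (HL2_pos v h p0)) _.
  exact: esym (hankelDr (ltW p0) h (L2P u) (L2P v)).
apply: etrans (congr2 +%R (HL2_npos _ h p0) (HL2_npos _ h p0)) _.
exact: addr0.
Qed.

Lemma HL2Zr M g (a : R) u : hank M g -> HL2 g (a *: u) = a *: HL2 g u.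
Proof.
move=> h; apply: (HL2_eq h) => p p0.
  apply: etrans (congr1 ( *%R a) (HL2_pos u h p0)) _.
  exact: esym (hankelZr a (ltW p0) h (L2P u)).
apply: etrans (congr1 ( *%R a) (HL2_npos _ h p0)) _.
exact: mulr0.
Qed.

Lemma hankB M1 M2 g1 g2 : 0 <= M1 -> 0 <= M2 -> hank M1 g1 -> hank M2 g2 ->
  hank (M1 + M2) (fun z => g1 z - g2 z).
Proof.
move=> M10 M20 h1 h2; have := hankZ (-1) h2; rewrite normrN1 mul1r => h3.
by apply: (eq_hank _ (hankD M10 M20 h1 h3)) => z; rewrite mulN1r.
Qed.

Lemma HL2Bl M1 M2 g1 g2 u : 0 <= M1 -> 0 <= M2 -> hank M1 g1 -> hank M2 g2 ->
  HL2 (fun z => g1 z - g2 z) u = HL2 g1 u - HL2 g2 u.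
Proof.
move=> M10 M20 h1 h2; have := hankZ (-1) h2; rewrite normrN1 mul1r => h3.
have := HL2Dl u M10 M20 h1 h3.
rewrite (HL2Zl _ _ h2) scaleN1r => <-; congr (HL2 _ u).
by apply/funext => z; rewrite mulN1r.
Qed.

Lemma cutL2B M1 M2 g1 g2 : 0 <= M1 -> 0 <= M2 -> hank M1 g1 -> hank M2 g2 ->
  cutL2 (fun z => g1 z - g2 z) = cutL2 g1 - cutL2 g2.
Proof.
move=> M10 M20 h1 h2; have := hankZ (-1) h2; rewrite normrN1 mul1r => h3.
have := cutL2D M10 M20 h1 h3.
rewrite (cutL2Z _ h2) scaleN1r => <-; congr cutL2.
by apply/funext => z; rewrite mulN1r.
Qed.

Section Matrix.
Variable I : finType.
Local Notation X := (I -> L2R).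
Local Notation ipX := (ipv ipR (I := I)).
Local Notation snX := (sn ipX).

Let HX : semi_inner ipX := semi_inner_ipv I Hip.

Definition Hmx (g : I -> I -> R -> R) (u : X) : X :=
  fun i => \sum_j HL2 (g i j) (u j).

Lemma ler_sn_sum (F : I -> L2R) (c : I -> R) :
  (forall j, snR (F j) <= c j) -> snR (\sum_j F j) <= \sum_j c j.
Proof.
move=> h; elim/big_ind2 : _ => [|u a v b|j _]; last exact: h.
  by rewrite sn0.
exact: snD_le.
Qed.

Lemma sn_Hmx (g : I -> I -> R -> R) (C : I -> I -> R) (u : X) :
  (forall i j, 0 <= C i j) ->
  (forall i j w, snR (HL2 (g i j) w) <= C i j * snR w) ->
  snX (Hmx g u) <= Num.sqrt #|I|%:R * (\sum_i \sum_j C i j) * snX u.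
Proof.
move=> C0 h; rewrite -mulrA; apply: sn_ipv_le => //.
  by rewrite mulr_ge0 ?sn_ge0 // sumr_ge0 // => i _; exact: sumr_ge0.
move=> i; apply: (@le_trans _ _ (\sum_j C i j * snX u)).
  apply: ler_sn_sum => j; apply: le_trans (h i j _) _.
  by rewrite ler_wpM2l // sn_comp_le.
rewrite -mulr_suml ler_wpM2r ?sn_ge0 // [X in _ <= X](bigD1 i) //= lerDl.
by apply: sumr_ge0 => k _; exact: sumr_ge0.
Qed.

Lemma sn_Hmx_hank (g : I -> I -> R -> R) (C : I -> I -> R) (c : R) (u : X) : 0 <= c ->
  (forall i j, 0 <= C i j /\ hank (C i j * c) (g i j)) ->
  snX (Hmx g u) <= Num.sqrt #|I|%:R * (\sum_i \sum_j C i j) * c * snX u.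
Proof.
move=> c0 h.
have := @sn_Hmx g (fun i j => C i j * c) u.
rewrite (_ : \sum_i \sum_j _ = (\sum_i \sum_j C i j) * c); last first.
  by rewrite mulr_suml; apply: eq_bigr => i _; rewrite mulr_suml.
rewrite mulrA; apply => [i j|i j w]; have [C0 hC] := h i j; first exact: mulr_ge0.
by apply: sn_HL2 => //; exact: mulr_ge0.
Qed.

Variables (n : nat) (K : I -> I -> nat -> R -> R).
Hypothesis KK : forall i j, kfam n (K i j).

Definition Top l (x : R) := Hmx (fun i j z => K i j l (2 * x + z)).

Let sh (x h : R) : 2 * (x + h) = 2 * x + 2 * h. Proof. exact: mulrDr. Qed.

Let norm2 (h : R) : `|h| <= 1 -> `|2 * h| <= 2.
Proof. by move=> h1; rewrite normrM ger0_norm // ler_piMr. Qed.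

(** Moving x by [h] moves the argument of the kernels by [2 * h]. Hence the factors 2 and 4 in the
    constants, and the range [|h| <= 2] demanded of kernel families. *)
Lemma opfam_Top : opfam ipX n Top.
Proof.
have sI : 0 <= Num.sqrt #|I|%:R :> R by exact: sqrtr_ge0.
split => l x ln.
- have /choice2[C hC] i j := kfam_hank (KK i j) (2 * x) ln.
  split=> [u v|a u]; apply/funext => i; rewrite /Top /Hmx.
    rewrite [RHS](_ : _ = \sum_j HL2 (fun z => K i j l (2 * x + z)) (u j) +
      \sum_j HL2 (fun z => K i j l (2 * x + z)) (v j)) //.
    rewrite -big_split; apply: eq_bigr => j _; exact: HL2Dr (hC i j).2.
  rewrite [RHS](_ : _ = a *: \sum_j HL2 (fun z => K i j l (2 * x + z)) (u j)) //.
  by rewrite scaler_sumr; apply: eq_bigr => j _; exact: HL2Zr (hC i j).2.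
- have /choice2[C hC] i j := kfam_hank (KK i j) (2 * x) ln.
  exists (Num.sqrt #|I|%:R * \sum_i \sum_j C i j); split.
    by rewrite mulr_ge0 // sumr_ge0 // => i _; rewrite sumr_ge0 // => j _; case: (hC i j).
  move=> u; rewrite -[X in X * snX _]mulr1; apply: sn_Hmx_hank => // i j.
  by rewrite mulr1; exact: hC.
- have /choice2[C hC] i j := kfam_r0 (KK i j) (2 * x) ln.
  exists (Num.sqrt #|I|%:R * (\sum_i \sum_j C i j) * 2); split.
    by rewrite !mulr_ge0 // sumr_ge0 // => i _; rewrite sumr_ge0 // => j _; case: (hC i j).
  move=> h u h1.
  rewrite (_ : _ - _ = Hmx (fun i j z => K i j l (2 * x + 2 * h + z) - K i j l (2 * x + z)) u); last first.
    apply/funext => i; rewrite /Top /Hmx sh.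
    rewrite [LHS](_ : _ = \sum_j HL2 (fun z => K i j l (2 * x + 2 * h + z)) (u j) -
      \sum_j HL2 (fun z => K i j l (2 * x + z)) (u j)) //.
    rewrite -sumrB; apply: eq_bigr => j _.
    have [C1 [C10 H1]] := kfam_hank (KK i j) (2 * x + 2 * h) ln.
    have [C2 [C20 H2]] := kfam_hank (KK i j) (2 * x) ln.
    by rewrite (HL2Bl _ C10 C20 H1 H2).
  rewrite -(mulrA _ 2) -(gtr0_norm (ltr0n R 2)) -normrM.
  apply: sn_Hmx_hank => // i j; have [C0 H] := hC i j; split => //.
  by rewrite (ger0_norm (ler0n _ _)); apply: H; exact: norm2.
- have /choice2[C hC] i j := kfam_r1 (KK i j) (2 * x) ln.
  exists (Num.sqrt #|I|%:R * (\sum_i \sum_j C i j) * 4); split.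
    by rewrite !mulr_ge0 // sumr_ge0 // => i _; rewrite sumr_ge0 // => j _; case: (hC i j).
  move=> h u h1.
  rewrite (_ : _ - _ - _ = Hmx (fun i j z => K i j l (2 * x + 2 * h + z) - K i j l (2 * x + z)
      - 2 * h * K i j l.+1 (2 * x + z)) u); last first.
    apply/funext => i; rewrite /Top /Hmx sh.
    rewrite [LHS](_ : _ = \sum_j HL2 (fun z => K i j l (2 * x + 2 * h + z)) (u j) -
      \sum_j HL2 (fun z => K i j l (2 * x + z)) (u j) -
      h *: (2 *: \sum_j HL2 (fun z => K i j l.+1 (2 * x + z)) (u j))) //.
    rewrite scalerA scaler_sumr -!sumrB; apply: eq_bigr => j _.
    have [C1 [C10 H1]] := kfam_hank (KK i j) (2 * x + 2 * h) (ltnW ln).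
    have [C2 [C20 H2]] := kfam_hank (KK i j) (2 * x) (ltnW ln).
    have [C3 [C30 H3]] := kfam_hank (KK i j) (2 * x) ln.
    have H4 := hankZ (2 * h) H3; have C40 : 0 <= `|2 * h| * C3 by exact: mulr_ge0.
    have H5 := hankB C10 C20 H1 H2; have C50 := addr_ge0 C10 C20.
    by rewrite (HL2Bl _ C50 C40 H5 H4) (HL2Bl _ C10 C20 H1 H2) (HL2Zl _ _ H3) (mulrC h).
  rewrite -(mulrA _ 4) (_ : 4 * _ = `|2 * h| ^+ 2); last first.
    by rewrite normrM exprMn (ger0_norm (ler0n _ 2)) -natrX.
  apply: sn_Hmx_hank => [|i j]; first exact: exprn_ge0.
   by have [C0 H] := hC i j; split => //; apply: H; exact: norm2.
Qed.

Variable kb : I -> nat -> R -> R.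
Hypothesis Hkb : forall i, kfam n (kb i).

Definition Bvec l (x : R) : X := fun i => cutL2 (fun z => kb i l (2 * x + z)).

Lemma smooth_Bvec k l : (k + l <= n)%N -> smooth ipX k (Bvec l).
Proof.
have sI : 0 <= Num.sqrt #|I|%:R :> R by exact: sqrtr_ge0.
elim: k l => [|k IH] l kl.
  move=> x; have /choice[C hC] i := kfam_r0 (Hkb i) (2 * x) kl.
  have S0 : 0 <= \sum_i C i by apply: sumr_ge0 => i _; case: (hC i).
  exists (Num.sqrt #|I|%:R * ((\sum_i C i) * 2)); split; first by rewrite !mulr_ge0.
  move=> h h1; rewrite -mulrA; apply: sn_ipv_le => //; first by rewrite !mulr_ge0.
  move=> i; have [C0 H] := hC i; have {}H := H _ (norm2 h1).
  apply: (@le_trans _ _ (C i * `|2 * h|)); last first.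
    rewrite normrM (ger0_norm (ler0n _ 2)) -mulrA ler_wpM2r ?mulr_ge0 //.
    by rewrite (bigD1 i) //= lerDl sumr_ge0 // => j _; case: (hC j).
  rewrite [X in snR X](_ : _ = cutL2 (fun z => kb i l (2 * x + 2 * h + z) - kb i l (2 * x + z))).
    by apply: sn_cutL2 => //; exact: mulr_ge0.
  have [C1 [C10 H1]] := kfam_hank (Hkb i) (2 * x + 2 * h) kl.
  have [C2 [C20 H2]] := kfam_hank (Hkb i) (2 * x) kl.
  by rewrite (cutL2B C10 C20 H1 H2) /Bvec -sh.
exists (fun x => 2 *: Bvec l.+1 x); split; last first.
  by apply: smoothZ => //; apply: IH; rewrite addnS -addSn.
have ln : (l < n)%N by apply: leq_trans kl; rewrite addSn ltnS leq_addl.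
move=> x; have /choice[C hC] i := kfam_r1 (Hkb i) (2 * x) ln.
have S0 : 0 <= \sum_i C i by apply: sumr_ge0 => i _; case: (hC i).
exists (Num.sqrt #|I|%:R * ((\sum_i C i) * 4)); split; first by rewrite !mulr_ge0.
move=> h h1; rewrite -mulrA; apply: sn_ipv_le => //; first by rewrite !mulr_ge0 ?sqr_ge0.
move=> i; have [C0 H] := hC i; have {}H := H _ (norm2 h1).
apply: (@le_trans _ _ (C i * `|2 * h| ^+ 2)); last first.
  rewrite normrM exprMn (ger0_norm (ler0n _ 2)) -natrX -mulrA ler_wpM2r ?mulr_ge0 ?sqr_ge0 //.
  by rewrite (bigD1 i) //= lerDl sumr_ge0 // => j _; case: (hC j).
rewrite [X in snR X](_ : _ = cutL2 (fun z => kb i l (2 * x + 2 * h + z) - kb i l (2 * x + z)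
    - 2 * h * kb i l.+1 (2 * x + z))).
  by apply: sn_cutL2 => //; rewrite mulr_ge0 // sqr_ge0.
have [C1 [C10 H1]] := kfam_hank (Hkb i) (2 * x + 2 * h) (ltnW ln).
have [C2 [C20 H2]] := kfam_hank (Hkb i) (2 * x) (ltnW ln).
have [C3 [C30 H3]] := kfam_hank (Hkb i) (2 * x) ln.
have H4 := hankZ (2 * h) H3; have C40 : 0 <= `|2 * h| * C3 by exact: mulr_ge0.
have H5 := hankB C10 C20 H1 H2; have C50 := addr_ge0 C10 C20.
rewrite (cutL2B C50 C40 H5 H4) (cutL2B C10 C20 H1 H2) (cutL2Z _ H3).
by rewrite /Bvec -sh (mulrC 2 h) -scalerA.
Qed.

End Matrix.
End HankelOperators.

(** * Weak derivatives on a half-line *)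
Section WeakDerivative.
Context {R : realType}.
Local Notation mu := (@lebesgue_measure R).
Implicit Types (f phi : R -> R) (a b c : R).

(** Off [[b, c]] the function vanishes in a neighbourhood, so the derivative is supported in the
    same interval. *)
Lemma test_functionS a phi : test_function a phi -> test_function a (derive1 phi).
Proof.
move=> [d [b [c [ab bc]]]]; split.
  by move=> j x; have := d j.+1 x; rewrite /derive1n iterSr.
exists b, c; split => // x; apply: contraNT; rewrite negb_and -!ltNge => xbc.
have : \forall y \near x, phi y = cst 0 y.
  have [xb|xb] := boolP (x < b).
    near=> y; apply/eqP; apply: contraT => /bc /andP[+ _].
    by rewrite leNgt; have -> : y < b by near: y; exact: lt_nbhsl.
  move: xbc; rewrite (negbTE xb) /= => cx.
  near=> y; apply/eqP; apply: contraT => /bc /andP[_].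
  by rewrite leNgt; have -> : c < y by near: y; exact: lt_nbhsr.
by move=> h; rewrite derive1E (near_eq_derive _ h) ?derive_cst.
Unshelve. all: by end_near. Qed.

Lemma test_function_derive1n a phi j : test_function a phi ->
  test_function a (derive1n j phi).
Proof. by move=> t; elim: j => [//|j IH]; exact: test_functionS. Qed.

Lemma test_function_is_derive a phi j x : test_function a phi ->
  is_derive (x : R) 1 (derive1n j phi) (derive1n j.+1 phi x).
Proof. by move=> [d _]; apply: DeriveDef; [exact: d|rewrite -derive1E]. Qed.

Lemma test_function_continuous a phi j : test_function a phi ->
  continuous (derive1n j phi).
Proof. by move=> t; apply: is_derive_continuous => x; exact: test_function_is_derive t. Qed.

Lemma Rintegral_itv_support a b c f : a < b -> (forall x, f x != 0 -> b <= x <= c) ->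
  \int[mu]_(x in `]a, +oo[) f x = \int[mu]_(x in `[b, c]) f x.
Proof.
move=> ab bc; rewrite Rintegral_mkcond [RHS]Rintegral_mkcond.
apply: eq_Rintegral => x _; rewrite !patchE !mem_setE !in_itv /= andbT.
have [->|/bc] := eqVneq (f x) 0; first by rewrite !if_same.
by move=> xbc; rewrite xbc (lt_le_trans ab) //; case/andP: xbc.
Qed.

Lemma Rintegral_by_parts_test a f f' phi :
  (forall x, a < x -> is_derive x 1 f (f' x)) ->
  (forall x, a < x -> {for x, continuous f'}) -> test_function a phi ->
  \int[mu]_(x in `]a, +oo[) (f x * derive1 phi x) =
  - \int[mu]_(x in `]a, +oo[) (f' x * phi x).
Proof.
move=> df cf' tp; have [_ [b [c [ab bc]]]] := tp.
have [_ [b1 [c1 [ab1 bc1]]]] := test_functionS tp.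
(* [b'] and [c'] lie strictly outside the supports of [phi] and of its derivative, but inside the
   half-line, so the boundary terms vanish. *)
pose b' := (a + Num.min b b1) / 2.
pose c' := Num.max b' (Num.max c c1) + 1.
have mb : a < Num.min b b1 by rewrite lt_min ab.
have ab' : a < b' by rewrite /b'; lra.
have b'm : b' < Num.min b b1 by rewrite /b'; lra.
have c'm : Num.max b' (Num.max c c1) < c' by rewrite /c' ltrDl.
have b'c' : b' < c' by apply: le_lt_trans c'm; rewrite le_max lexx.
have pb : phi b' = 0.
  apply/eqP; apply: contraT => /bc /andP[+ _]; rewrite leNgt (lt_le_trans b'm) //.
  by rewrite ge_min lexx.
have pc : phi c' = 0.
  apply/eqP; apply: contraT => /bc /andP[_]; rewrite leNgt (le_lt_trans _ c'm) //.
  by rewrite !le_max lexx orbT.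
rewrite (@Rintegral_itv_support a b' c') //; last first.
  move=> x; rewrite mulf_eq0 negb_or => /andP[_ /bc1/andP[h1 h2]].
  apply/andP; split.
    by apply: (ltW (lt_le_trans b'm _)); rewrite ge_min h1 orbT.
  by apply: (ltW (le_lt_trans _ c'm)); rewrite !le_max h2 !orbT.
rewrite (@Rintegral_itv_support a b' c') //; last first.
  move=> x; rewrite mulf_eq0 negb_or => /andP[_ /bc/andP[h1 h2]].
  apply/andP; split.
    by apply: (ltW (lt_le_trans b'm _)); rewrite ge_min h1.
  by apply: (ltW (le_lt_trans _ c'm)); rewrite !le_max h2 !orbT.
have inI x : b' <= x -> a < x by exact: lt_le_trans.
have cf x : a < x -> {for x, continuous f}.
  move=> ax; have [dfx _] := df x ax.
  by apply: differentiable_continuous; exact/derivable1_diffP.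
have dphi (x : R) : is_derive x 1 phi (derive1 phi x) by exact: (test_function_is_derive 0 x tp).
have cphi : continuous phi by exact: (test_function_continuous (j := 0) tp).
have cdphi : continuous (derive1 phi) by exact: (test_function_continuous (j := 1) tp).
rewrite (@Rintegration_by_parts _ f phi f' (derive1 phi) b' c') //.
- by rewrite pb pc !mulr0 subrr add0r.
- apply: continuous_in_subspaceT => x; rewrite inE /= in_itv /= => /andP[h _].
  by apply: cf'; exact: inI.
- split.
  + by move=> x; rewrite in_itv /= => /andP[h _]; have [] := df x (inI _ (ltW h)).
  + by apply: cvg_at_right_filter; apply: cf.
  + by apply: cvg_at_left_filter; apply: cf; exact: inI (ltW b'c').
- move=> x; rewrite in_itv /= => /andP[h _].
  by have [_ <-] := df x (inI _ (ltW h)); rewrite derive1E.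
- exact: continuous_subspaceT.
- split.
  + by move=> x _; have [] := dphi x.
  + by apply: cvg_at_right_filter; exact: cphi.
  + by apply: cvg_at_left_filter; exact: cphi.
Qed.

Lemma Rintegral_weak_chain a (w : nat -> R -> R) n :
  (forall l x, (l < n)%N -> a < x -> is_derive x 1 (w l) (w l.+1 x)) ->
  (forall l x, (l <= n)%N -> a < x -> {for x, continuous (w l)}) ->
  forall j phi, (j <= n)%N -> test_function a phi ->
  \int[mu]_(x in `]a, +oo[) (w 0%N x * derive1n j phi x) =
  (- 1) ^+ j * \int[mu]_(x in `]a, +oo[) (w j x * phi x).
Proof.
move=> d c; elim=> [|j IH] phi jn tp; first by rewrite expr0 mul1r.
have := IH (derive1 phi) (ltnW jn) (test_functionS tp).
rewrite /derive1n -iterSr => ->; rewrite exprSr -mulrA; congr (_ * _).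
rewrite mulN1r; apply: Rintegral_by_parts_test => // x ax; first exact: d.
exact: c.
Qed.

End WeakDerivative.

(** * Classical derivatives from quantitative rates *)

Section DeriveOfRate.
Context {R : realType}.

Lemma is_derive_rate (f : R -> R) (x df C : R) :
  (forall h, `|h| <= 1 -> `|f (x + h) - f x - h * df| <= C * `|h| ^+ 2) ->
  is_derive x 1 f df.
Proof.
move=> r.
have C0 : 0 <= C.
  have := r 1; rewrite normr1 expr1n mulr1 => /(_ (lexx _)).
  exact: le_trans.
have lim : (fun h => h^-1 *: (f (h *: 1 + x) - f x)) @ (0 : R)^' --> df.
  apply/cvgrPdist_le => e e0; near=> h.
  have hn0 : h != 0 by near: h; exact: nbhs_dnbhs_neq.
  have h1 : `|h| <= 1.
    by near: h; apply: dnbhs0_le.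
  have he : `|h| <= e / (C + 1).
    by near: h; apply: dnbhs0_le; rewrite divr_gt0 // ltr_wpDl.
  have -> : h *: 1 + x = x + h by rewrite /GRing.scale /= mulr1 addrC.
  rewrite -normrN opprB.
  have -> : h^-1 *: (f (x + h) - f x) - df = h^-1 * (f (x + h) - f x - h * df).
    by rewrite /GRing.scale /=; field.
  rewrite normrM normfV ler_pdivrMl ?normr_gt0 //.
  apply: le_trans (r h h1) _; rewrite expr2 mulrA mulrC ler_wpM2l //.
  apply: le_trans (ler_wpM2l C0 he) _.
  rewrite mulrA ler_pdivrMr ?ltr_wpDl // mulrC ler_wpM2l ?(ltW e0) //.
  by rewrite lerDl.
apply: DeriveDef.
  by apply/cvg_ex; exists df; exact: lim.
by apply: cvg_lim => //; exact: lim.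
Unshelve. all: by end_near. Qed.

Lemma continuous_rate (f : R -> R) (x C : R) :
  (forall h, `|h| <= 1 -> `|f (x + h) - f x| <= C * `|h|) -> {for x, continuous f}.
Proof.
move=> r.
have C0 : 0 <= C.
  have := r 1; rewrite normr1 mulr1 => /(_ (lexx _)).
  exact: le_trans.
have nd (d : R) : 0 < d -> \forall y \near x, `|y - x| <= d.
  move=> d0; apply/nbhs_ballP; exists d => // z.
  by rewrite /ball /= distrC => /ltW.
apply/cvgrPdist_le => e e0; near=> y.
have h1 : `|y - x| <= 1 by near: y; exact: nd.
have h2 : `|y - x| <= e / (C + 1).
  by near: y; apply: nd; rewrite divr_gt0 // ltr_wpDl.
rewrite distrC.
have := r (y - x) h1; rewrite (addrC x) subrK => /le_trans; apply.
apply: le_trans (ler_wpM2l C0 h2) _.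
rewrite mulrA ler_pdivrMr ?ltr_wpDl // mulrC ler_wpM2l ?(ltW e0) //.
by rewrite lerDl.
Unshelve. all: by end_near. Qed.

End DeriveOfRate.

Section SmoothSequence.
Context {R : realType} {X : lmodType R} (ip : X -> X -> R).
Hypothesis H : semi_inner ip.

Lemma smooth_seq k w : smooth ip k w -> exists s : nat -> R -> X,
  [/\ s 0%N = w, forall j, (j < k)%N -> rate1 ip (s j) (s j.+1) & rate0 ip (s k)].
Proof.
elim: k w => [|k IH] w; first by move=> r; exists (fun=> w).
move=> [w' [r /IH[s [s0 s1 s2]]]].
exists (fun j => if j is j'.+1 then s j' else w); split => //.
by case=> [|j]; [rewrite s0|exact: s1].
Qed.

(** Pairing with a fixed vector turns a rate into an ordinary derivative of a real function, and
    such derivatives are unique. With [f] and [g] built from a test function, weak derivative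
    identities in p are thus inherited by derivatives in x. *)
Lemma rate1_functional (w w' z z' : R -> X) (f g : X) (c : R) :
  rate1 ip w w' -> rate1 ip z z' -> (forall x, ip (w x) f = c * ip (z x) g) ->
  forall x, ip (w' x) f = c * ip (z' x) g.
Proof.
move=> rw rz e x.
have D (v v' : R -> X) (q : X) : rate1 ip v v' ->
    is_derive x 1 (fun t : R => ip (v t) q) (ip (v' x) q).
  move=> /(_ x)[C [C0 hC]]; apply: (@is_derive_rate _ _ _ _ (C * sn ip q)) => h h1.
  have ipB a b : ip a q - ip b q = ip (a - b) q by rewrite (ipDl H) (ipNl H).
  rewrite -(ipZl H) !ipB; apply: le_trans (cauchy_schwarz H _ _) _.
  by rewrite mulrAC ler_wpM2r ?sn_ge0 // hC.
have d1 := D w w' f rw; have d2 := is_deriveZ c (D z z' g rz).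
have [_ <-] := d1; case: d2 => _ e2; apply: etrans e2.
by congr ('D_1 _ x); apply/funext => t; exact: e.
Qed.

End SmoothSequence.

(** * Pointwise differentiation of Hankel integrals *)

Section HankelDerivative.
Context {R : realType}.
Local Notation mu := (@lebesgue_measure R).
Local Notation L2R := (L2 mu).
Local Notation ipR := (ip2 (mu := mu)).
Local Notation snR := (sn ipR).

Let Hip := semi_inner_ip2 mu.

(** Cauchy-Schwarz with the L^2 bound of the kernel: here [hank] controls values at a point rather
    than an operator norm. *)
Lemma norm_hankel0_le M g (u : L2R) : 0 <= M -> hank M g ->
  `|\int[mu]_s (g s * trunc u s)| <= M * snR u.
Proof.
move=> M0 h.
rewrite (_ : \int[mu]_s _ = ipR (cutL2 g) u).
  apply: le_trans (cauchy_schwarz Hip _ _) _; rewrite ler_wpM2r ?sn_ge0 //.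
  exact: sn_cutL2.
apply: eq_Rintegral => s _.
by apply: esym; apply: etrans (congr1 ( *%R ^~ (u s)) (cutL2E s h)) _; rewrite /trunc mulrAC mulrC mulrA.
Qed.

Variables (n : nat) (k : nat -> R -> R) (x : R) (u : L2R).
Hypothesis kk : kfam n k.

Let D l (p : R) := hankel (fun z => k l (x + z)) (trunc u) p.

Let DE l p : D l p = \int[mu]_s (k l (x + p + s) * trunc u s).
Proof. by apply: eq_Rintegral => s _; rewrite addrAC addrA. Qed.

Let Dint l p : (l <= n)%N ->
  mu.-integrable setT (EFin \o (fun s => k l (x + p + s) * trunc u s)).
Proof.
move=> ln; have [C [C0 hC]] := kfam_hank kk (x + p) ln.
have := hank_integrable (lexx 0) hC (L2P u).
by apply: eq_integrable => // s _ /=; rewrite addr0.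
Qed.

(** Shifting p has the same effect on the kernel as shifting its argument, so the rates of the
    family, which govern the dependence on x, also give classical derivatives in p, whatever the
    regularity of [u]. *)
Lemma is_derive_hankel l (p : R) : (l < n)%N ->
  is_derive p 1 (hankel (fun z => k l (x + z)) (trunc u) : R -> R)
    (hankel (fun z => k l.+1 (x + z)) (trunc u) p : R).
Proof.
move=> ln; have [C [C0 hC]] := kfam_r1 kk (x + p) ln.
apply: (@is_derive_rate _ _ _ _ (C * snR u)) => h h1.
have h2 : `|h| <= 2 by apply: le_trans h1 _; rewrite ler1n.
have := norm_hankel0_le u (mulr_ge0 C0 (sqr_ge0 _)) (hC h h2).
rewrite mulrAC -!/(D _ _) !DE; apply: le_trans; rewrite le_eqVlt; apply/orP; left.
apply/eqP; congr (`|_|); rewrite -RintegralZl //; last exact: Dint.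
rewrite -RintegralB //; [|exact: Dint (ltnW ln)|exact: Dint (ltnW ln)].
rewrite -RintegralB //; last 2 first.
- exact: (integrableB measurableT (Dint (p + h) (ltnW ln)) (Dint p (ltnW ln))).
- exact: (integrableZl measurableT h (Dint p ln)).
by apply: eq_Rintegral => s _; rewrite addrA; ring.
Qed.

Lemma continuous_hankel l : (l <= n)%N ->
  continuous (hankel (fun z => k l (x + z)) (trunc u)).
Proof.
move=> ln p; have [C [C0 hC]] := kfam_r0 kk (x + p) ln.
apply: (@continuous_rate _ _ _ (C * snR u)) => h h1.
have h2 : `|h| <= 2 by apply: le_trans h1 _; rewrite ler1n.
have := norm_hankel0_le u (mulr_ge0 C0 (normr_ge0 _)) (hC h h2).
rewrite mulrAC -!/(D _ _) !DE; apply: le_trans; rewrite le_eqVlt; apply/orP; left.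
apply/eqP; congr (`|_|).
rewrite -RintegralB //; [|exact: Dint ln|exact: Dint ln].
by apply: eq_Rintegral => s _; rewrite addrA; ring.
Qed.

End HankelDerivative.

Section HalfLinePairing.
Context {R : realType}.
Local Notation mu := (@lebesgue_measure R).
Local Notation L2R := (L2 mu).
Local Notation ipR := (ip2 (mu := mu)).
Implicit Types (f w phi : R -> R).

Lemma ae_imp (P Q : R -> Prop) : (forall p, P p -> Q p) ->
  {ae mu, forall p, P p} -> {ae mu, forall p, Q p}.
Proof. move=> h; exact: (@filterS _ _ (ae_filter_ringOfSetsType mu) P Q h). Qed.

Lemma Rintegral_half_line f w : (forall p, 0 < p -> f p = w p) ->
  (forall p, p <= 0 -> f p = 0) -> \int[mu]_p f p = \int[mu]_(p in `]0, +oo[) w p.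
Proof.
move=> f1 f2; rewrite [RHS]Rintegral_mkcond; apply: eq_Rintegral => p _.
rewrite patchE mem_setE in_itv /= andbT.
by case: (leP p 0) => p0; [exact: f2|exact: f1].
Qed.

Lemma test_sqint (a : R) phi : test_function a phi -> phi \in sqint mu.
Proof.
move=> tp; have cphi := @test_function_continuous _ _ _ 0 tp.
apply/sqintP; split; first exact: continuous_measurable_fun.
have [_ [b [c [ab bc]]]] := tp.
have : mu.-integrable `[b, c] (EFin \o (fun x => phi x ^+ 2)).
  apply: continuous_compact_integrable; first exact: segment_compact.
  by apply: continuous_subspaceT => x; apply: cvgM; exact: cphi.
move=> /integrableP[_].
rewrite [X in (X < _)%E -> _](_ : _ = nsq mu phi) // /nsq [LHS]integral_mkcond.
apply: eq_integral => x _; rewrite patchE mem_setE in_itv /=.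
case: ifPn => [_|/negP xbc].
  by rewrite /= ger0_norm ?sqr_ge0.
by have [->|/bc//] := eqVneq (phi x) 0; rewrite expr0n.
Qed.

End HalfLinePairing.

(** * Systems of Hankel equations *)
Section System.
Context {R : realType}.
Local Notation mu := (@lebesgue_measure R).
Local Notation L2R := (L2 mu).
Local Notation ipR := (ip2 (mu := mu)).
Local Notation snR := (sn ipR).
Variable I : finType.
Local Notation X := (I -> L2R).
Local Notation ipX := (ipv ipR (I := I)).
Local Notation snX := (sn ipX).

Let Hip := semi_inner_ip2 mu.
Let HX : semi_inner ipX := semi_inner_ipv I Hip.

Lemma sn_eq0_ae (w : L2R) : snR w = 0 <-> {ae mu, forall p, w p = 0}.
Proof.
have nE : (snR w = 0) <-> (nsq mu w = 0)%E.
  rewrite nsq_sn; split=> [->|[]/eqP]; first by rewrite expr0n.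
  by rewrite sqrf_eq0 => /eqP.
have mw := measurable_sqr (measurable_L2 w).
rewrite nE /nsq; split.
  move=> h.
  have : (\int[mu]_x `|((w x) ^+ 2)%:E| = 0)%E.
    by rewrite -[RHS]h; apply: eq_integral => x _; rewrite gee0_abs // lee_fin sqr_ge0.
  move/(ae_eq_integral_abs _ measurableT mw).
  by apply: filterS => x /(_ Logic.I)[] /eqP; rewrite sqrf_eq0 => /eqP.
move=> h; rewrite (ae_eq_integral (cst 0%E)) //; first exact: integral0.
by apply: filterS h => x wx _; rewrite /cst wx expr0n.
Qed.

Lemma snv_eq0 (w : X) : snX w = 0 <-> forall i, snR (w i) = 0.
Proof.
split=> [h i|h].
  by apply/eqP; rewrite eq_le sn_ge0 andbT -h; exact: sn_comp_le.
apply/eqP; rewrite eq_le sn_ge0 andbT.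
apply: le_trans (sn_ipv_le Hip (lexx 0) _) _; last by rewrite mulr0.
by move=> i; rewrite h.
Qed.

Variables (n : nat) (K : I -> I -> nat -> R -> R) (kb : I -> nat -> R -> R).
Hypotheses (KK : forall i j, kfam n (K i j)) (Hkb : forall i, kfam n (kb i)).
Variables (b a0 : R).
Hypotheses (a0_gt0 : 0 < a0) (b_gt0 : 0 < b).
Hypothesis coer : forall x (u : X), a0 * ipX u u <= ipX (b *: u + Top K 0 x u) u.

Definition solves x (u : X) := snX (b *: u + Top K 0 x u - Bvec kb 0 x) = 0.

Lemma solves_exists x : exists u, solves x u.
Proof.
exact: (solve_exists HX (opfam_Top KK) a0_gt0
  (fast_complete_ipv Hip (@fast_complete_ip2 _ _ _ mu)) coer).
Qed.

Lemma solves_unique x u v : solves x u -> solves x v -> forall i,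
  {ae mu, forall p, u i p = v i p}.
Proof.
move=> su sv i.
have : snX (u - v) = 0.
  apply/eqP; rewrite eq_le sn_ge0 andbT.
  apply: le_trans (solve_le HX a0_gt0 coer x (u - v)) _.
  have [LD LZ] := opfam_lin (opfam_Top KK) x (leq0n n).
  rewrite (_ : _ + _ = (b *: u + Top K 0 x u - Bvec kb 0 x) -
     (b *: v + Top K 0 x v - Bvec kb 0 x)); last first.
    rewrite (islinB _ _ (opfam_lin (opfam_Top KK) x (leq0n n))) scalerBr.
    have T (V : zmodType) (a c e f g : V) : a - c + (e - f) = a + e - g - (c + f - g).
      by rewrite (opprB _ g) [RHS]addrA subrK opprD addrACA.
    exact: T.
  have snB0 (p q : X) : snX p = 0 -> snX q = 0 -> snX (p - q) = 0.
    move=> p0 q0; apply/eqP; rewrite eq_le sn_ge0 andbT.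
    by apply: le_trans (ler_snB HX _ _) _; rewrite p0 q0 addr0.
  have := snB0 _ _ su sv; set w := _ - _ => ->; rewrite mulr0 //.
move=> /snv_eq0/(_ i)/sn_eq0_ae; apply: filterS => p.
by move/eqP; rewrite subr_eq0 => /eqP.
Qed.

(** For [l = 0] this is the right-hand side of the fixed point form of the equation, for larger [l]
    its l-th derivative in p: only kernels are differentiated, never [u]. *)
Definition jet l x (u : X) : X := b^-1 *: (Bvec kb l x - Top K l x u).

(** The representative of [jet] on the half-line that is differentiable in p at every point,
    including 0, where the truncation may jump. *)
Definition wfun l x (u : X) i (p : R) : R :=
  b^-1 * (kb i l (2 * x + p) -
    \sum_j hankel (fun z => K i j l (2 * x + z)) (trunc (u j)) p).

Lemma jetE l x u i p : jet l x u i p =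
  b^-1 * (cutL2 (fun z => kb i l (2 * x + z)) p -
    \sum_j HL2 (fun z => K i j l (2 * x + z)) (u j) p).
Proof.
transitivity (b^-1 * (cutL2 (fun z => kb i l (2 * x + z)) p -
    (\sum_j HL2 (fun z => K i j l (2 * x + z)) (u j)) p)) => //.
by rewrite L2sum.
Qed.

Lemma jet_pos l x u i p : (l <= n)%N -> 0 < p -> jet l x u i p = wfun l x u i p.
Proof.
move=> ln p0; rewrite jetE; have [C [_ hC]] := kfam_hank (Hkb i) (2 * x) ln.
congr (_ * (_ - _)).
  by apply: etrans (cutL2E p hC) _; exact: trunc_pos.
apply: eq_bigr => j _; have [D [_ hD]] := kfam_hank (KK i j) (2 * x) ln.
exact: HL2_pos hD p0.
Qed.

Lemma jet_npos l x u i p : (l <= n)%N -> p <= 0 -> jet l x u i p = 0.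
Proof.
move=> ln p0; rewrite jetE; have [C [_ hC]] := kfam_hank (Hkb i) (2 * x) ln.
rewrite big1; last first.
  move=> j _; have [D [_ hD]] := kfam_hank (KK i j) (2 * x) ln.
  exact: HL2_npos hD p0.
rewrite subr0; apply: etrans (congr1 ( *%R b^-1) (etrans (cutL2E p hC) (trunc_npos _ p0))) _.
exact: mulr0.
Qed.

Lemma wfun_is_derive l x u i (p : R) : (l < n)%N ->
  is_derive p 1 (wfun l x u i) (wfun l.+1 x u i p).
Proof.
move=> ln; have d1 : is_derive p 1 (fun p : R => kb i l (2 * x + p)) (kb i l.+1 (2 * x + p)).
  have d0 : is_derive p 1 (fun p : R => 2 * x + p) 1.
    by have := is_deriveD (is_derive_cst (2 * x) p 1) (is_derive_id p 1); rewrite add0r.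
  have := is_derive1_comp (kfam_der (Hkb i) (2 * x + p) ln) d0.
  by rewrite mulr1.
have d2 j := is_derive_hankel (2 * x) (u j) (KK i j) p ln.
have d3 : is_derive p 1 (\sum_j hankel (fun z => K i j l (2 * x + z)) (trunc (u j)))
    (\sum_j hankel (fun z => K i j l.+1 (2 * x + z)) (trunc (u j)) p).
  elim/big_ind2 : _ => [|f1 e1 f2 e2 h1 h2|j _]; [|exact: is_deriveD|exact: d2].
  exact: is_derive_cst.
have := is_deriveZ b^-1 (is_deriveB d1 d3).
rewrite /wfun /GRing.scale /=.
congr (is_derive _ _ _ _); apply/funext => q /=.
by rewrite fct_sumE.
Qed.

Lemma wfun_continuous l x u i : (l <= n)%N -> continuous (wfun l x u i).
Proof.
move=> ln p; apply: cvgM; first exact: cvg_cst.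
apply: cvgB.
  apply: (@continuous_comp _ _ _ (fun p => 2 * x + p) (kb i l)).
    by apply: cvgD; [exact: cvg_cst|exact: cvg_id].
  exact: kfam_cont (Hkb i) l ln _.
apply: cvg_big => [|j _]; first exact: add_continuous.
exact: continuous_hankel (KK i j) l ln _.
Qed.

Lemma jet_weak x u i j phi : (j <= n)%N -> test_function 0 phi ->
  \int[mu]_p (jet 0 x u i p * derive1n j phi p) =
  (- 1) ^+ j * \int[mu]_p (jet j x u i p * phi p).
Proof.
move=> jn tp.
rewrite (@Rintegral_half_line _ _ (fun p => wfun 0 x u i p * derive1n j phi p)); last 2 first.
- by move=> p p0; rewrite jet_pos.
- by move=> p p0; rewrite jet_npos // mul0r.
rewrite (@Rintegral_half_line _ _ (fun p => wfun j x u i p * phi p)); last 2 first.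
- by move=> p p0; rewrite jet_pos.
- by move=> p p0; rewrite jet_npos // mul0r.
apply: (@Rintegral_weak_chain _ _ (fun l => wfun l x u i) n) => //.
- by move=> l p ln _; exact: wfun_is_derive.
- by move=> l p ln _; exact: wfun_continuous.
Qed.

Lemma solves_jet x u : solves x u -> forall i, {ae mu, forall p, u i p = jet 0 x u i p}.
Proof.
move=> su i.
have : snX (u - jet 0 x u) = 0.
  rewrite (_ : u - jet 0 x u = b^-1 *: (b *: u + Top K 0 x u - Bvec kb 0 x)).
    by rewrite (snZ HX) su mulr0.
  rewrite -(addrA (b *: u)) scalerDr scalerA mulVf ?gt_eqF // scale1r.
  by rewrite /jet -scalerN opprB.
move=> /snv_eq0/(_ i)/sn_eq0_ae; apply: filterS => p.
by move/eqP; rewrite subr_eq0 => /eqP.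
Qed.

Lemma solvesP x (u : X) :
  (forall i, {ae mu, forall p : R, 0 < p ->
    b * u i p + \sum_j hankel (fun z => K i j 0 (2 * x + z)) (trunc (u j)) p =
    kb i 0 (2 * x + p)}) -> (forall i p, p <= 0 -> u i p = 0) -> solves x u.
Proof.
move=> h u0; have : snX (u - jet 0 x u) = 0.
  apply/snv_eq0 => i; apply/sn_eq0_ae; apply: ae_imp (h i) => p hp.
  transitivity (u i p - jet 0 x u i p) => //.
  have [p0|p0] := leP p 0; first by rewrite u0 // jet_npos // subr0.
  rewrite jet_pos // /wfun -hp // addrK mulrA mulVf ?gt_eqF // mul1r subrr //.
rewrite /solves => h1.
rewrite (_ : _ - _ = b *: (u - jet 0 x u)); first by rewrite (snZ HX) h1 mulr0.
rewrite scalerBr /jet scalerA divff ?gt_eqF // scale1r opprB addrA //.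
Qed.

(** [W l j x] stands for l derivatives in p and j in x of the solution. At j = 0 the weak identity
    is that of the jets; the step from j to j + 1 differentiates it in x against a fixed test
    function. *)
Lemma solves_smooth (V : R -> X) : (forall x, solves x (V x)) ->
  forall k, (k <= n)%N -> exists W : nat -> nat -> R -> X,
  [/\ W 0%N 0%N = V,
      forall l j, (l + k <= n)%N -> (j < k)%N -> rate1 ipX (W l j) (W l j.+1),
      forall l, (l + k <= n)%N -> rate0 ipX (W l k)
    & forall l j x i phi, (l + k <= n)%N -> (j <= k)%N -> test_function 0 phi ->
      \int[mu]_p (W 0%N j x i p * derive1n l phi p) =
      (- 1) ^+ l * \int[mu]_p (W l j x i p * phi p)].
Proof.
move=> sV k kn.
have sB l : (k + l <= n)%N -> smooth ipX k (Bvec kb l) by exact: smooth_Bvec.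
have smV : smooth ipX k V.
  apply: (smooth_solve HX (opfam_Top KK) a0_gt0
    (fast_complete_ipv Hip (@fast_complete_ip2 _ _ _ mu)) coer kn sV).
  by apply: sB; rewrite addn0.
(* Order 0 is the given curve itself, as [W 0 0 = V] is required and [V x] equals its jet only
   almost everywhere. *)
pose J l x := if l is l'.+1 then jet l x (V x) else V x.
have smJ l : (l + k <= n)%N -> smooth ipX k (J l).
  case: l => [//|l] lk; apply: (smoothZ HX); apply: (smoothB HX).
    by apply: sB; rewrite addnC.
  by apply: (smooth_op HX (opfam_Top KK)) smV; rewrite addnC.
have /choice[W hW] l : exists s : nat -> R -> X, (l + k <= n)%N ->
   [/\ s 0%N = J l, forall j, (j < k)%N -> rate1 ipX (s j) (s j.+1) & rate0 ipX (s k)].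
  have [lk|lk] := boolP (l + k <= n)%N; last by exists (fun=> J l).
  by have [s hs] := smooth_seq (smJ l lk); exists s.
have [W0 W1 W2] := hW 0%N kn.
exists W; split => //.
- by move=> l j lk jk; have [_ + _] := hW l lk; apply.
- by move=> l lk; have [] := hW l lk.
move=> l j x i phi lk jk tp.
pose Phi j := MkL2 (test_sqint (test_function_derive1n j tp)).
have [Wl0 Wl1 Wl2] := hW l lk.
suff : forall x, ipR (W 0%N j x i) (Phi l) = (- 1) ^+ l * ipR (W l j x i) (Phi 0%N).
  by move=> h; exact: (h x).
have ri (w w' : R -> X) : rate1 ipX w w' -> rate1 ipR (w ^~ i) (w' ^~ i).
  move=> r y; have [C [C0 hC]] := r y; exists C; split => // h h1.
  by apply: le_trans (hC h h1); exact: (sn_comp_le Hip (w (y + h) - w y - h *: w' y)).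
elim: j jk => [_ {}x|j IH jk].
  rewrite W0 Wl0; case: l lk {Wl0 Wl1 Wl2} => [|l] lk; first by rewrite expr0 mul1r.
  transitivity (ipR (jet 0 x (V x) i) (Phi l.+1)); last first.
    by apply: jet_weak => //; apply: leq_trans lk; rewrite leq_addr.
  (* A vector of seminorm 0 pairs to 0 with everything, so the null set is invisible to the test
     function. *)
  have : snR (V x i - jet 0 x (V x) i) = 0.
    apply/sn_eq0_ae; apply: filterS (solves_jet (sV x) i) => p hp.
    by transitivity (V x i p - jet 0 x (V x) i p) => //; rewrite hp subrr.
  move=> h; have := sn_eq0_ip Hip (Phi l.+1) h; rewrite (ipDl Hip) (ipNl Hip) => /eqP.
  by rewrite subr_eq0 => /eqP.
apply: (rate1_functional Hip (ri _ _ (W1 j jk)) (ri _ _ (Wl1 j jk))).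
exact: IH (ltnW jk).
Qed.

End System.

(** * Sums of exponential kernels *)

Section ExponentialKernels.
Context {R : realType}.
Local Notation mu := (@lebesgue_measure R).
Local Notation L2R := (L2 mu).
Local Notation ipR := (ip2 (mu := mu)).

Let Hip := semi_inner_ip2 mu.

Definition expk (nu z : R) : R := expR (- nu * z).

Lemma expkD nu x y : expk nu (x + y) = expk nu x * expk nu y.
Proof. by rewrite /expk mulrDr expRD. Qed.

Lemma hank_expk nu : 0 < nu -> exists M, 0 <= M /\ hank M (expk nu).
Proof.
move=> nu0; have [M [M0 h]] := kfam_hank (kfam_exp nu0 0) 0 (leqnn 0).
by exists M; split => //; apply: eq_hank h => z; rewrite expr0 mul1r add0r.
Qed.

Lemma HL2_expk nu (u : L2R) : 0 < nu ->
  HL2 (expk nu) u = ipR (cutL2 (expk nu)) u *: cutL2 (expk nu).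
Proof.
move=> nu0; have [M [M0 h]] := hank_expk nu0.
apply: (HL2_eq h) => p p0; last first.
  apply: etrans (congr1 ( *%R _) (etrans (cutL2E p h) (trunc_npos _ p0))) _.
  exact: mulr0.
apply: etrans (congr1 ( *%R _) (etrans (cutL2E p h) (trunc_pos _ p0))) _.
rewrite /hankel /ip2 -RintegralZr //; last exact: (L2M (cutL2 (expk nu)) u).
apply: eq_Rintegral => s _; rewrite expkD [RHS]mulrAC; congr (_ * _).
by apply: etrans (congr1 ( *%R ^~ (u s)) (cutL2E s h)) _; rewrite /trunc mulrCA mulrA.
Qed.

Definition expsum (I : finType) (nu w : I -> R) l z : R :=
  \sum_k w k * ((- nu k) ^+ l * expk (nu k) z).

Section Sum.
Variables (I : finType) (nu w : I -> R).
Hypothesis nu0 : forall k, 0 < nu k.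

Lemma kfam_expsum n : kfam n (expsum nu w).
Proof.
by apply: kfam_sum => k; apply: kfamZ; exact: kfam_exp.
Qed.

Lemma ip_HL2_expsum (x : R) (u v : L2R) :
  ipR (HL2 (fun z => expsum nu w 0 (x + z)) u) v =
  \sum_k w k * expk (nu k) x * (ipR (cutL2 (expk (nu k))) u * ipR (cutL2 (expk (nu k))) v).
Proof.
rewrite /expsum.
(* The induction over a sequence also carries a [hank] bound for the partial sum, on which
   additivity of the operator in its kernel depends. *)
suff H : forall r : seq I, exists M, 0 <= M /\
    (hank M (fun z => \sum_(k <- r) w k * ((- nu k) ^+ 0 * expk (nu k) (x + z))) /\
     ipR (HL2 (fun z => \sum_(k <- r) w k * ((- nu k) ^+ 0 * expk (nu k) (x + z))) u) v =
     \sum_(k <- r) w k * expk (nu k) x *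
       (ipR (cutL2 (expk (nu k))) u * ipR (cutL2 (expk (nu k))) v)).
  by have [M [_ [_ ->]]] := H (index_enum I).
elim=> [|k r [M [M0 [hM IH]]]].
  exists 0; split => //; under eq_fun do rewrite big_nil; rewrite big_nil.
  have [M [M0 h]] := hank_expk ltr01.
  have h0 := hankZ 0 h; rewrite normr0 mul0r in h0.
  have -> : (fun=> 0) = (fun z => 0 * expk 1 z) by apply/funext => z; rewrite mul0r.
  by rewrite (HL2Zl _ _ h) (ipZl Hip) mul0r.
have [E [E0 hE]] := hank_expk (nu0 k).
set c := w k * expk (nu k) x.
have hc := hankZ c hE; have c0 : 0 <= `|c| * E by exact: mulr_ge0.
have -> : (fun z => \sum_(k <- k :: r) w k * ((- nu k) ^+ 0 * expk (nu k) (x + z))) =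
    (fun z => c * expk (nu k) z +
      \sum_(k <- r) w k * ((- nu k) ^+ 0 * expk (nu k) (x + z))).
  by apply/funext => z; rewrite big_cons expr0 mul1r expkD /c mulrA.
exists (`|c| * E + M); split; first exact: addr_ge0.
split; first exact: hankD.
rewrite (HL2Dl u c0 M0 hc hM) (HL2Zl _ _ hE) (HL2_expk _ (nu0 k)).
by rewrite (ipDl Hip) IH big_cons !(ipZl Hip) /c.
Qed.

End Sum.
End ExponentialKernels.

(** * Matrices of complex kernels as real matrices *)

Section ComplexKernelSystem.
Context {R : realType}.
Local Notation mu := (@lebesgue_measure R).
Local Notation L2R := (L2 mu).
Local Notation ipR := (ip2 (mu := mu)).
Local Notation snR := (sn ipR).
(* The component (i, false) of a pair of complex functions is the real part of
   its i-th function and (i, true) the imaginary part. *)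
Local Notation I := (bool * bool)%type.
Local Notation X := (I -> L2R).
Local Notation ipX := (ipv ipR (I := I)).
Local Notation snX := (sn ipX).

Let Hip := semi_inner_ip2 mu.
Let HX : semi_inner ipX := semi_inner_ipv I Hip.

Definition symker (a b : R -> R) l z : R :=
  (2 * pi)^-1 * fker (dsym l (a, b)).1 (dsym l (a, b)).2 z.

(* The kernel of a symbol c has as imaginary part the real part of the kernel of
   - i c. *)
Definition imsym (r : bool) (c : (R -> R) * (R -> R)) : (R -> R) * (R -> R) :=
  if r then (c.2, fun xi => - c.1 xi) else c.

(* Entries of the real 2 x 2 matrix of the multiplication by
   [p false + i p true]. *)
Definition realmx (V : zmodType) (p : bool -> V) (r s : bool) : V :=
  if ~~ r && s then - p true else p (r (+) s).

Variables (n : nat) (N : finType) (nu : N -> R).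
Variables (c : bool -> bool -> (R -> R) * (R -> R)) (w : bool -> bool -> bool -> N -> R).
Variables (B delta : R).
Hypotheses (nu0 : forall k, 0 < nu k) (B0 : 0 <= B) (delta0 : 0 <= delta).
Hypothesis mc : forall i j, measurable_fun setT (c i j).1 /\ measurable_fun setT (c i j).2.
Hypothesis decay : forall i j xi,
  (1 + xi ^+ 2) ^+ n.+2 * ((c i j).1 xi ^+ 2 + (c i j).2 xi ^+ 2) <= B ^+ 2.
Hypothesis small : forall i j xi, (c i j).1 xi ^+ 2 + (c i j).2 xi ^+ 2 <= delta ^+ 2.

(** In these names [c] marks the continuous part and [d] the discrete part; [r] selects the real
    ([false]) or imaginary ([true]) part of the entry [(i, j)], and [l] is the order of the
    derivative. *)
Definition ckerc (i j r : bool) l z : R :=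
  symker (imsym r (c i j)).1 (imsym r (c i j)).2 l z.
Definition ckerd (i j r : bool) l z : R := expsum nu (w i j r) l z.
Definition cker (i j r : bool) l z : R := ckerc i j r l z + ckerd i j r l z.

Lemma kfam_ckerc i j r : kfam n (ckerc i j r).
Proof.
have [m1 m2] := mc i j.
apply: kfamZ; apply: (kfam_fker B0).
- by case: r.
- by case: r => //=; exact: measurable_funN.
- move=> xi; apply: le_trans (decay i j xi).
  by case: r => /=; rewrite ?sqrrN // [X in _ * X]addrC.
Qed.

Lemma kfam_cker i j r : kfam n (cker i j r).
Proof. by apply: kfamD; [exact: kfam_ckerc|exact: kfam_expsum]. Qed.

Definition Kmx (i j : I) l z : R := realmx (fun r => cker i.1 j.1 r l z) i.2 j.2.
Definition Kcmx (i j : I) l z : R := realmx (fun r => ckerc i.1 j.1 r l z) i.2 j.2.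
Definition Kdmx (i j : I) l z : R := realmx (fun r => ckerd i.1 j.1 r l z) i.2 j.2.

Let kfam_real (k : bool -> nat -> R -> R) r s : (forall t, kfam n (k t)) ->
  kfam n (fun l z => realmx (fun t => k t l z) r s).
Proof.
move=> kk; rewrite /realmx; case: (~~ r && s); last exact: kk.
have := kfamZ (-1) (kk true).
by under eq_fun do under eq_fun do rewrite mulN1r.
Qed.

Lemma kfam_Kmx i j : kfam n (Kmx i j).
Proof. by apply: kfam_real => t; exact: kfam_cker. Qed.

Lemma kfam_Kcmx i j : kfam n (Kcmx i j).
Proof. by apply: kfam_real => t; exact: kfam_ckerc. Qed.

Lemma kfam_Kdmx i j : kfam n (Kdmx i j).
Proof. by apply: kfam_real => t; exact: kfam_expsum. Qed.

Lemma KmxE i j l z : Kmx i j l z = Kcmx i j l z + Kdmx i j l z.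
Proof. by rewrite /Kmx /Kcmx /Kdmx /realmx; case: ifP => _ //; rewrite opprD. Qed.

Lemma Top_KmxE x u : Top Kmx 0 x u = Top Kcmx 0 x u + Top Kdmx 0 x u.
Proof.
apply/funext => i; rewrite /Top /Hmx.
rewrite [RHS](_ : _ = \sum_j HL2 (fun z => Kcmx i j 0 (2 * x + z)) (u j) +
      \sum_j HL2 (fun z => Kdmx i j 0 (2 * x + z)) (u j)) //.
rewrite -big_split; apply: eq_bigr => j _.
have [C1 [C10 H1]] := kfam_hank (kfam_Kcmx i j) (2 * x) (leq0n n).
have [C2 [C20 H2]] := kfam_hank (kfam_Kdmx i j) (2 * x) (leq0n n).
apply: (etrans _ (HL2Dl (u j) C10 C20 H1 H2)); congr (HL2 _ (u j)).
by apply/funext => z; exact: KmxE.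
Qed.

(** The normalisation 1 / (2 pi) times the operator bound 4 pi delta. *)
Lemma sn_HL2_ckerc i j r x v :
  snR (HL2 (fun z => ckerc i j r 0 (2 * x + z)) v) <= 2 * delta * snR v.
Proof.
have [m1 m2] := mc i j.
pose a := (imsym r (c i j)).1; pose b := (imsym r (c i j)).2.
have ma : measurable_fun setT a by rewrite /a /imsym; case: (r).
have mb : measurable_fun setT b by rewrite /b /imsym; case: (r) => //=; exact: measurable_funN.
have ab xi : a xi ^+ 2 + b xi ^+ 2 = (c i j).1 xi ^+ 2 + (c i j).2 xi ^+ 2.
  by rewrite /a /b /imsym; case: (r) => /=; rewrite ?sqrrN // addrC.
have dab xi : (1 + xi ^+ 2) ^+ n.+2 * (a xi ^+ 2 + b xi ^+ 2) <= B ^+ 2 by rewrite ab.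
have [ia ib] := integrable_dsym B0 ma mb dab (leq0n n).
have sab : symbol_le delta a b by split => // xi; rewrite ab.
have [D [_ hD]] := kfam_hank (kfam_fker B0 ma mb dab) (2 * x) (leq0n n).
have p0 : 0 <= (2 * pi : R)^-1 by rewrite invr_ge0 mulr_ge0 // pi_ge0.
rewrite (HL2Zl _ _ hD) (snZ Hip) ger0_norm //.
have pd : 0 <= 4 * pi * delta by rewrite !mulr_ge0 // pi_ge0.
apply: le_trans (ler_wpM2l p0 (sn_HL2_op pd hD (hankel_fker_op _ delta0 sab (L2P v)))) _.
rewrite le_eqVlt; apply/orP; left; apply/eqP.
by move: (pi : R) (pi_gt0 R) => q q0; field; rewrite gt_eqF.
Qed.

(** 64 = 2 * 16 * 2: the square root of the number of components, sixteen entries, and norm at most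
    2 delta for each. *)
Lemma sn_Top_Kcmx x (u : X) : snX (Top Kcmx 0 x u) <= 64 * delta * snX u.
Proof.
have := @sn_Hmx _ _ (fun i j z => Kcmx i j 0 (2 * x + z)) (fun=> fun=> 2 * delta) u.
have -> : Num.sqrt #|{: I}|%:R = 2 :> R.
  by rewrite card_prod card_bool (natrM R 2 2) -expr2 sqrtr_sqr ger0_norm.
rewrite !sumr_const card_prod card_bool -!mulrnA.
rewrite (_ : 2 * (2 * delta *+ _) = 64 * delta); last by rewrite -(mulr_natl (2 * delta)) !natrM; ring.
apply => [i j|i j v]; first exact: mulr_ge0.
rewrite /Kcmx /realmx; case: (~~ i.2 && j.2); last exact: sn_HL2_ckerc.
have [D [_ hD]] := kfam_hank (kfam_ckerc i.1 j.1 true) (2 * x) (leq0n n).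
have := HL2Zl (-1) v hD; under eq_fun do rewrite mulN1r.
move=> ->; rewrite (snZ Hip) normrN1 mul1r; exact: sn_HL2_ckerc.
Qed.

Hypothesis psd : forall k (y : I -> R),
  0 <= \sum_i \sum_j realmx (fun r => w i.1 j.1 r k) i.2 j.2 * (y j * y i).

(** Each exponential acts with rank one, so the form is a sum over [k] of positive factors
    [expk (nu k) (2 * x)] times the form of [psd] at the coefficients of [u] along the k-th
    exponential. *)
Lemma ip_Top_Kdmx x (u : X) : 0 <= ipX (Top Kdmx 0 x u) u.
Proof.
pose y k (i : I) := ipR (cutL2 (expk (nu k))) (u i).
suff -> : ipX (Top Kdmx 0 x u) u = \sum_k expk (nu k) (2 * x) *
    \sum_i \sum_j realmx (fun r => w i.1 j.1 r k) i.2 j.2 * (y k j * y k i).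
  by apply: sumr_ge0 => k _; rewrite mulr_ge0 // expR_ge0.
under [RHS]eq_bigr do rewrite mulr_sumr.
rewrite exchange_big; apply: eq_bigr => i _ /=.
under [RHS]eq_bigr do rewrite mulr_sumr.
rewrite exchange_big /= /Top /Hmx.
rewrite (big_morph (fun v => ipR v (u i)) (fun a b => ipDl Hip a b (u i)) (id1 := 0)); last first.
  by rewrite -(scale0r 0) (ipZl Hip) mul0r.
apply: eq_bigr => j _.
have Kd z : Kdmx i j 0 (2 * x + z) =
    expsum nu (fun k => realmx (fun r => w i.1 j.1 r k) i.2 j.2) 0 (2 * x + z).
  rewrite /Kdmx /ckerd /realmx; case: ifP => _ //.
  by rewrite /expsum -sumrN; apply: eq_bigr => k _; rewrite mulNr.
under eq_fun do rewrite Kd.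
by rewrite ip_HL2_expsum //; apply: eq_bigr => k _; rewrite /y; ring.
Qed.

Lemma Kmx_coercive (b : R) x (u : X) :
  (b - 64 * delta) * ipX u u <= ipX (b *: u + Top Kmx 0 x u) u.
Proof.
rewrite (ipDl HX) (ipZl HX) Top_KmxE (ipDl HX) mulrBl.
have h1 := ip_Top_Kdmx x u.
have h2 : - (64 * delta * ipX u u) <= ipX (Top Kcmx 0 x u) u.
  rewrite lerNl; apply: le_trans (ler_norm _) _; rewrite normrN.
  apply: le_trans (cauchy_schwarz HX _ _) _.
  rewrite -(sn_sqr HX) expr2 mulrA ler_wpM2r ?sn_ge0 //; exact: sn_Top_Kcmx.
apply: lerD; first exact: lexx.
apply: (le_trans h2); rewrite lerDl; exact: h1.
Qed.

End ComplexKernelSystem.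

(** * The spectral parameter and the symbols *)
Section NullPreimage.
Context {R : realType}.
Local Notation mu := (@lebesgue_measure R).
Local Notation wl := (@wlength R idfun).

(** The preimage of an interval of length d lies within distance L d of any of its points, hence in
    an interval of length 2 L d; summing over a cover of [N] by open intervals of small total length
    gives outer measure 0. *)
Lemma negligible_preimage_expanding (f : R -> R) (D : set R) (L : R) (N : set R) : 0 <= L ->
  (forall x y, D x -> D y -> `|x - y| <= L * `|f x - f y|) ->
  mu.-negligible N -> mu.-negligible (D `&` f @^-1` N).
Proof.
move=> L0 fD /negligible_outer_measure N0; apply/negligible_outer_measure.
apply/eqP; rewrite eq_le outer_measure_ge0 andbT.
apply/lee_addgt0Pr => e e0; rewrite add0e.
(* The summand 1 keeps the denominator positive when [L] is 0. *)
pose d := e / (2 * L + 1).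
have L1 : 0 < 2 * L + 1 by rewrite ltr_wpDl // mulr_ge0.
have d0 : 0 < d by rewrite divr_gt0.
have [F [Fo NF] Fd] : exists2 F, open_itv_cover N F & (\sum_(0 <= k <oo) wl (F k) <= d%:E)%E.
  have : (wl^* N)%mu \is a fin_num by rewrite N0.
  rewrite outer_measure_open_itv_cover.
  move=> /lb_ereal_inf_adherent-/(_ _ d0)[_/= [F]] AF <- Fe.
  exists F => //; apply/ltW; apply: lt_le_trans Fe _.
  by rewrite -outer_measure_open_itv_cover N0 add0e.
pose G k := D `&` f @^-1` (F k).
have Gk k : ((wl^* (G k))%mu <= (2 * L)%:E * wl (F k))%E.
  have [[a b] /= Fk] := Fo k.
  have [/eqP G0|/set0P[x0 [Dx0 Fx0]]] := boolP (G k == set0).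
    by rewrite G0 outer_measure0 mule_ge0 // lee_fin mulr_ge0.
  have ab : a < b.
    by move: Fx0; rewrite Fk /= in_itv /= => /andP[]; exact: lt_trans.
  have GI : G k `<=` `[x0 - L * (b - a), x0 + L * (b - a)]%classic.
    move=> x [Dx Fx]; rewrite /= in_itv /= -ler_distlC distrC.
    apply: le_trans (fD _ _ Dx Dx0) _; rewrite ler_wpM2l //.
    move: Fx Fx0; rewrite Fk /= !in_itv /= => /andP[h1 h2] /andP[h3 h4].
    by rewrite ler_norml; apply/andP; split; lra.
  apply: (@le_trans _ _ (wl^* `[(x0 - L * (b - a))%R, (x0 + L * (b - a))%R]%classic)%mu).
    exact: le_outer_measure.
  rewrite -[X in (X <= _)%E]/(mu `[x0 - L * (b - a), x0 + L * (b - a)]%classic).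
  rewrite lebesgue_measure_itv /= lte_fin Fk wlength_itv /= lte_fin ab.
  have Lab : 0 <= L * (b - a) by rewrite mulr_ge0 // subr_ge0 ltW.
  case: ifPn => _; last by rewrite -EFinB -EFinM lee_fin -mulrA mulr_ge0.
  by rewrite -!EFinB -EFinM lee_fin; lra.
have sub : D `&` f @^-1` N `<=` \bigcup_k G k.
  by move=> x [Dx /NF[k _ Fx]]; exists k.
apply: (@le_trans _ _ (wl^* (\bigcup_k G k))%mu); first exact: le_outer_measure.
apply: (@le_trans _ _ (\sum_(0 <= k <oo) (wl^* (G k))%mu)%E).
  exact: outer_measure_sigma_subadditive.
apply: (@le_trans _ _ (\sum_(0 <= k <oo) ((2 * L)%:E * wl (F k)))%E).
  by apply: lee_nneseries => // i *; first [exact: Gk|exact: outer_measure_ge0].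
rewrite nneseriesZl //.
apply: (@le_trans _ _ ((2 * L)%:E * d%:E)%E).
  by rewrite lee_wpmul2l // lee_fin mulr_ge0.
rewrite -EFinM lee_fin /d mulrA ler_pdivrMr // mulrC ler_wpM2l ?(ltW e0) //.
by rewrite lerDl.
Qed.

Lemma lambda_of_sqr (xi : R) : lambda_of xi ^+ 2 = xi ^+ 2 + 2^-1.
Proof. by rewrite /lambda_of sqr_sqrtr // addr_ge0 ?sqr_ge0 // invr_ge0. Qed.

Lemma lambda_of_gt0 (xi : R) : 0 < lambda_of xi.
Proof. by rewrite sqrtr_gt0 ltr_wpDl ?sqr_ge0 // invr_gt0. Qed.

Lemma lambda_of_spectrum (xi : R) : (Num.sqrt 2)^-1 <= lambda_of xi.
Proof.
rewrite -sqrtrV // /lambda_of ler_wsqrtr // lerDr; exact: sqr_ge0.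
Qed.

(** The squares of [lambda_of] and of the identity differ by a constant, so x - y and the difference
    of the values are in the ratio of two sums, both under control when x and y stay in [1/M, M]. *)
Lemma lambda_of_expanding (M x y : R) : 0 < M ->
  M^-1 <= x <= M -> M^-1 <= y <= M -> `|x - y| <= M * (M + 1) * `|lambda_of x - lambda_of y|.
Proof.
move=> M0 /andP[x1 x2] /andP[y1 y2].
have i0 : 0 < M^-1 :> R by rewrite invr_gt0.
have lm z : M^-1 <= z <= M -> lambda_of z <= M + 1.
  move=> /andP[z1 z2]; have M1 : 0 <= M + 1 by lra.
  rewrite -(ger0_norm M1) -sqrtr_sqr ler_wsqrtr //.
  have : z ^+ 2 <= M ^+ 2.
    by rewrite lerXn2r ?nnegrE ?(ltW M0) // ltW // (lt_le_trans i0).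
  have h : (2^-1 : R) <= 1 by rewrite invf_le1 // ler1n.
  by nra.
have lx := lm x; have ly := lm y.
have e : (x - y) * (x + y) = (lambda_of x - lambda_of y) * (lambda_of x + lambda_of y).
  by rewrite -!subr_sqr !lambda_of_sqr; ring.
have e' := congr1 Num.norm e; rewrite !normrM in e'.
have p1 : 0 < x + y by lra.
have p2 : 0 < lambda_of x + lambda_of y by rewrite addr_gt0 // lambda_of_gt0.
rewrite (gtr0_norm p1) (gtr0_norm p2) in e'.
have h1 : `|x - y| * (2 * M^-1) <= `|lambda_of x - lambda_of y| * (2 * (M + 1)).
  apply: (@le_trans _ _ (`|x - y| * (x + y))).
    by rewrite ler_wpM2l //; lra.
  rewrite e' ler_wpM2l //.
  have := lx; rewrite x1 x2 => /(_ isT).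
  have := ly; rewrite y1 y2 => /(_ isT).
  by lra.
have h2 : `|x - y| * M^-1 <= `|lambda_of x - lambda_of y| * (M + 1) by lra.
move: h2; rewrite ler_pdivrMr // => /le_trans; apply.
by rewrite le_eqVlt; apply/orP; left; apply/eqP; ring.
Qed.

(** [lambda_of] is critical at 0, so the exceptional set is divided into the null point 0 and the
    shells 1/(m+1) <= |xi| <= m+1, where the map is expanding. The signs [s] and [t] run over the
    two sheets of the spectrum and the two half-lines of xi. *)
Lemma ae_lambda_of (P : R -> Prop) :
  {ae mu, forall l : R, continuous_spectrum l -> P l} ->
  {ae mu, forall xi : R, P (lambda_of xi) /\ P (- lambda_of xi)}.
Proof.
move=> h.
pose N := [set l : R | ~ (continuous_spectrum l -> P l)].
have N0 : mu.-negligible N by [].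
pose D m := [set x : R | m.+1%:R^-1 <= x <= m.+1%:R].
pose f (s t : bool) (x : R) : R := (-1) ^+ s * lambda_of ((-1) ^+ t * x).
pose E (s t : bool) m := [set x : R | D m ((-1) ^+ t * x)] `&` f s t @^-1` N.
have nE s t m : mu.-negligible (E s t m).
  apply: (@negligible_preimage_expanding _ _ (m.+1%:R * (m.+1%:R + 1))) => //.
  move=> x y Dx Dy; rewrite /f -mulrBr normrM normr_sign mul1r.
  by have := lambda_of_expanding (ltr0Sn R m) Dx Dy; rewrite -mulrBr normrM normr_sign mul1r.
have nU s t : mu.-negligible (\bigcup_m E s t m) by apply: negligible_bigcup.
have z0 : mu.-negligible [set (0 : R)].
  by exists [set 0]; split => //; exact: lebesgue_measure_set1.
have := negligibleU z0 (negligibleU (negligibleU (nU false false) (nU false true))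
  (negligibleU (nU true false) (nU true true))).
apply: negligibleS => x /= nP; have [->|x0] := eqVneq x 0; first by left.
right.
have [s fN] : exists s : bool, N ((-1) ^+ s * lambda_of x).
  apply: contrapT => hN; apply: nP; split; apply: contrapT => hP; apply: hN.
    exists false; rewrite expr0 mul1r => hs; apply: hP; apply: hs.
    by rewrite /continuous_spectrum /= ger0_norm ?(ltW (lambda_of_gt0 _)) // lambda_of_spectrum.
  exists true; rewrite expr1 mulN1r => hs; apply: hP; apply: hs.
  by rewrite /continuous_spectrum /= normrN ger0_norm ?(ltW (lambda_of_gt0 _)) // lambda_of_spectrum.
have [t tx] : exists t : bool, (-1) ^+ t * x = `|x|.
  by exists (x < 0); rewrite [RHS]normrEsg sgr_def x0 mulr1n.
have lx : lambda_of ((-1) ^+ t * x) = lambda_of x.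
  by rewrite /lambda_of exprMn sqrr_sign mul1r.
have [m hm] : exists m : nat, D m `|x|.
  have nx : 0 < `|x| by rewrite normr_gt0.
  have [m1 h1] : exists m : nat, `|x| <= m%:R.
    by exists (Num.truncn `|x|).+1; exact/ltW/truncnS_gt.
  have [m2 h2] : exists m : nat, `|x|^-1 <= m%:R.
    by exists (Num.truncn `|x|^-1).+1; exact/ltW/truncnS_gt.
  exists (m1 + m2)%N; apply/andP; split.
    rewrite -[`|x|]invrK lef_pV2 ?posrE ?invr_gt0 //.
    by apply: le_trans h2 _; rewrite ler_nat (leq_trans (leq_addl m1 m2)).
  by apply: le_trans h1 _; rewrite ler_nat (leq_trans (leq_addr m2 m1)).
have Ex : (\bigcup_m E s t m) x.
  by exists m => //; split; rewrite /= ?tx // /f lx.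
by case: s t {fN tx lx} Ex => [] [] Ex; [right; right|right; left|left; right|left; left].
Qed.

End NullPreimage.

(** * From L^oo norms to almost everywhere bounds *)

Section EssentialBounds.
Context {R : realType}.
Local Notation mu := (@lebesgue_measure R).
Local Notation C := R[i].
Local Notation normc := (@Normc.normc R).

(** The definition of the norm of exponent [+oo] distinguishes spaces of measure 0; this selects the
    essential supremum. *)
Lemma lebesgue_measureT_gt0 : (0 < mu [set: R])%E.
Proof.
apply: (@lt_le_trans _ _ (mu `[0, 1]%classic)).
  by rewrite lebesgue_measure_itv /= lte_fin ltr01 sube0 lte_fin ltr01.
by apply: le_measure => //; rewrite inE //; exact: measurable_itv.
Qed.

Lemma cLnormy_le (D : set R) (f : R -> C) (M : R) : 0 <= M ->
  (cLnorm D +oo f <= M%:E)%E -> {ae mu, forall l : R, D l -> normc (f l) <= M}.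
Proof.
move=> M0; rewrite /cLnorm unlock lebesgue_measureT_gt0 => /ess_supP.
apply: ae_imp => l; rewrite /= patchE => h Dl.
rewrite mem_set // in h; move: h; rewrite /= ger0_norm // ?lee_fin //.
by case: (f l) => a b /=; exact: sqrtr_ge0.
Qed.

Lemma inLpy_bounded (D : set R) (f : R -> C) : inLp D +oo%E f ->
  exists M, 0 <= M /\ {ae mu, forall l : R, D l -> normc (f l) <= M}.
Proof.
move=> [_ fy].
have f0 : (0 <= cLnorm D +oo f)%E by exact: Lnorm_ge0.
have ff : cLnorm D +oo f \is a fin_num by rewrite ge0_fin_numE.
exists (fine (cLnorm D +oo f)); rewrite fine_ge0 //; split => //.
by apply: cLnormy_le; rewrite ?fine_ge0 // fineK.
Qed.

End EssentialBounds.

Section ComplexParts.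
Context {R : realType}.
Implicit Types x y : R[i].
Local Notation Re := complex.Re.
Local Notation Im := complex.Im.

Lemma complex_eq x y : Re x = Re y -> Im x = Im y -> x = y.
Proof. by case: x y => [a b] [c d] /= -> ->. Qed.

Lemma Re_mulc x y : Re (x * y) = Re x * Re y - Im x * Im y.
Proof. by case: x y => [a b] [c d]. Qed.

Lemma Im_mulc x y : Im (x * y) = Re x * Im y + Im x * Re y.
Proof. by case: x y => [a b] [c d]. Qed.

Lemma Re_addc x y : Re (x + y) = Re x + Re y.
Proof. by case: x y => [a b] [c d]. Qed.

Lemma Im_addc x y : Im (x + y) = Im x + Im y.
Proof. by case: x y => [a b] [c d]. Qed.

Lemma Re_oppc x : Re (- x) = - Re x. Proof. by case: x. Qed.
Lemma Im_oppc x : Im (- x) = - Im x. Proof. by case: x. Qed.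

Definition reimE := (Re_addc, Im_addc, Re_oppc, Im_oppc, Re_mulc, Im_mulc).

Lemma invc_real (r : R) : (r%:C%C)^-1 = (r^-1)%:C%C.
Proof. by rewrite fmorphV. Qed.

Lemma normc_sqr x : Normc.normc x ^+ 2 = Re x ^+ 2 + Im x ^+ 2.
Proof. by case: x => a b /=; rewrite sqr_sqrtr // addr_ge0 ?sqr_ge0. Qed.

Lemma normc_real (r : R) : Normc.normc (r%:C%C) = `|r|.
Proof. by rewrite /= expr0n addr0 sqrtr_sqr. Qed.

End ComplexParts.

Lemma sum_bool2 (V : zmodType) (F : bool * bool -> V) : \sum_i F i =
  F (false, false) + F (false, true) + F (true, false) + F (true, true).
Proof.
rewrite (eq_bigr (fun i => F (i.1, i.2))) => [|[] //].
rewrite -(pair_big xpredT xpredT (fun a b => F (a, b))) /= !big_bool /=.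
by rewrite addrC (addrC (F (false, true))) (addrC (F (true, true))) addrA.
Qed.

(** * Symbols modified on a null set *)

Section TruncatedSymbols.
Context {R : realType}.
Local Notation leb := (@lebesgue_measure R).
Local Notation C := R[i].
Local Notation Re := complex.Re.
Local Notation Im := complex.Im.
Variables (n : nat) (beta : R -> C) (B e : R).
Hypotheses (B0 : 0 <= B) (e0 : 0 <= e).
Hypotheses
  (mp : cmeasurable setT (fun xi : R => beta (lambda_of xi)))
  (mm : cmeasurable setT (fun xi : R => beta (- lambda_of xi))).
Hypothesis bB : {ae leb, forall l : R, continuous_spectrum l ->
  Normc.normc ((l ^+ n.+2)%:C%C * beta l) <= B}.
Hypothesis be : {ae leb, forall l : R, continuous_spectrum l ->
  Normc.normc ((l ^+ n)%:C%C * beta l) <= e}.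

Let sqn (z : C) : R := Re z ^+ 2 + Im z ^+ 2.

Let S xi := sqn (beta (lambda_of xi)) + sqn (beta (- lambda_of xi)).

(** The frequencies at which both bounds hold in squared form, the factors 2 accounting for the two
    sheets summed in [S]. As a boolean test it can be used to redefine the symbols measurably. *)
Let good xi := (S xi * (lambda_of xi ^+ 2) ^+ n.+2 <= 2 * B ^+ 2) &&
  (S xi * (lambda_of xi ^+ 2) ^+ n <= 2 * e ^+ 2).

Let S0 xi : 0 <= S xi. Proof. by rewrite !addr_ge0 ?sqr_ge0. Qed.

Let lam2 (xi : R) : 2^-1 <= lambda_of xi ^+ 2.
Proof. by rewrite lambda_of_sqr lerDr sqr_ge0. Qed.

Lemma ae_good : {ae leb, forall xi, good xi}.
Proof.
have h1 := ae_lambda_of bB; have h2 := ae_lambda_of be.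
have : {ae leb, forall xi : R,
  (Normc.normc ((lambda_of xi ^+ n.+2)%:C%C * beta (lambda_of xi)) <= B /\
   Normc.normc (((- lambda_of xi) ^+ n.+2)%:C%C * beta (- lambda_of xi)) <= B) /\
  (Normc.normc ((lambda_of xi ^+ n)%:C%C * beta (lambda_of xi)) <= e /\
   Normc.normc (((- lambda_of xi) ^+ n)%:C%C * beta (- lambda_of xi)) <= e)}.
  exact: (@filterI _ _ (ae_filter_ringOfSetsType leb) _ _ h1 h2).
apply: ae_imp => xi [[p1 m1] [p2 m2]].
have key (j : nat) (l M : R) (z : C) : 0 <= M -> Normc.normc ((l ^+ j)%:C%C * z) <= M ->
    sqn z * (l ^+ 2) ^+ j <= M ^+ 2.
  move=> M0 h; rewrite /sqn -normc_sqr -exprM mulnC exprM -exprMn.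
  have : Normc.normc ((l ^+ j)%:C%C * z) ^+ 2 <= M ^+ 2.
    by rewrite lerXn2r ?nnegrE // Normc.normcM mulr_ge0 //;
      [rewrite normc_real|case: (z) => a b; exact: sqrtr_ge0].
  by rewrite Normc.normcM normc_real (exprMn _ `|l ^+ j|) real_normK ?num_real // (exprMn _ (Normc.normc z)) mulrC.
have := key _ _ _ _ B0 p1; have := key _ _ _ _ B0 m1; have := key _ _ _ _ e0 p2.
have := key _ _ _ _ e0 m2; rewrite !sqrrN => k1 k2 k3 k4.
by apply/andP; split; rewrite /S mulrDl mulr_natl mulr2n; exact: lerD.
Qed.

Definition rc1 xi := Re (c1 beta xi).
Definition ic1 xi := Im (c1 beta xi).
Definition rc2 xi := Re (c2 beta xi).
Definition ic2 xi := Im (c2 beta xi).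

Let rc1E xi : rc1 xi = Re (beta (lambda_of xi)) + Re (beta (- lambda_of xi)).
Proof. by rewrite /rc1 /c1 !reimE. Qed.
Let ic1E xi : ic1 xi = Im (beta (lambda_of xi)) + Im (beta (- lambda_of xi)).
Proof. by rewrite /ic1 /c1 !reimE. Qed.
Let rc2E xi : rc2 xi = (Re (beta (lambda_of xi)) - Re (beta (- lambda_of xi))) / lambda_of xi.
Proof. by rewrite /rc2 /c2 invc_real !reimE /= mulr0 subr0. Qed.
Let ic2E xi : ic2 xi = (Im (beta (lambda_of xi)) - Im (beta (- lambda_of xi))) / lambda_of xi.
Proof. by rewrite /ic2 /c2 invc_real !reimE /= mulr0 add0r. Qed.

Lemma measurable_lambda_of : measurable_fun setT (@lambda_of R).
Proof.
apply: continuous_measurable_fun => x; apply: continuous_comp; last exact: sqrt_continuous.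
by apply: cvgD; [apply: cvgM; exact: cvg_id|exact: cvg_cst].
Qed.

Lemma measurable_c12 : [/\ measurable_fun setT rc1, measurable_fun setT ic1,
  measurable_fun setT rc2 & measurable_fun setT ic2].
Proof.
have [p1 p2] := mp; have [m1 m2] := mm.
have ml : measurable_fun setT (fun xi : R => (lambda_of xi)^-1).
  have : continuous (fun xi : R => (lambda_of xi)^-1).
    move=> x; apply: cvgV; first by rewrite gt_eqF // lambda_of_gt0.
    apply: (@continuous_comp _ _ _ (fun xi : R => xi ^+ 2 + 2^-1) Num.sqrt).
      by apply: cvgD; [apply: cvgM; exact: cvg_id|exact: cvg_cst].
    exact: sqrt_continuous.
  by move/continuous_measurable_fun.
rewrite (funext rc1E) (funext ic1E) (funext rc2E) (funext ic2E).
split; [exact: measurable_funD|exact: measurable_funD| |].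
- by apply: measurable_funM => //; exact: measurable_funB.
- by apply: measurable_funM => //; exact: measurable_funB.
Qed.

(* Modified on a null set, so that the essential bounds hold at every frequency. *)
Definition cut (f : R -> R) : R -> R := fun xi => if good xi then f xi else 0.

Lemma measurable_cut f : measurable_fun setT f -> measurable_fun setT (cut f).
Proof.
move=> mf; have [p1 p2] := mp; have [m1 m2] := mm.
have mS : measurable_fun setT S.
  by apply: measurable_funD; apply: measurable_funD; exact: measurable_funX.
have ml j : measurable_fun setT (fun xi : R => (lambda_of xi ^+ 2) ^+ j).
  by do 2!apply: measurable_funX; exact: measurable_lambda_of.
apply: measurable_fun_ifT => //.
by apply: measurable_and; apply: measurable_fun_ler => //; apply: measurable_funM.
Qed.

Lemma ae_cut f : {ae leb, forall xi, cut f xi = f xi}.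
Proof. by apply: ae_imp ae_good => xi g; rewrite /cut g. Qed.

(** The symbols of F2 on the diagonal and of sqrt 2 (F1 - i F2') and sqrt 2 (F1 + i F2') off it: F2'
    has the symbol i xi c2, so - i F2' contributes + xi c2. *)
Definition csym (i j : bool) : (R -> R) * (R -> R) :=
  if i == j then (cut rc2, cut ic2) else
  let s : R := if i then -1 else 1 in
  (fun xi => Num.sqrt 2 * (cut rc1 xi + s * (xi * cut rc2 xi)),
   fun xi => Num.sqrt 2 * (cut ic1 xi + s * (xi * cut ic2 xi))).

Lemma measurable_csym i j :
  measurable_fun setT (csym i j).1 /\ measurable_fun setT (csym i j).2.
Proof.
have [m1 m2 m3 m4] := measurable_c12.
rewrite /csym; case: eqP => _ /=; first by split; exact: measurable_cut.
by split; do ![apply: measurable_funM => //|apply: measurable_funD => //]; exact: measurable_cut.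
Qed.

(** Since 1/lambda^2 <= 2 and |xi/lambda| <= 1, |c2|^2 <= 4 S while |c1|^2 and |xi c2|^2 are at most
    2 S. Off the diagonal, sqrt 2 and the square of a sum each double: 2 * 2 * (2 + 2) = 16. The
    factor xi costs no decay because c2 contains 1/lambda. *)
Lemma csym_le i j xi :
  (csym i j).1 xi ^+ 2 + (csym i j).2 xi ^+ 2 <= 16 * (if good xi then S xi else 0).
Proof.
have sq2 : Num.sqrt 2 ^+ 2 = 2 :> R by rewrite sqr_sqrtr.
have [g|g] := boolP (good xi); last first.
  rewrite mulr0 /csym /cut; case: (i == j) => /=.
    by rewrite (negbTE g) expr0n /= addr0.
  by rewrite (negbTE g) !mulr0 addr0 mulr0 expr0n /= addr0.
have cutE f : cut f xi = f xi by rewrite /cut g.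
have l0 := lambda_of_gt0 xi; have l2 := lam2 xi; have le := lambda_of_sqr xi.
set p := Re (beta (lambda_of xi)); set q := Im (beta (lambda_of xi)).
set r := Re (beta (- lambda_of xi)); set s := Im (beta (- lambda_of xi)).
have SE : S xi = p ^+ 2 + q ^+ 2 + (r ^+ 2 + s ^+ 2) by [].
have li : (lambda_of xi)^-1 ^+ 2 <= 2.
  by rewrite exprVn -[X in _ <= X]invrK lef_pV2 // posrE ?invr_gt0 // exprn_gt0.
have x2 : (xi / lambda_of xi) ^+ 2 <= 1.
  by rewrite exprMn exprVn ler_pdivrMr ?exprn_gt0 // mul1r le lerDl invr_ge0.
have D (a b : R) : (a + b) ^+ 2 <= 2 * (a ^+ 2 + b ^+ 2).
  by have := sqr_ge0 (a - b); rewrite sqrrB sqrrD; lra.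
have c2le : rc2 xi ^+ 2 + ic2 xi ^+ 2 <= 4 * S xi.
  rewrite rc2E ic2E -/p -/q -/r -/s !exprMn -mulrDl.
  have h : (p - r) ^+ 2 + (q - s) ^+ 2 <= 2 * S xi.
    by have := D p (- r); have := D q (- s); rewrite !sqrrN SE; lra.
  apply: le_trans (ler_wpM2r (sqr_ge0 _) h) _.
  apply: le_trans (ler_wpM2l (_ : 0 <= 2 * S xi) li) _; first by rewrite mulr_ge0.
  by lra.
have xc2le : (xi * rc2 xi) ^+ 2 + (xi * ic2 xi) ^+ 2 <= 2 * S xi.
  rewrite rc2E ic2E -/p -/q -/r -/s.
  rewrite (_ : _ ^+ 2 + _ = ((p - r) ^+ 2 + (q - s) ^+ 2) * (xi / lambda_of xi) ^+ 2); last by ring.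
  have h : (p - r) ^+ 2 + (q - s) ^+ 2 <= 2 * S xi.
    by have := D p (- r); have := D q (- s); rewrite !sqrrN SE; lra.
  apply: le_trans (ler_wpM2r (sqr_ge0 _) h) _.
  apply: le_trans (ler_wpM2l (_ : 0 <= 2 * S xi) x2) _; first by rewrite mulr_ge0.
  by rewrite mulr1.
have c1le : rc1 xi ^+ 2 + ic1 xi ^+ 2 <= 2 * S xi.
  by rewrite rc1E ic1E -/p -/q -/r -/s; have := D p r; have := D q s; rewrite SE; lra.
rewrite /csym; case: (i == j) => /=; rewrite !cutE; first by have := S0 xi; lra.
rewrite !exprMn sq2.
set t : R := if i then -1 else 1; have t2 : t ^+ 2 = 1 by rewrite /t; case: (i); rewrite ?sqrrN expr1n.
have h1 := D (rc1 xi) (t * (xi * rc2 xi)); have h2 := D (ic1 xi) (t * (xi * ic2 xi)).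
rewrite !(exprMn _ t) t2 !mul1r in h1 h2; rewrite -mulrDr; lra.
Qed.

(** 1 + xi^2 <= 2 lambda^2 turns decay in lambda into decay in xi. The constant is rounded up to a
    perfect square. *)
Lemma csym_decay i j xi :
  (1 + xi ^+ 2) ^+ n.+2 * ((csym i j).1 xi ^+ 2 + (csym i j).2 xi ^+ 2) <=
  (2 ^+ n.+2 * 8 * B) ^+ 2.
Proof.
have x0 : 0 <= 1 + xi ^+ 2 by rewrite addr_ge0 ?sqr_ge0.
apply: le_trans (ler_wpM2l (exprn_ge0 _ x0) (csym_le i j xi)) _.
case: ifPn => [/andP[g _]|_]; last by rewrite !mulr0 sqr_ge0.
have h : (1 + xi ^+ 2) ^+ n.+2 <= (2 * lambda_of xi ^+ 2) ^+ n.+2.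
  rewrite lerXn2r ?nnegrE //; have := sqr_ge0 xi; rewrite lambda_of_sqr; lra.
apply: le_trans (ler_wpM2r (_ : 0 <= 16 * S xi) h) _; first by rewrite mulr_ge0.
have p1 : 1 <= 2 ^+ n.+2 :> R by rewrite exprn_ege1 // ler1n.
rewrite (exprMn _ 2); move: g p1.
move: ((lambda_of xi ^+ 2) ^+ n.+2) (2 ^+ n.+2 : R) => w q g p1.
have q0 : 0 <= q by apply: le_trans p1.
rewrite (_ : q * w * (16 * S xi) = q * 16 * (S xi * w)); last by ring.
apply: le_trans (ler_wpM2l (_ : 0 <= q * 16) g) _; first by rewrite mulr_ge0.
rewrite (_ : (_ * 8 * _) ^+ 2 = q * (64 * (q * B ^+ 2))); last by ring.
have -> : q * 16 * (2 * B ^+ 2) = q * (32 * B ^+ 2) by ring.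
rewrite ler_wpM2l //.
have B2 := sqr_ge0 B; have : B ^+ 2 <= q * B ^+ 2 by rewrite ler_peMl.
by move: (q * B ^+ 2) => v; lra.
Qed.

(** The origin of the exponent n + 9: lambda^2 >= 1/2 gives S <= 2^n * 2 e^2, so 16 S <= 2^(n+5) *
    2^(-2n-18) <= 2^(-12). The target 2^(-6) is the inverse of the 64 in the norm of the continuous
    operator. *)
Lemma csym_small i j xi : e <= (2 ^+ (n + 9))^-1 ->
  (csym i j).1 xi ^+ 2 + (csym i j).2 xi ^+ 2 <= (2 ^+ 6)^-1 ^+ 2.
Proof.
move=> ee; apply: le_trans (csym_le i j xi) _.
case: ifPn => [/andP[_ g]|_]; last by rewrite !mulr0 sqr_ge0.
have h : 2^-1 ^+ n * S xi <= 2 * e ^+ 2.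
  apply: le_trans g; rewrite mulrC ler_wpM2l // lerXn2r ?nnegrE ?sqr_ge0 //.
have P : 0 < 2 ^+ n :> R by rewrite exprn_gt0.
have P1 : 1 <= 2 ^+ n :> R by rewrite exprn_ege1 // ler1n.
have h2 : S xi <= 2 ^+ n * (2 * e ^+ 2).
  by rewrite -ler_pdivrMl // -exprVn.
have e2 : e ^+ 2 <= ((2 ^+ (n + 9))^-1) ^+ 2.
  by rewrite lerXn2r ?nnegrE // invr_ge0 exprn_ge0.
apply: (@le_trans _ _ (32 * (2 ^+ n * ((2 ^+ (n + 9))^-1) ^+ 2))).
  have : 2 ^+ n * e ^+ 2 <= 2 ^+ n * ((2 ^+ (n + 9))^-1) ^+ 2 by rewrite ler_wpM2l // ltW.
  have := h2; rewrite mulrCA; move: (2 ^+ n * e ^+ 2) (2 ^+ n * _) => u v; lra.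
rewrite -[(2 ^+ (n + 9))^-1]exprVn -[(2 ^+ 6)^-1]exprVn exprD; set t := 2^-1 : R.
have tp : 2 ^+ n * t ^+ n = 1 :> R by rewrite -exprMn divff // expr1n.
rewrite (_ : _ * _ = 32 * t ^+ 18 * t ^+ n * (2 ^+ n * t ^+ n)); last by ring.
rewrite tp mulr1.
have t1 : t ^+ n <= 1 by rewrite exprn_ile1 // /t ?invr_ge0 // invf_le1 // ler1n.
apply: (@le_trans _ _ (32 * t ^+ 18)).
  by rewrite ler_piMr // mulr_ge0 // exprn_ge0 // /t invr_ge0.
have -> : 32 = 2 ^+ 5 :> R by rewrite -natrX.
rewrite -[18%N]/(5 + 13)%N exprD mulrA -exprMn divff // expr1n mul1r -exprM.
by rewrite -[13%N]/(12 + 1)%N exprD ler_piMr ?exprn_ge0 ?exprn_ile1 // /t ?invr_ge0 // invf_le1 // ler1n.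
Qed.

End TruncatedSymbols.

(** * The Marchenko system *)
Section MarchenkoKernels.
Context {R : realType}.
Local Notation leb := (@lebesgue_measure R).
Local Notation C := R[i].
Local Notation Re := complex.Re.
Local Notation Im := complex.Im.

Lemma fker_lin (k s : R) a1 b1 a2 b2 z :
  leb.-integrable setT (EFin \o a1) -> leb.-integrable setT (EFin \o b1) ->
  leb.-integrable setT (EFin \o a2) -> leb.-integrable setT (EFin \o b2) ->
  fker (fun x => k * (a1 x + s * a2 x)) (fun x => k * (b1 x + s * b2 x)) z =
  k * (fker a1 b1 z + s * fker a2 b2 z).
Proof.
move=> i1 j1 i2 j2.
have i3 := integrableZl measurableT (- s) i2; have j3 := integrableZl measurableT (- s) j2.
have -> : (fun x => k * (a1 x + s * a2 x)) = (fun x => k * (a1 x - (- s) * a2 x)).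
  by apply/funext => x; rewrite mulNr opprK.
have -> : (fun x => k * (b1 x + s * b2 x)) = (fun x => k * (b1 x - (- s) * b2 x)).
  by apply/funext => x; rewrite mulNr opprK.
rewrite fkerZ; [|exact: (integrableB measurableT i1 i3)|exact: (integrableB measurableT j1 j3)].
by rewrite fkerB // fkerZ // mulNr opprK.
Qed.

Lemma Rintegral_ae_eq (f g : R -> R) : measurable_fun setT f -> measurable_fun setT g ->
  {ae leb, forall x, f x = g x} -> \int[leb]_x f x = \int[leb]_x g x.
Proof.
move=> mf mg h; congr fine; apply: ae_eq_integral => //.
- exact/measurable_EFinP.
- exact/measurable_EFinP.
- by apply: ae_imp h => x /= -> _.
Qed.

(** The identity holds at every [z] although the symbol may be changed on a null set. The second
    kernel belongs to - i c, whose kernel has as real part the imaginary part of that of c. *)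
Lemma cint_fourier (c : R -> C) (a b : R -> R) (z : R) :
  measurable_fun setT (fun xi => Re (c xi)) -> measurable_fun setT (fun xi => Im (c xi)) ->
  leb.-integrable setT (EFin \o a) -> leb.-integrable setT (EFin \o b) ->
  {ae leb, forall xi, a xi = Re (c xi)} -> {ae leb, forall xi, b xi = Im (c xi)} ->
  cint setT (fun xi => c xi * cis (xi * z)) =
  (fker a b z +i* fker b (fun xi => - a xi) z)%C.
Proof.
move=> m1 m2 ia ib ha hb.
have iNa : leb.-integrable setT (EFin \o (fun xi => - a xi)) by exact: (integrableN ia).
have ma := measurable_int ia; have mb := measurable_int ib.
have hab := @filterI _ _ (ae_filter_ringOfSetsType leb) _ _ ha hb.
have mcos : measurable_fun setT (fun xi : R => cos (z * xi)).
  by apply: (@continuous_measurable_fun R); under eq_fun do rewrite mulrC; exact: continuous_cosM.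
have msin : measurable_fun setT (fun xi : R => sin (z * xi)).
  by apply: (@continuous_measurable_fun R); under eq_fun do rewrite mulrC; exact: continuous_sinM.
rewrite /cint; congr (_ +i* _)%C; rewrite fkerE //.
  under eq_Rintegral do rewrite Re_mulc /= mulrC.
  apply: Rintegral_ae_eq.
  - under eq_fun do rewrite (mulrC _ z).
    by apply: measurable_funB; apply: measurable_funM => //.
  - by apply: measurable_funB; apply: measurable_funM.
  - by apply: ae_imp hab => xi [-> ->]; rewrite (mulrC xi z) (mulrC (cos _)).
under eq_Rintegral do rewrite Im_mulc /= addrC.
apply: Rintegral_ae_eq.
- under eq_fun do rewrite (mulrC _ z).
  by apply: measurable_funD; apply: measurable_funM => //.
- by apply: measurable_funB; apply: measurable_funM => //; exact: measurable_funN.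
- by apply: ae_imp hab => xi [-> ->]; rewrite (mulrC xi z) mulNr opprK.
Qed.

Variables (N : nat) (lam m : 'I_N -> R) (n : nat) (beta : R -> C) (B e : R).
Hypothesis lam_bound : forall k, - (Num.sqrt 2)^-1 < lam k < (Num.sqrt 2)^-1.
Hypothesis m_lt0 : forall k, m k < 0.
Hypotheses (B0 : 0 <= B) (e0 : 0 <= e).
Hypotheses
  (mp : cmeasurable setT (fun xi : R => beta (lambda_of xi)))
  (mm : cmeasurable setT (fun xi : R => beta (- lambda_of xi))).
Hypothesis bB : {ae leb, forall l : R, continuous_spectrum l ->
  Normc.normc ((l ^+ n.+2)%:C%C * beta l) <= B}.
Hypothesis be : {ae leb, forall l : R, continuous_spectrum l ->
  Normc.normc ((l ^+ n)%:C%C * beta l) <= e}.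

Local Notation nul := (nu lam).
Local Notation csy := (csym n beta B e).
Local Notation cutb := (cut n beta B e).

Lemma nu_sqr k : nul k ^+ 2 = 2^-1 - lam k ^+ 2 /\ 0 < nul k.
Proof.
have /andP[l1 l2] := lam_bound k.
have s0 : 0 < (Num.sqrt 2)^-1 :> R by rewrite invr_gt0 sqrtr_gt0.
have s2 : (Num.sqrt 2)^-1 ^+ 2 = 2^-1 :> R by rewrite exprVn sqr_sqrtr.
have h : 0 < 2^-1 - lam k ^+ 2.
  rewrite subr_gt0 -s2 -(real_normK (num_real (lam k))) ltrXn2r ?nnegrE ?(ltW s0) //.
  by rewrite ltr_norml l1.
by rewrite /nu sqr_sqrtr ?(ltW h) // sqrtr_gt0.
Qed.

(* The pair of Hankel kernels off the diagonal is sqrt 2 * (F1 - i F2') and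
   sqrt 2 * (F1 + i F2'). *)
Definition ksign (i : bool) : R := if i then -1 else 1.

(** The k-th exponential enters with - mu_k times the Hermitian matrix with unit diagonal and
    off-diagonal entries sqrt 2 (lambda_k + i nu_k) and its conjugate. *)
Definition wgt (i j r : bool) (k : 'I_N) : R :=
  if i == j then (if r then 0 else - m k)
  else if r then - ksign i * Num.sqrt 2 * (m k * nul k)
  else - Num.sqrt 2 * (m k * lam k).

(* Since |sqrt 2 (lambda_k + i nu_k)| = 1, the form is - mu_k times a sum of two
   squares. *)
Lemma wgt_psd k (y : bool * bool -> R) :
  0 <= \sum_i \sum_j realmx (fun r => wgt i.1 j.1 r k) i.2 j.2 * (y j * y i).
Proof.
rewrite !sum_bool2 /realmx /wgt /ksign /=.
have [nk _] := nu_sqr k.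
have s2 : Num.sqrt 2 ^+ 2 = 2 :> R by rewrite sqr_sqrtr.
set q := Num.sqrt 2 in s2 *.
set p0 := y (false, false); set p1 := y (false, true).
set p2 := y (true, false); set p3 := y (true, true).
set l := lam k in nk *; set v := nul k in nk *.
have cd : 1 - (q * l) ^+ 2 - (q * v) ^+ 2 = 0 by rewrite !exprMn s2 nk; field.
rewrite (_ : _ + _ = - m k * ((p0 + q * l * p2 - q * v * p3) ^+ 2 +
   (p1 + q * v * p2 + q * l * p3) ^+ 2) +
   - m k * (1 - (q * l) ^+ 2 - (q * v) ^+ 2) * (p2 ^+ 2 + p3 ^+ 2)); last by ring.
rewrite cd mulr0 mul0r addr0 mulr_ge0 ?addr_ge0 ?sqr_ge0 //.
by rewrite oppr_ge0 ltW.
Qed.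

Definition mker := cker nul csy wgt.
Definition Kmk := Kmx nul csy wgt.
(** The right-hand side of the Marchenko system is the first column of its kernel matrix. *)
Definition kbm (i : bool * bool) l z := mker i.1 false i.2 l z.

Let integrable_sym i j : leb.-integrable setT (EFin \o (csy i j).1) /\
  leb.-integrable setT (EFin \o (csy i j).2).
Proof.
have [m1 m2] := measurable_csym n B e mp mm i j.
have W0 : 0 <= 2 ^+ n.+2 * 8 * B by do 2!apply: mulr_ge0 => //; exact: exprn_ge0.
have := integrable_dsym W0 m1 m2 _ (leq0n n); apply.
by move=> xi; exact: csym_decay.
Qed.

Let sqrt2_neq0 : Num.sqrt 2 != 0 :> R.
Proof. by rewrite sqrtr_eq0 -ltNge. Qed.

(** c1 and xi c2 are the half sum and half difference of the two off-diagonal symbols, up to the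
    factor sqrt 2. *)
Lemma integrable_cut :
  [/\ leb.-integrable setT (EFin \o cutb (rc1 beta)),
      leb.-integrable setT (EFin \o cutb (ic1 beta)),
      leb.-integrable setT (EFin \o cutb (rc2 beta)) &
      leb.-integrable setT (EFin \o cutb (ic2 beta))] /\
  leb.-integrable setT (EFin \o (fun xi => xi * cutb (rc2 beta) xi)) /\
  leb.-integrable setT (EFin \o (fun xi => xi * cutb (ic2 beta) xi)).
Proof.
have [i1 j1] := integrable_sym false true; have [i2 j2] := integrable_sym true false.
have [i0 j0] := integrable_sym false false.
have s2 := sqrt2_neq0.
split; first split => //.
- have := integrableZl measurableT (2 * Num.sqrt 2)^-1 (integrableD measurableT i1 i2).
  by apply: eq_integrable => // xi _; rewrite /= /csym /=; congr EFin; field.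
- have := integrableZl measurableT (2 * Num.sqrt 2)^-1 (integrableD measurableT j1 j2).
  by apply: eq_integrable => // xi _; rewrite /= /csym /=; congr EFin; field.
split.
- have := integrableZl measurableT (2 * Num.sqrt 2)^-1 (integrableB measurableT i1 i2).
  by apply: eq_integrable => // xi _; rewrite /= /csym /=; congr EFin; field.
- have := integrableZl measurableT (2 * Num.sqrt 2)^-1 (integrableB measurableT j1 j2).
  by apply: eq_integrable => // xi _; rewrite /= /csym /=; congr EFin; field.
Qed.

Let cutE f : {ae leb, forall xi, cutb f xi = f xi}.
Proof. exact: ae_cut. Qed.

Lemma F2E z : F2 lam m beta z =
  (mker false false false 0 z +i* mker false false true 0 z)%C.
Proof.
have [[_ _ i3 i4] _] := integrable_cut; have [_ _ m3 m4] := measurable_c12 mp mm.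
have e22 := cint_fourier z m3 m4 i3 i4 (cutE _) (cutE _).
rewrite /F2 /F22 /F21 e22; apply: complex_eq; rewrite !reimE /= ?mul0r ?subr0 ?addr0 ?mulr0 ?addr0 ?oppr0 ?addr0.
  rewrite /mker /cker /ckerc /ckerd /symker /expsum /wgt /=; congr (_ + _).
  by rewrite -sumrN; apply: eq_bigr => k _; rewrite expr0 mul1r (mulNr (m k)).
rewrite /mker /cker /ckerc /ckerd /symker /expsum /wgt /=.
by rewrite [X in _ + X]big1 ?addr0 // => k _; rewrite mul0r.
Qed.

(** As c2 and xi c2 are integrable, F2 is differentiable in the classical sense, so the pointwise
    [derive1] inside [cderiv] are genuine derivatives. *)
Lemma cderiv_F2E z : cderiv (F2 lam m beta) z =
  (((2 * pi)^-1 * fker (fun xi => - (xi * cutb (ic2 beta) xi)) (fun xi => xi * cutb (rc2 beta) xi) z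
     + \sum_k m k * nul k * expk (nul k) z) +i*
   ((2 * pi)^-1 * fker (fun xi => xi * cutb (rc2 beta) xi) (fun xi => xi * cutb (ic2 beta) xi) z))%C.
Proof.
have [[_ _ i3 i4] [i5 i6]] := integrable_cut.
have iN3 : leb.-integrable setT (EFin \o (fun xi => - cutb (rc2 beta) xi)) by exact: (integrableN i3).
have iN5 : leb.-integrable setT (EFin \o (fun xi => xi * - cutb (rc2 beta) xi)).
  by have := integrableN i5; apply: eq_integrable => // xi _ /=; rewrite mulrN.
have d1 := is_derive_fker z i3 i4 i5 i6.
have d2 := is_derive_fker z i4 iN3 i6 iN5.
have ee : kfam 1 (expsum nul (wgt false false false)).
  by apply: kfam_expsum => k; case: (nu_sqr k).
have d3 := kfam_der ee z (ltnSn 0).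
rewrite /cderiv; congr (_ +i* _)%C.
  have -> : (fun t => Re (F2 lam m beta t)) =
      (fun t => (2 * pi)^-1 * fker (cutb (rc2 beta)) (cutb (ic2 beta)) t
                + expsum nul (wgt false false false) 0 t).
    by apply/funext => t; rewrite F2E.
  have [_ ed] := is_deriveD (is_deriveZ (2 * pi)^-1 d1) d3.
  rewrite derive1E; apply: etrans ed _; congr (_ + _).
  by apply: eq_bigr => k _; rewrite /wgt /= expr1; ring.
have -> : (fun t => Im (F2 lam m beta t)) =
    (fun t => (2 * pi)^-1 * fker (cutb (ic2 beta)) (fun xi => - cutb (rc2 beta) xi) t).
  apply/funext => t; rewrite F2E /= /mker /cker /ckerc /ckerd /symker /expsum /wgt /=.
  by rewrite [X in _ + X]big1 ?addr0 // => k _; rewrite mul0r.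
have [_ ed] := is_deriveZ (2 * pi)^-1 d2.
rewrite derive1E; apply: etrans ed _; rewrite /GRing.scale /=; congr (_ * fker _ _ z).
by apply/funext => xi; rewrite mulrN opprK.
Qed.

Lemma F1_F2E i z : (Num.sqrt 2)%:C%C * (F1 lam m beta z - (ksign i)%:C%C * 'i%C * cderiv (F2 lam m beta) z) =
  (mker i (~~ i) false 0 z +i* mker i (~~ i) true 0 z)%C.
Proof.
have [[i1 i2 i3 i4] [i5 i6]] := integrable_cut; have [m1 m2 m3 m4] := measurable_c12 mp mm.
have iN1 : leb.-integrable setT (EFin \o (fun xi => - cutb (rc1 beta) xi)) by exact: (integrableN i1).
have iN5 : leb.-integrable setT (EFin \o (fun xi => - (xi * cutb (rc2 beta) xi))).
  exact: (integrableN i5).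
have iN6 : leb.-integrable setT (EFin \o (fun xi => - (xi * cutb (ic2 beta) xi))).
  exact: (integrableN i6).
have e12 := cint_fourier z m1 m2 i1 i2 (cutE _) (cutE _).
have ni : (i == ~~ i) = false by case: (i).
rewrite /F1 /F12 /F11 e12 cderiv_F2E.
rewrite /mker /cker /ckerc /ckerd /symker /expsum /wgt /csym ni /= -/(ksign i).
set s := ksign i; set q := Num.sqrt 2; set g := (2 * pi)^-1.
have h1 := fker_lin q s z i1 i2 i5 i6.
have h2 := fker_lin q s z i2 iN1 i6 iN5.
apply: complex_eq; rewrite !reimE /=.
  rewrite h1.
  have -> : \sum_k - q * (m k * lam k) * ((- nul k) ^+ 0 * expk (nul k) z) =
     - q * \sum_k m k * lam k * expR (- nul k * z).
    by rewrite mulr_sumr; apply: eq_bigr => k _; rewrite expr0 /expk; ring.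
  by ring.
rewrite [X in _ = g * fker _ X z + _](_ : _ = (fun x =>
    q * (- cutb (rc1 beta) x + s * - (x * cutb (rc2 beta) x)))); last first.
  by apply/funext => x; rewrite -!mulrN; ring.
rewrite h2.
have -> : \sum_k - s * q * (m k * nul k) * ((- nul k) ^+ 0 * expk (nul k) z) =
   - s * q * \sum_k m k * nul k * expk (nul k) z.
  by rewrite mulr_sumr; apply: eq_bigr => k _; rewrite expr0; ring.
have -> : fker (fun xi => xi * cutb (ic2 beta) xi) (fun x => - (x * cutb (rc2 beta) x)) z =
    - fker (fun xi => - (xi * cutb (ic2 beta) xi)) (fun xi => xi * cutb (rc2 beta) xi) z.
  have := fkerZ (-1) z iN6 i5; rewrite mulN1r => <-.
  by congr (fker _ _ z); apply/funext => x; rewrite mulN1r ?opprK.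
by ring.
Qed.

End MarchenkoKernels.

(** * Sobolev norms *)
Section SobolevBySquareIntegrability.
Context {R : realType}.
Local Notation leb := (@lebesgue_measure R).
Local Notation L2R := (L2 leb).
Local Notation ipR := (ip2 (mu := leb)).
Local Notation snR := (sn ipR).
Local Notation C := R[i].
Local Notation Re := complex.Re.
Local Notation Im := complex.Im.
Implicit Types (f : R -> C) (a : R).

Lemma ae_shift (P : R -> Prop) a : {ae leb, forall y : R, P y} ->
  {ae leb, forall p : R, P (p + a)}.
Proof.
move=> h; have N0 : leb.-negligible [set y : R | ~ P y] by [].
have := @negligible_preimage_expanding R (fun p => p + a) setT 1 _ ler01 _ N0.
rewrite setTI; apply => x y _ _; rewrite mul1r le_eqVlt; apply/orP; left; apply/eqP.
by congr (`|_|); ring.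
Qed.

Lemma cLnorm2_sqr (D : set R) f : measurable D ->
  (cLnorm D 2%:E f `^ 2 = \int[leb]_(x in D) (Re (f x) ^+ 2 + Im (f x) ^+ 2)%:E)%E.
Proof.
move=> mD; rewrite /cLnorm unlock -poweRrM mulVf // poweRe1; last first.
  by apply: integral_ge0 => x _; exact: poweR_ge0.
rewrite [RHS]integral_mkcond; apply: eq_integral => x _; rewrite !patchE.
case: ifPn => _; last by rewrite abse0 poweR0r.
have n0 : 0 <= Normc.normc (f x) by case: (f x) => u v; exact: sqrtr_ge0.
by rewrite /= ger0_norm // powR_mulrn // normc_sqr.
Qed.

Lemma inLp2P (D : set R) f : measurable D -> cmeasurable D f ->
  (\int[leb]_(x in D) (Re (f x) ^+ 2 + Im (f x) ^+ 2)%:E < +oo)%E -> inLp D 2%:E f.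
Proof.
move=> mD mf; rewrite -cLnorm2_sqr // => h; split => //.
rewrite ltey; apply/eqP => e; move: h; rewrite e poweRyr ?ltxx //.
Qed.

Lemma integral_half_line (F : R -> \bar R) a : measurable_fun `]a, +oo[ F ->
  (\int[leb]_(x in `]a, +oo[) F x = \int[leb]_(p in `]0%R, +oo[) F (p + a)%R)%E.
Proof.
move=> mF; rewrite integral_mkcond -(integral_shift a); last first.
  by apply/(measurable_restrictT F (measurable_itv _)).
rewrite [RHS]integral_mkcond; apply: eq_integral => p _.
by rewrite !patchE !mem_setE !in_itv /= !andbT ltrDr.
Qed.

Lemma sqint_component a f : inLp `]a, +oo[ 2%:E f -> forall r : bool,
  trunc (fun p => if r then Im (f (p + a)) else Re (f (p + a))) \in sqint leb.
Proof.
move=> [[m1 m2] fy] r.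
have mI : measurable (`]a, +oo[%classic : set R) by exact: measurable_itv.
pose g x := if r then Im (f x) else Re (f x).
have mg : measurable_fun `]a, +oo[ g by rewrite /g; case: (r).
have mtg : measurable_fun setT (trunc (fun p => g (p + a))).
  have -> : trunc (fun p => g (p + a)) = (g \_ `]a, +oo[) \o (fun p => p + a).
    apply/funext => p; rewrite /= patchE mem_setE in_itv /= andbT ltrDr.
    by have [p0|p0] := leP p 0; [rewrite trunc_npos|rewrite trunc_pos].
  apply: measurableT_comp; last exact: measurable_shift.
  exact/(measurable_restrictT g mI).
apply/sqintP; split => //.
have e : nsq leb (trunc (fun p => g (p + a))) = (\int[leb]_(x in `]a, +oo[) ((g x) ^+ 2)%:E)%E.
  rewrite (integral_half_line (F := fun x => ((g x) ^+ 2)%:E)); last first.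
    by apply/measurable_EFinP; exact: measurable_funX.
  rewrite [RHS]integral_mkcond; apply: eq_integral => p _; rewrite patchE mem_setE in_itv /= andbT.
  by have [p0|p0] := leP p 0; [rewrite trunc_npos // expr0n|rewrite trunc_pos].
rewrite -[X in nsq leb X]/(trunc (fun p => g (p + a))) e.
apply: (@le_lt_trans _ _ (cLnorm `]a, +oo[ 2%:E f `^ 2)%E); last exact: poweR_lty.
rewrite cLnorm2_sqr //; apply: ge0_le_integral => //.
- by move=> x _; rewrite lee_fin sqr_ge0.
- by apply/measurable_EFinP; exact: measurable_funX.
- by apply/measurable_EFinP; apply: measurable_funD; exact: measurable_funX.
- by move=> x _; rewrite lee_fin /g; case: (r); rewrite ?lerDl ?lerDr sqr_ge0.
Qed.

Lemma integral_half_line_le a f (Q : bool -> L2R) :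
  (forall p, 0 < p -> Re (f (p + a)) = Q false p) ->
  (forall p, 0 < p -> Im (f (p + a)) = Q true p) ->
  cmeasurable `]a, +oo[ f /\
  (\int[leb]_(x in `]a, +oo[) (Re (f x) ^+ 2 + Im (f x) ^+ 2)%:E <=
    (snR (Q false) ^+ 2 + snR (Q true) ^+ 2)%:E)%E.
Proof.
move=> h1 h2.
have mI : measurable (`]a, +oo[%classic : set R) by exact: measurable_itv.
have mQ (q : L2R) (g : R -> R) : (forall p, 0 < p -> g (p + a) = q p) ->
    measurable_fun `]a, +oo[ g.
  move=> h; apply: (@eq_measurable_fun _ _ R R _ (fun x => q (x - a))).
    move=> x; rewrite inE /= in_itv /= andbT => ax.
    by rewrite -h ?subr_gt0 // subrK.
  apply: measurable_funTS; apply: measurableT_comp; last exact: measurable_shift.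
  exact: sqint_meas (L2P q).
have m1 := mQ _ (fun y => Re (f y)) h1; have m2 := mQ _ (fun y => Im (f y)) h2.
split; first by split.
rewrite integral_half_line; last first.
  by apply/measurable_EFinP; apply: measurable_funD; exact: measurable_funX.
rewrite EFinD -!nsq_sn /nsq -ge0_integralD //; last 4 first.
- by move=> x _; rewrite lee_fin sqr_ge0.
- exact: measurable_sqr (sqint_meas (L2P _)).
- by move=> x _; rewrite lee_fin sqr_ge0.
- exact: measurable_sqr (sqint_meas (L2P _)).
pose F p := (Re (f (p + a)) ^+ 2 + Im (f (p + a)) ^+ 2)%:E.
have mF : measurable_fun setT (F \_ `]0, +oo[).
  apply/(measurable_restrictT F (measurable_itv _)); apply/measurable_EFinP.
  apply: (@eq_measurable_fun _ _ R R _ (fun p => Q false p ^+ 2 + Q true p ^+ 2)).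
    move=> p; rewrite inE /= in_itv /= andbT => p0.
    by rewrite h1 // h2.
  apply: measurable_funTS; apply: measurable_funD; apply: measurable_funX; exact: sqint_meas (L2P _).
rewrite [X in (X <= _)%E]integral_mkcond; apply: ge0_le_integral => //.
- move=> x _; rewrite patchE; case: ifP => // _.
  by rewrite lee_fin addr_ge0 ?sqr_ge0.
- by apply: emeasurable_funD; exact: measurable_sqr (sqint_meas (L2P _)).
- move=> p _; rewrite patchE mem_setE in_itv /= andbT -EFinD.
  case: ifPn => [p0|_]; last by rewrite lee_fin addr_ge0 ?sqr_ge0.
  by rewrite h1 // h2.
Qed.

Lemma cint_test a f (phi : R -> R) :
  cint `]a, +oo[ (fun x => f x * (phi x)%:C%C) =
  (\int[leb]_(x in `]a, +oo[) (Re (f x) * phi x) +i*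
   \int[leb]_(x in `]a, +oo[) (Im (f x) * phi x))%C.
Proof.
rewrite /cint; congr (_ +i* _)%C; apply: eq_Rintegral => x _; rewrite !reimE /=.
  by rewrite mulr0 subr0.
by rewrite mulr0 add0r.
Qed.

Lemma weak_derivativeP a j f g :
  (forall r phi, test_function a phi ->
    \int[leb]_(x in `]a, +oo[) ((if r then Im (f x) else Re (f x)) * derive1n j phi x) =
    (- 1) ^+ j * \int[leb]_(x in `]a, +oo[) ((if r then Im (g x) else Re (g x)) * phi x)) ->
  weak_derivative a j f g.
Proof.
move=> h phi tp; rewrite !cint_test (h false phi tp) (h true phi tp).
have -> : (-1) ^+ j = ((-1) ^+ j)%:C%C :> C by rewrite rmorphXn /= rmorphN rmorph1.
by apply: complex_eq; rewrite !reimE /= mul0r ?subr0 ?addr0.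
Qed.

Section JetOfL2.
Variables (n : nat) (f : R -> C) (Q : nat -> bool -> L2R).
Hypothesis fQ : forall p, 0 < p -> Re (f p) = Q 0%N false p /\ Im (f p) = Q 0%N true p.
Hypothesis wQ : forall l r phi, (l <= n)%N -> test_function 0 phi ->
  \int[leb]_p (Q 0%N r p * derive1n l phi p) = (- 1) ^+ l * \int[leb]_p (Q l r p * phi p).

(** A weak jet must start with [f] itself, which agrees with [Q 0] only for p > 0. *)
Let g l : R -> C := if l is 0%N then f else fun p => (Q l false p +i* Q l true p)%C.

Let gQ l r p : 0 < p -> (if r then Im (g l p) else Re (g l p)) = Q l r p.
Proof.
case: l => [|l] p0 /=; last by case: r.
by have [h1 h2] := fQ p0; case: r.
Qed.

Let weak_jet_g : weak_jet n 0 f g.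
Proof.
split => // l ln; split.
  have [m b] := @integral_half_line_le 0 (g l) (Q l)
    (fun p p0 => etrans (congr1 (fun z => Re (g l z)) (addr0 p)) (gQ l false p0))
    (fun p p0 => etrans (congr1 (fun z => Im (g l z)) (addr0 p)) (gQ l true p0)).
  by apply: inLp2P => //; apply: le_lt_trans b (ltry _).
apply: weak_derivativeP => r phi tp.
have ex (j l' : nat) : \int[leb]_(x in `]0, +oo[)
      ((if r then Im (g l' x) else Re (g l' x)) * derive1n j phi x) =
    \int[leb]_x (Q l' r x * derive1n j phi x).
  have [_ [b [c [b0 bc]]]] := test_function_derive1n j tp.
  apply: esym; apply: Rintegral_half_line => p p0; first by rewrite gQ.
  have [->|/bc /andP[bp _]] := eqVneq (derive1n j phi p) 0; first by rewrite mulr0.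
  by have := lt_le_trans b0 (le_trans bp p0); rewrite ltxx.
by have := ex l 0%N; have := ex 0%N l; rewrite /= => -> ->; exact: wQ.
Qed.

Lemma in_sobolev_L2 : in_sobolev n 0 f.
Proof. by exists g. Qed.

(** The infimum is bounded by its value at the jet [g], at most the square root of 2 (n + 1) c^2;
    the stated constant is a simpler upper bound. *)
Lemma sobolev_norm_L2 (c : R) : 0 <= c ->
  (forall l r, (l <= n)%N -> snR (Q l r) <= c) ->
  (sobolev_norm n 0 f <= (2 * n.+1%:R * c)%:E)%E.
Proof.
move=> c0 hc.
apply: (@le_trans _ _ ((\sum_(j < n.+1) cLnorm `]0%R, +oo[ 2%:E (g j) `^ 2) `^ 2^-1)%E).
  by apply: ereal_inf_lbound; exists g.
have K0 : 0 <= 2 * n.+1%:R * c by rewrite !mulr_ge0.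
have -> : (2 * n.+1%:R * c)%:E = ((((2 * n.+1%:R * c) ^+ 2)%:E) `^ 2^-1)%E.
  by rewrite poweR_EFin powR12_sqrt ?sqr_ge0 // sqrtr_sqr ger0_norm.
apply: gt0_ler_poweR => //.
- rewrite in_itv /= leey andbT; apply: sume_ge0 => j _; exact: poweR_ge0.
- by rewrite in_itv /= leey andbT lee_fin sqr_ge0.
apply: (@le_trans _ _ (\sum_(j < n.+1) (2 * c ^+ 2)%:E)%E).
  apply: lee_sum => j _; rewrite cLnorm2_sqr; last exact: measurable_itv.
  have [_ b] := @integral_half_line_le 0 (g j) (Q j)
    (fun p p0 => etrans (congr1 (fun z => Re (g j z)) (addr0 p)) (gQ j false p0))
    (fun p p0 => etrans (congr1 (fun z => Im (g j z)) (addr0 p)) (gQ j true p0)).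
  apply: le_trans b _; rewrite lee_fin.
  have jn : (j <= n)%N by rewrite -ltnS.
  have s r : snR (Q j r) ^+ 2 <= c ^+ 2 by rewrite lerXn2r ?nnegrE ?sn_ge0 // hc.
  by have := s false; have := s true; lra.
rewrite sumEFin lee_fin sumr_const card_ord -(mulr_natl (2 * c ^+ 2)).
have n1 : 1 <= n.+1%:R :> R by rewrite ler1n.
move: (n.+1%:R : R) n1 => M M1.
have c2 := sqr_ge0 c.
rewrite (_ : (2 * M * c) ^+ 2 = M * (4 * M * c ^+ 2)); last by ring.
rewrite ler_wpM2l ?ler_wpM2r //; lra.
Qed.

End JetOfL2.

Lemma sobolev_norm_ge0 n a f : (0 <= sobolev_norm n a f)%E.
Proof. by apply: le_ereal_inf_tmp => _ [g _ <-]; exact: poweR_ge0. Qed.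

End SobolevBySquareIntegrability.

(** * Pairs of complex functions as four real components *)

Section SobolevPairs.
Context {R : realType}.
Local Notation leb := (@lebesgue_measure R).
Local Notation L2R := (L2 leb).
Local Notation ipR := (ip2 (mu := leb)).
Local Notation snR := (sn ipR).
Local Notation C := R[i].
Local Notation Re := complex.Re.
Local Notation Im := complex.Im.
Local Notation I := (bool * bool)%type.

Definition compv (F : R -> C * C) (i : I) (y : R) : R :=
  let z := if i.1 then (F y).2 else (F y).1 in if i.2 then Im z else Re z.

Definition of_comp (w : I -> R -> R) (y : R) : C * C :=
  ((w (false, false) y +i* w (false, true) y)%C, (w (true, false) y +i* w (true, true) y)%C).

Lemma of_compK w i y : compv (of_comp w) i y = w i y.
Proof. by case: i => [] [] []. Qed.

Lemma compv_inj F G y : (forall i, compv F i y = compv G i y) -> F y = G y.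
Proof.
rewrite /compv => h; rewrite [F y]surjective_pairing [G y]surjective_pairing.
congr (_, _); apply: complex_eq.
- exact: (h (false, false)).
- exact: (h (false, true)).
- exact: (h (true, false)).
- exact: (h (true, true)).
Qed.

Section Pair.
Variables (n : nat) (F : R -> C * C) (Q : nat -> I -> L2R).
Hypothesis FQ : forall i p, 0 < p -> compv F i p = Q 0%N i p.
Hypothesis wQ : forall l i phi, (l <= n)%N -> test_function 0 phi ->
  \int[leb]_p (Q 0%N i p * derive1n l phi p) = (- 1) ^+ l * \int[leb]_p (Q l i p * phi p).

Let F1 p (p0 : 0 < p) := conj (FQ (false, false) p0) (FQ (false, true) p0).
Let F2 p (p0 : 0 < p) := conj (FQ (true, false) p0) (FQ (true, true) p0).

Lemma in_sobolev2_L2 : in_sobolev2 n 0 F.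
Proof.
split.
  apply: (in_sobolev_L2 (f := fun p => (F p).1) (Q := fun l r => Q l (false, r))) => //.
  by move=> l r phi; exact: wQ.
apply: (in_sobolev_L2 (f := fun p => (F p).2) (Q := fun l r => Q l (true, r))) => //.
by move=> l r phi; exact: wQ.
Qed.

Lemma sobolev2_norm_L2 (c : R) : 0 <= c ->
  (forall l i, (l <= n)%N -> snR (Q l i) <= c) ->
  (sobolev2_norm n 0 F <= (4 * n.+1%:R * c)%:E)%E.
Proof.
move=> c0 h.
have h1 := sobolev_norm_L2 (f := fun p => (F p).1) (Q := fun l r => Q l (false, r))
  F1 (fun l r => @wQ l (false, r)) c0 (fun l r => h l (false, r)).
have h2 := sobolev_norm_L2 (f := fun p => (F p).2) (Q := fun l r => Q l (true, r))
  F2 (fun l r => @wQ l (true, r)) c0 (fun l r => h l (true, r)).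
apply: le_trans (leeD h1 h2) _; rewrite -EFinD lee_fin.
by rewrite le_eqVlt; apply/orP; left; apply/eqP; ring.
Qed.

End Pair.

Lemma cvge0_linear (f : R -> \bar R) (K : R) : (forall h, 0 <= f h)%E ->
  (forall h, h != 0 -> `|h| <= 1 -> (f h <= (K * `|h|)%:E)%E) ->
  f h @[h --> (0 : R)^'] --> 0%E.
Proof.
move=> f0 fK.
apply: (@squeeze_cvge _ _ _ _ (fun=> 0%E) _ (fun h => (K * `|h|)%:E)).
- near=> h; rewrite f0 fK //; near: h; first exact: nbhs_dnbhs_neq.
  exact: dnbhs0_le.
- exact: cvg_cst.
- apply: cvg_EFin; first exact: nearW.
  have : K * `|h| @[h --> (0 : R)^'] --> K * `|0 : R|.
    apply: cvgM; first exact: cvg_cst.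
    by apply: cvg_norm; apply: cvg_within_filter; exact: cvg_id.
  by rewrite normr0 mulr0.
Unshelve. all: by end_near. Qed.

End SobolevPairs.

(** * Existence, uniqueness and smoothness for the Marchenko system *)

Section MarchenkoSystem.
Context {R : realType}.
Local Notation leb := (@lebesgue_measure R).
Local Notation L2R := (L2 leb).
Local Notation ipR := (ip2 (mu := leb)).
Local Notation snR := (sn ipR).
Local Notation C := R[i].
Local Notation Re := complex.Re.
Local Notation Im := complex.Im.
Local Notation I := (bool * bool)%type.
Local Notation X := (I -> L2R).
Local Notation ipX := (ipv ipR (I := I)).
Local Notation snX := (sn ipX).

Let Hip := semi_inner_ip2 leb.
Let HX : semi_inner ipX := semi_inner_ipv I Hip.

Variables (N : nat) (lam m : 'I_N -> R) (n : nat) (beta : R -> C) (B e : R).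
Hypothesis lam_bound : forall k, - (Num.sqrt 2)^-1 < lam k < (Num.sqrt 2)^-1.
Hypothesis m_lt0 : forall k, m k < 0.
Hypotheses (B0 : 0 <= B) (e0 : 0 <= e) (e_small : e <= (2 ^+ (n + 9))^-1).
Hypotheses
  (mp : cmeasurable setT (fun xi : R => beta (lambda_of xi)))
  (mm : cmeasurable setT (fun xi : R => beta (- lambda_of xi))).
Hypothesis bB : {ae leb, forall l : R, continuous_spectrum l ->
  Normc.normc ((l ^+ n.+2)%:C%C * beta l) <= B}.
Hypothesis be : {ae leb, forall l : R, continuous_spectrum l ->
  Normc.normc ((l ^+ n)%:C%C * beta l) <= e}.

Local Notation K := (Kmk lam m n beta B e).
Local Notation kb := (kbm lam m n beta B e).
Local Notation mk := (mker lam m n beta B e).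

Let b : R := 2 * Num.sqrt 2.
(** The continuous part has norm at most 64 * 2^(-6) = 1, which leaves 2 sqrt 2 - 1 for the
    coercivity. *)
Let a0 : R := b - 64 * (2 ^+ 6)^-1.

Let b_gt0 : 0 < b. Proof. by rewrite mulr_gt0 // sqrtr_gt0. Qed.

Let a0_gt0 : 0 < a0.
Proof.
have -> : a0 = b - 1.
  rewrite /a0; congr (_ - _); rewrite (_ : 64 = 2 ^+ 6 :> R) ?divff //.
  by rewrite -natrX.
rewrite subr_gt0 /b; have : 1 <= Num.sqrt 2 :> R.
  by rewrite -[X in X <= _]sqrtr1 ler_wsqrtr // ler1n.
lra.
Qed.

Let nu0 k : 0 < nu lam k. Proof. by case: (nu_sqr lam_bound k). Qed.

Let W0 : 0 <= 2 ^+ n.+2 * 8 * B.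
Proof. by do 2!apply: mulr_ge0 => //; exact: exprn_ge0. Qed.

Let KK i j : kfam n (K i j).
Proof.
apply: (kfam_Kmx _ nu0 W0) => [i' j'|i' j' xi]; first exact: measurable_csym.
exact: csym_decay.
Qed.

Let Hkb i : kfam n (kb i).
Proof.
apply: (kfam_cker _ nu0 W0) => [i' j'|i' j' xi]; first exact: measurable_csym.
exact: csym_decay.
Qed.

Let coer x (u : X) : a0 * ipX u u <= ipX (b *: u + Top K 0 x u) u.
Proof.
apply: (Kmx_coercive nu0 W0) => //.
- by move=> i j; exact: measurable_csym.
- by move=> i j xi; exact: csym_decay.
- by move=> i j xi; exact: csym_small.
- by move=> k y; exact: wgt_psd.
Qed.

(** Real and imaginary parts of the two equations, with sqrt 2 absorbed into the off-diagonal
    kernels. The sum stays inside the integral; the two are exchanged later, where integrability is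
    known. *)
Lemma marchenko_eqsE x (Psi : R -> C * C) y :
  (marchenko_eq1 lam m beta x Psi y /\ marchenko_eq2 lam m beta x Psi y) <->
  (forall i, b * compv Psi i y = kb i 0%N (x + y) -
    \int[leb]_(s in `]x, +oo[) (\sum_j K i j 0%N (s + y) * compv Psi j s)).
Proof.
pose kz i j z : C := (mk i j false 0%N z +i* mk i j true 0%N z)%C.
have eF2 z : F2 lam m beta z = kz false false z by exact: F2E.
have e01 z : (Num.sqrt 2)%:C%C * (F1 lam m beta z - 'i%C * cderiv (F2 lam m beta) z) =
    kz false true z.
  have := @F1_F2E _ _ _ m _ _ _ _ lam_bound B0 e0 mp mm bB be false z.
  by rewrite /ksign rmorph1 mul1r.
have e10 z : (Num.sqrt 2)%:C%C * (F1 lam m beta z + 'i%C * cderiv (F2 lam m beta) z) =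
    kz true false z.
  have := @F1_F2E _ _ _ m _ _ _ _ lam_bound B0 e0 mp mm bB be true z.
  by rewrite /ksign rmorphN rmorph1 mulN1r mulNr opprK.
have e11 z : F2 lam m beta z = kz true true z by exact: F2E.
have cE (D : set R) (h : R -> C) (z w : C) : ((2 * Num.sqrt 2)%:C%C * z = w - cint D h) <->
    (b * Re z = Re w - \int[leb]_(s in D) Re (h s) /\
     b * Im z = Im w - \int[leb]_(s in D) Im (h s)).
  split=> [/(congr1 (fun z => (Re z, Im z)))[]|[h1 h2]].
    by rewrite !reimE /= !mul0r subr0 addr0 /b.
  by apply: complex_eq; rewrite !reimE /= !mul0r ?subr0 ?addr0 -/b.
have E1 : marchenko_eq1 lam m beta x Psi y <->
    (2 * Num.sqrt 2)%:C%C * (Psi y).1 = kz false false (x + y) -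
      cint `]x, +oo[ (fun s => (Psi s).2 * kz false true (s + y) + (Psi s).1 * kz false false (s + y)).
  rewrite /marchenko_eq1 eF2.
  suff -> : (fun s => (Num.sqrt 2)%:C%C * (Psi s).2 *
        (F1 lam m beta (s + y) - 'i%C * cderiv (F2 lam m beta) (s + y)) +
      (Psi s).1 * F2 lam m beta (s + y)) =
      (fun s => (Psi s).2 * kz false true (s + y) + (Psi s).1 * kz false false (s + y)) by exact: iff_refl.
  by apply/funext => s; rewrite -e01 -eF2 mulrA (mulrC (Psi s).2).
have E2 : marchenko_eq2 lam m beta x Psi y <->
    (2 * Num.sqrt 2)%:C%C * (Psi y).2 = kz true false (x + y) -
      cint `]x, +oo[ (fun s => (Psi s).1 * kz true false (s + y) + (Psi s).2 * kz true true (s + y)).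
  rewrite /marchenko_eq2 e10.
  suff -> : (fun s => (Num.sqrt 2)%:C%C * (Psi s).1 *
        (F1 lam m beta (s + y) + 'i%C * cderiv (F2 lam m beta) (s + y)) +
      (Psi s).2 * F2 lam m beta (s + y)) =
      (fun s => (Psi s).1 * kz true false (s + y) + (Psi s).2 * kz true true (s + y)) by exact: iff_refl.
  by apply/funext => s; rewrite -e10 -e11 mulrA (mulrC (Psi s).1).
rewrite E1 E2 !cE.
have KE i j z : K i j 0%N z = realmx (fun r => mk i.1 j.1 r 0%N z) i.2 j.2 by [].
have S i : \int[leb]_(s in `]x, +oo[) (\sum_j K i j 0%N (s + y) * compv Psi j s) =
    \int[leb]_(s in `]x, +oo[)
      let h := (Psi s).1 * kz i.1 false (s + y) + (Psi s).2 * kz i.1 true (s + y) in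
      (if i.2 then Im h else Re h).
  apply: eq_Rintegral => s _; rewrite sum_bool2 !KE /realmx /compv /=.
  by case: i => [i1 []] /=; rewrite !reimE /=; ring.
have H1 s : (Psi s).2 * kz false true (s + y) + (Psi s).1 * kz false false (s + y) =
   (Psi s).1 * kz false false (s + y) + (Psi s).2 * kz false true (s + y) by rewrite addrC.
under [X in (_ = _ - X /\ _) /\ _]eq_Rintegral do rewrite H1.
under [X in (_ /\ _ = _ - X) /\ _]eq_Rintegral do rewrite H1.
split.
  move=> [[h1 h2] [h3 h4]] [[] []]; rewrite S /compv /=.
  - exact: h4.
  - exact: h3.
  - exact: h2.
  - exact: h1.
move=> h; have h1 := h (false, false); have h2 := h (false, true).
have h3 := h (true, false); have h4 := h (true, true).
by rewrite !S in h1 h2 h3 h4.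
Qed.

Lemma measurable_kfam k (l : nat) (z : R) : kfam n k -> (l <= n)%N ->
  measurable_fun setT (fun s => k l (z + s)).
Proof.
move=> kk ln; apply: measurableT_comp; last by apply: measurable_funD.
by apply: continuous_measurable_fun; exact: kfam_cont kk l ln.
Qed.

(** With s = x + q and y = x + p, the argument s + y becomes 2 x + q + p; for p > 0 each term of the
    sum is integrable. *)
Lemma Rintegral_hankel_sum x (Psi : R -> C * C) (U : X) p : 0 < p ->
  (forall i p, 0 < p -> U i p = compv Psi i (p + x)) -> forall i,
  \int[leb]_(s in `]x, +oo[) (\sum_j K i j 0%N (s + (p + x)) * compv Psi j s) =
  \sum_j hankel (fun z => K i j 0%N (2 * x + z)) (trunc (U j)) p.
Proof.
move=> p0 hU i.
pose H s := \sum_j K i j 0%N (2 * x + (s + p)) * trunc (U j) s.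
have mH : measurable_fun setT H.
  apply: measurable_sum => j; apply: measurable_funM.
    apply: (measurableT_comp (measurable_kfam (2 * x) (KK i j) (leq0n n))).
    exact: measurable_shift.
  exact: measurable_trunc (sqint_meas (L2P _)).
have intH j : leb.-integrable setT (EFin \o (fun s => K i j 0%N (2 * x + (s + p)) * trunc (U j) s)).
  have [M [M0 hM]] := kfam_hank (KK i j) (2 * x) (leq0n n).
  exact: (hank_integrable (ltW p0) hM (L2P (U j))).
transitivity (\int[leb]_s H s); last first.
  have eH : (\int[leb]_s (H s)%:E =
      \sum_j (hankel (fun z => K i j 0%N (2 * x + z)) (trunc (U j)) p)%:E)%E.
    under eq_integral do rewrite /H -sumEFin.
    rewrite integral_sum //; apply: eq_bigr => j _.
    by rewrite /hankel /Rintegral fineK //; exact: (integrable_fin_num measurableT (intH j)).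
  by rewrite /Rintegral eH sumEFin.
rewrite Rintegral_mkcond /Rintegral; congr fine.
rewrite -(integral_shift (f := EFin \o H) (- x)); last exact/measurable_EFinP.
apply: eq_integral => s _; rewrite patchE mem_setE in_itv /= andbT; congr EFin.
rewrite /H; case: ifPn => [xs|]; last first.
  rewrite -leNgt => sx; rewrite big1 // => j _.
  by rewrite trunc_npos ?mulr0 // subr_le0.
apply: eq_bigr => j _; rewrite trunc_pos ?subr_gt0 // hU ?subr_gt0 // subrK.
by congr (K i j 0%N _ * _); ring.
Qed.

Lemma marchenko_eqs_shift x (Psi : R -> C * C) (U : X) p : 0 < p ->
  (forall i p, 0 < p -> U i p = compv Psi i (p + x)) ->
  (marchenko_eq1 lam m beta x Psi (p + x) /\ marchenko_eq2 lam m beta x Psi (p + x)) <->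
  (forall i, b * U i p + \sum_j hankel (fun z => K i j 0%N (2 * x + z)) (trunc (U j)) p =
     kb i 0%N (2 * x + p)).
Proof.
move=> p0 hU; rewrite marchenko_eqsE.
have xx : x + (p + x) = 2 * x + p by ring.
split=> h i; have := h i; rewrite (Rintegral_hankel_sum p0 hU) xx hU //.
  by move=> ->; rewrite subrK.
by move=> <-; rewrite addrK.
Qed.

Local Notation solv := (solves K kb b).

(** Translation to p = y - x followed by truncation turns any solution into a vector of L^2, where
    uniqueness is decided by coercivity. *)
Lemma solution_vector x Psi : marchenko_solution lam m beta n x Psi ->
  exists U : X, [/\ forall i p, 0 < p -> U i p = compv Psi i (p + x),
    forall i p, p <= 0 -> U i p = 0 & solv x U].
Proof.
move=> [[[g1 [g10 h1]] [g2 [g20 h2]]] eqs].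
have [i1 _] := h1 0%N (leq0n n); have [i2 _] := h2 0%N (leq0n n).
rewrite g10 in i1; rewrite g20 in i2.
have sq i : trunc (fun p => compv Psi i (p + x)) \in sqint leb.
  by case: i => [[] r]; [have := sqint_component i2 r|have := sqint_component i1 r].
pose U : X := fun i => MkL2 (sq i).
have U1 i p : 0 < p -> U i p = compv Psi i (p + x) by exact: trunc_pos.
have U2 i p : p <= 0 -> U i p = 0 by exact: trunc_npos.
exists U; split => //; apply: (solvesP KK Hkb b_gt0) => // i.
apply: ae_imp (ae_shift x eqs) => p h p0.
have /(marchenko_eqs_shift p0 U1) : marchenko_eq1 lam m beta x Psi (p + x) /\
  marchenko_eq2 lam m beta x Psi (p + x) by apply: h; rewrite ltrDr.
exact.
Qed.

Lemma marchenko_unique x Phi Psi : marchenko_solution lam m beta n x Phi ->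
  marchenko_solution lam m beta n x Psi ->
  {ae leb, forall y : R, x < y -> Phi y = Psi y}.
Proof.
move=> /solution_vector[U [U1 U2 sU]] /solution_vector[V [V1 V2 sV]].
have h i := solves_unique KK a0_gt0 coer sU sV i.
have : {ae leb, forall p : R, forall i, U i p = V i p}.
  have c4 : {ae leb, forall p : R, (U (false, false) p = V (false, false) p /\
      U (false, true) p = V (false, true) p) /\
      (U (true, false) p = V (true, false) p /\ U (true, true) p = V (true, true) p)}.
    by do 2![apply: (@filterI _ _ (ae_filter_ringOfSetsType leb))]; exact: h.
  by apply: ae_imp c4 => p [[q1 q2] [q3 q4]] [[] []].
move=> /(ae_shift (- x)); apply: ae_imp => y hy xy.
apply: compv_inj => i; have y0 : 0 < y - x by rewrite subr_gt0.
by have := hy i; rewrite U1 // V1 // subrK.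
Qed.

(** An L^2 solution [v] is replaced by the function that the equation itself assigns to it. This
    representative has n classical derivatives and satisfies the system at every y > x. *)
Lemma marchenko_exists x : exists Psi, marchenko_solution lam m beta n x Psi.
Proof.
have [v sv] := solves_exists kb KK a0_gt0 coer x.
pose w l i y := wfun K kb b l x v i (y - x).
pose Psi := of_comp (w 0%N).
pose U := jet K kb b 0 x v.
have U1 i p : 0 < p -> U i p = compv Psi i (p + x).
  by move=> p0; rewrite /U (jet_pos KK Hkb) // of_compK /w addrK.
exists Psi; split; last first.
  apply: aeW => y xy; have y0 : 0 < y - x by rewrite subr_gt0.
  rewrite -[y](subrK x); apply/(marchenko_eqs_shift y0 U1) => i.
  rewrite /U (jet_pos KK Hkb) // -/(w 0%N i y).
  (* [v] and its jet differ on a null set, which the Hankel integrals do not see. *)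
  have eh j : hankel (fun z => K i j 0%N (2 * x + z)) (trunc (jet K kb b 0 x v j)) (y - x) =
      hankel (fun z => K i j 0%N (2 * x + z)) (trunc (v j)) (y - x).
    have mk0 : measurable_fun setT (fun s : R => K i j 0%N (2 * x + (s + (y - x)))).
      apply: (measurableT_comp (measurable_kfam (2 * x) (KK i j) (leq0n n))).
      exact: measurable_shift.
    apply: Rintegral_ae_eq.
    - by apply: measurable_funM => //; exact: measurable_trunc (sqint_meas (L2P _)).
    - by apply: measurable_funM => //; exact: measurable_trunc (sqint_meas (L2P _)).
    - have := solves_jet b_gt0 sv j; apply: ae_imp => s hs.
      by rewrite /trunc hs.
  under eq_bigr do rewrite eh.
  by rewrite /w /wfun mulrA divff ?gt_eqF // mul1r subrK.
have wder l i (y : R) : (l < n)%N -> is_derive y 1 (w l i) (w l.+1 i y).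
  move=> ln; have d0 : is_derive y 1 (fun y : R => y - x) 1.
    by have := is_deriveD (is_derive_id y 1) (is_derive_cst (- x) y 1); rewrite addr0.
  have := @is_derive1_comp _ (wfun K kb b l x v i) (fun y : R => y - x) y _ _
    (wfun_is_derive KK Hkb b x v i (y - x) ln) d0.
  by rewrite mulr1.
have wcont l i : (l <= n)%N -> continuous (w l i).
  move=> ln y; apply: (@continuous_comp _ _ _ (fun y : R => y - x) (wfun K kb b l x v i)).
    by apply: cvgB; [exact: cvg_id|exact: cvg_cst].
  exact: wfun_continuous.
have sob (a : bool) : in_sobolev n x (fun y => (w 0%N (a, false) y +i* w 0%N (a, true) y)%C).
  exists (fun l y => (w l (a, false) y +i* w l (a, true) y)%C); split => // l ln; split.
    have [mw bw] := @integral_half_line_le _ x (fun y => (w l (a, false) y +i* w l (a, true) y)%C)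
      (fun r => jet K kb b l x v (a, r))
      (fun p p0 => etrans (congr1 (wfun K kb b l x v (a, false)) (addrK x p)) (esym (jet_pos KK Hkb b x v (a, false) ln p0)))
      (fun p p0 => etrans (congr1 (wfun K kb b l x v (a, true)) (addrK x p)) (esym (jet_pos KK Hkb b x v (a, true) ln p0))).
    by apply: inLp2P => //; apply: le_lt_trans bw (ltry _).
  apply: weak_derivativeP => r phi tp.
  have := @Rintegral_weak_chain _ x (fun l => w l (a, r)) n
    (fun l y ln _ => wder l (a, r) y ln) (fun l y ln _ => wcont l (a, r) ln y) l phi ln tp.
  by case: r.
by split; [exact: (sob false)|exact: (sob true)].
Qed.

Lemma marchenko_smooth (Psi : R -> R -> C * C) :
  (forall x, marchenko_solution lam m beta n x (Psi x)) ->
  forall k, (k < n)%N -> Ck_sobolev2 k (n - k) (fun x p => Psi x (x + p)).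
Proof.
move=> sol k kn; have kn' := ltnW kn.
have [V hV] := choice (fun x => solution_vector (sol x)).
have sV x : solv x (V x) by have [] := hV x.
have [W [W00 Wr1 Wr0 Wweak]] := solves_smooth KK Hkb a0_gt0 b_gt0 coer sV kn'.
have lk l : (l <= n - k)%N -> (l + k <= n)%N by move=> h; rewrite -(subnK kn') leq_add2r.
(* Order 0 must be the given [Psi], known only to agree with [W] for p > 0; the derivatives in x are
   taken from [W]. *)
pose v j x p := if j is 0%N then Psi x (x + p) else of_comp (W 0%N j x) p.
have vW j x i p : 0 < p -> compv (v j x) i p = W 0%N j x i p.
  case: j => [|j] p0; last exact: of_compK.
  by have [h _ _] := hV x; rewrite W00 h // /v /compv addrC.
have ipW l j x i phi (tp : test_function 0 phi) : (l <= n - k)%N -> (j <= k)%N ->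
    ipR (W 0%N j x i) (MkL2 (test_sqint (test_function_derive1n l tp))) =
    (- 1) ^+ l * ipR (W l j x i) (MkL2 (test_sqint tp)).
  by move=> ln jk; exact: Wweak (lk l ln) jk tp.
have r1le j x l i : (j < k)%N -> (l <= n - k)%N -> exists C, 0 <= C /\
    forall h, h != 0 -> `|h| <= 1 ->
    snR (h^-1 *: (W l j (x + h) i - W l j x i) - W l j.+1 x i) <= C * `|h|.
  move=> jk ln; have [C [C0 hC]] := Wr1 l j (lk l ln) jk x.
  exists C; split => // h h0 h1.
  have -> : h^-1 *: (W l j (x + h) i - W l j x i) - W l j.+1 x i =
      h^-1 *: (W l j (x + h) i - W l j x i - h *: W l j.+1 x i).
    by rewrite [RHS]scalerBr scalerA mulVf // scale1r.
  rewrite (snZ Hip) normfV ler_pdivrMl ?normr_gt0 // mulrCA -expr2.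
  apply: le_trans (hC h h1).
  exact: (sn_comp_le Hip (W l j (x + h) - W l j x - h *: W l j.+1 x)).
exists v; split => //.
- move=> j x jk; apply: (in_sobolev2_L2 (Q := fun l => W l j x)).
    by move=> i p; exact: vW.
  by move=> l i phi ln tp; apply: Wweak => //; exact: lk.
- move=> j x jk.
  (* The quotients of [W l j] form a weak jet of the quotient of [v j], as the weak identities are
     linear. A single constant [S] over all orders [l] and components then bounds the Sobolev norm
     by a multiple of |h|. *)
  have /choice2[D hD] (l : nat) i : exists C, (l <= n - k)%N -> 0 <= C /\
      forall h, h != 0 -> `|h| <= 1 ->
      snR (h^-1 *: (W l j (x + h) i - W l j x i) - W l j.+1 x i) <= C * `|h|.
    have [ln|_] := boolP (l <= n - k)%N; last by exists 0.
    by have [C hC] := r1le j x l i jk ln; exists C.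
  pose S := \sum_(l < (n - k).+1) \sum_i `|D l i|.
  have S0 : 0 <= S by apply: sumr_ge0 => l _; exact: sumr_ge0.
  have DS l i : (l <= n - k)%N -> D l i <= S.
    move=> ln; have ln' : (l < (n - k).+1)%N by rewrite ltnS.
    apply: le_trans (ler_norm _) _; rewrite /S (bigD1 (Ordinal ln')) //= (bigD1 i) //=.
    rewrite -addrA lerDl addr_ge0 //; first exact: sumr_ge0.
    by apply: sumr_ge0 => t _; exact: sumr_ge0.
  apply: (@cvge0_linear _ _ (4 * (n - k).+1%:R * S)).
    by move=> h; rewrite adde_ge0 // sobolev_norm_ge0.
  move=> h h0 h1; rewrite -(mulrA _ S).
  apply: (sobolev2_norm_L2
    (Q := fun l i => h^-1 *: (W l j (x + h) i - W l j x i) - W l j.+1 x i)).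
  + move=> i p p0; have := vW j (x + h) i p p0; have := vW j x i p p0.
    have := vW j.+1 x i p p0; rewrite !L2D !L2N !L2Z !L2D !L2N => <- <- <-.
    by rewrite /compv; case: i => [[] []] /=; rewrite !reimE /= ?mul0r ?subr0 ?addr0.
  + move=> l i phi ln tp.
    suff : ipR (h^-1 *: (W 0%N j (x + h) i - W 0%N j x i) - W 0%N j.+1 x i)
          (MkL2 (test_sqint (test_function_derive1n l tp))) =
        (-1) ^+ l * ipR (h^-1 *: (W l j (x + h) i - W l j x i) - W l j.+1 x i)
          (MkL2 (test_sqint tp)) by [].
    rewrite !(ipDl Hip, ipNl Hip, ipZl Hip) !ipW // ?(ltnW jk) //; ring.
  + by rewrite mulr_ge0.
  + move=> l i ln; have [D0 hl] := hD l i ln.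
    by apply: le_trans (hl h h0 h1) _; rewrite ler_wpM2r // DS.
- move=> x.
  have /choice[D hD] (l : nat) : exists C, (l <= n - k)%N -> 0 <= C /\
      forall h, `|h| <= 1 -> snX (W l k (x + h) - W l k x) <= C * `|h|.
    have [ln|_] := boolP (l <= n - k)%N; last by exists 0.
    by have [C hC] := Wr0 l (lk l ln) x; exists C.
  pose S := \sum_(l < (n - k).+1) `|D l|.
  have S0 : 0 <= S by apply: sumr_ge0.
  have DS l : (l <= n - k)%N -> D l <= S.
    move=> ln; have ln' : (l < (n - k).+1)%N by rewrite ltnS.
    apply: le_trans (ler_norm _) _; rewrite /S (bigD1 (Ordinal ln')) //=.
    by rewrite lerDl sumr_ge0.
  apply: (@cvge0_linear _ _ (4 * (n - k).+1%:R * S)).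
    by move=> h; rewrite adde_ge0 // sobolev_norm_ge0.
  move=> h h0 h1; rewrite -(mulrA _ S).
  apply: (sobolev2_norm_L2 (Q := fun l i => W l k (x + h) i - W l k x i)).
  + move=> i p p0; have := vW k (x + h) i p p0; have := vW k x i p p0.
    rewrite !L2D !L2N => <- <-.
    by rewrite /compv; case: i => [[] []] /=; rewrite !reimE.
  + move=> l i phi ln tp.
    suff : ipR (W 0%N k (x + h) i - W 0%N k x i)
          (MkL2 (test_sqint (test_function_derive1n l tp))) =
        (-1) ^+ l * ipR (W l k (x + h) i - W l k x i) (MkL2 (test_sqint tp)) by [].
    rewrite !(ipDl Hip, ipNl Hip) !ipW //; ring.
  + by rewrite mulr_ge0.
  + move=> l i ln; have [D0 hl] := hD l ln.
    apply: le_trans (sn_comp_le Hip (W l k (x + h) - W l k x) i) _.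
    by apply: le_trans (hl h h1) _; rewrite ler_wpM2r // DS.
Qed.

End MarchenkoSystem.

Local Open Scope complex_scope.
Theorem proposition1p2 (R : realType) (N : nat) (lam mu : 'I_N -> R) (n : nat)
    (N_gt0 : (0 < N)%N)
    (lam_bound : forall k : 'I_N, - (Num.sqrt 2)^-1 < lam k < (Num.sqrt 2)^-1)
    (lam_incr : forall j k : 'I_N, (j < k)%N -> lam j < lam k)
    (mu_lt0 : forall k : 'I_N, mu k < 0) :
  exists eps0 : R, 0 < eps0 /\
  forall beta : R -> R[i],
    inLp setT 1%:E (fun xi : R => beta (lambda_of xi)) ->
    inLp setT 2%:E (fun xi : R => beta (lambda_of xi)) ->
    inLp setT 1%:E (fun xi : R => beta (- lambda_of xi)) ->
    inLp setT 2%:E (fun xi : R => beta (- lambda_of xi)) ->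
    inLp continuous_spectrum +oo%E (fun l : R => (l ^+ n.+2)%:C * beta l) ->
    (cLnorm continuous_spectrum +oo (fun l : R => (l ^+ n)%:C * beta l)%R
       <= eps0%:E)%E ->
    (forall x : R,
       exists Psi : R -> R[i] * R[i],
         marchenko_solution lam mu beta n x Psi /\
         forall Phi : R -> R[i] * R[i],
           marchenko_solution lam mu beta n x Phi ->
           \forall y \ae (@lebesgue_measure R), x < y -> Phi y = Psi y) /\
    (forall Psi : R -> R -> R[i] * R[i],
       (forall x : R, marchenko_solution lam mu beta n x (Psi x)) ->
       forall k : nat, (k < n)%N ->
         Ck_sobolev2 k (n - k) (fun x p : R => Psi x (x + p))).
Proof.
(* With this bound the continuous part of the Hankel operator has norm at most
   1 < 2 sqrt 2. *)
pose eps : R := (2 ^+ (n + 9))^-1.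
have eps0 : 0 < eps by rewrite invr_gt0 exprn_gt0.
exists eps; split => // beta [mp _] _ [mm _] _ /inLpy_bounded[B [B0 bB]].
move=> /(cLnormy_le (ltW eps0)) be; split.
  move=> x.
  have [Psi hPsi] := marchenko_exists lam_bound mu_lt0 B0 (ltW eps0) (lexx eps) mp mm bB be x.
  exists Psi; split => // Phi hPhi.
  exact: (marchenko_unique lam_bound mu_lt0 B0 (ltW eps0) (lexx eps) mp mm bB be hPhi hPsi).
move=> Psi hPsi k kn.
exact: (marchenko_smooth lam_bound mu_lt0 B0 (ltW eps0) (lexx eps) mp mm bB be hPsi kn).
Qed.
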